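(* Let $h:[0,\infty)\to[0,\infty)$ be a function of class $C^2$ with $h(0)=h'(0)=0$, and suppose that there are constants $c_1,c_2>0$ and an exponent $\mu\in(1,\infty)$ such that for all $t\ge 0$ $$c_1(1+t)^{-\mu}\le \min\Big\{h''(t),\frac{h'(t)}{t}\Big\},\qquad \max\Big\{h''(t),\frac{h'(t)}{t}\Big\}\le \frac{c_2}{1+t}.$$ Assume in addition that $\mu<2$. Define $H(\varepsilon):=h(|\varepsilon|)$ for symmetric $2\times 2$ real matrices $\varepsilon$. Let $u\in C^1(\mathbb{R}^2,\mathbb{R}^2)$ be a weak solution on the whole plane of $$-\operatorname{div}\big[\nabla H(\varepsilon(u))\big]+u^k\partial_k u+\nabla\pi=0,\qquad \operatorname{div}u=0 .$$ If $u$ is bounded, i.e. $\sup_{\mathbb{R}^2}|u|<\infty$, then $u$ is a constant vector.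
   Context: Here $\varepsilon(u)=\frac12(\nabla u+(\nabla u)^T)$ is the symmetric gradient, $|\cdot|$ is the Euclidean (Frobenius) norm on matrices, $A:B=\sum_{i,j}A_{ij}B_{ij}$, and repeated indices are summed, so $u^k\partial_k u=\sum_{k=1}^2 u^k\partial_k u$. The quotient $h'(t)/t$ at $t=0$ is understood as its limit $h''(0)$. The symbol $\nabla H=DH$ denotes the gradient of $H$ with respect to the matrix variable, so $DH(\varepsilon)=\frac{h'(|\varepsilon|)}{|\varepsilon|}\varepsilon$ (equal to $0$ at $\varepsilon=0$). The scalar function $\pi$ is an a priori unknown pressure. A field $u\in C^1(\mathbb{R}^2,\mathbb{R}^2)$ is a weak solution of the system if $\operatorname{div}u=0$ on $\mathbb{R}^2$ and $$\int_{\mathbb{R}^2}DH(\varepsilon(u)):\varepsilon(\varphi)\,dx+\int_{\mathbb{R}^2}u^k\,\partial_k u^i\,\varphi^i\,dx=0$$ for all $\varphi\in C_0^\infty(\mathbb{R}^2,\mathbb{R}^2)$ with $\operatorname{div}\varphi=0$ (the pressure is eliminated by using divergence-free test fields). *)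

(* Defs.v *)
From HB Require Import structures.
From mathcomp Require Import all_boot all_order all_algebra.
From mathcomp Require Import all_classical all_reals all_analysis.

Set Implicit Arguments.
Unset Strict Implicit.
Unset Printing Implicit Defensive.

Import Order.TTheory GRing.Theory Num.Theory.
Import numFieldNormedType.Exports.

Local Open Scope classical_set_scope.
Local Open Scope ring_scope.

Section HalfLine.
Context {R : realType}.
Implicit Types f h : R -> R.

(* Difference quotients are taken inside [0, +oo[, so that the derivative at 0
   is the right derivative and values of [f] at negative reals are irrelevant. *)
Definition diffquot_ge0 f (t : R) : R -> R := fun s => (f s - f t) / (s - t).

Definition derivable_ge0 f (t : R) : Prop :=
  cvg (diffquot_ge0 f t @ within `[0, +oo[ (t^')).

Definition derive_ge0 f (t : R) : R :=
  lim (diffquot_ge0 f t @ within `[0, +oo[ (t^')).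

Fixpoint Ck_ge0 (n : nat) f : Prop :=
  if n is n'.+1
  then (forall t, 0 <= t -> derivable_ge0 f t) /\ Ck_ge0 n' (derive_ge0 f)
  else {within `[0, +oo[, continuous f}.

(* h'(t) / t, with its limit h''(0) as the value at t = 0. *)
Definition derive_quot h (t : R) : R :=
  if t == 0 then derive_ge0 (derive_ge0 h) 0 else derive_ge0 h t / t.

End HalfLine.

Section Plane.
Context {R : realType}.

Definition frob_dot m n (A B : 'M[R]_(m, n)) : R :=
  \sum_(i < m) \sum_(j < n) A i j * B i j.

(* Euclidean norm; the library norm `|A| on matrices is the max norm. *)
Definition frob_norm m n (A : 'M[R]_(m, n)) : R := Num.sqrt (frob_dot A A).

Definition mx_gradient (F : 'M[R]_2 -> R) (A : 'M[R]_2) : 'M[R]_2 :=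
  \matrix_(i, j) 'D_(delta_mx i j) F A.

(* H is defined on all 2 x 2 matrices by the same formula. At a symmetric
   matrix its gradient is symmetric, hence it coincides with the gradient
   taken in the space of symmetric matrices, namely (h'(|A|) / |A|) A
   (and 0 at A = 0) when h is C^1 on [0, +oo[ with h'(0) = 0. *)
Definition Hpot (h : R -> R) (A : 'M[R]_2) : R := h (frob_norm A).

Fixpoint Ck (n : nat) (f : 'rV[R]_2 -> 'rV[R]_2) : Prop :=
  if n is n'.+1
  then (forall x, differentiable f x) /\
       (forall j : 'I_2, Ck n' ('D_(delta_mx 0 j) f))
  else continuous f.

(* Points and fields are row vectors, so 'J u x k i is the partial derivative
   of the i-th component of u in the k-th variable. *)
Definition divergence (u : 'rV[R]_2 -> 'rV[R]_2) (x : 'rV[R]_2) : R :=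
  \sum_(i < 2) 'J u x i i.

Definition sym_grad (u : 'rV[R]_2 -> 'rV[R]_2) (x : 'rV[R]_2) : 'M[R]_2 :=
  2^-1 *: ('J u x + ('J u x)^T).

Definition convection (u : 'rV[R]_2 -> 'rV[R]_2) (x : 'rV[R]_2) : 'rV[R]_2 :=
  \row_(i < 2) \sum_(k < 2) u x 0 k * 'J u x k i.

Definition test_field (phi : 'rV[R]_2 -> 'rV[R]_2) : Prop :=
  (forall n, Ck n phi) /\ compact (closure [set x | phi x != 0]).

Definition row_of_pair (p : R * R) : 'rV[R]_2 :=
  \row_(i < 2) (if i == 0 then p.1 else p.2).

(* Integral for the two-dimensional Lebesgue measure, the plane being
   parametrized by pairs of coordinates. *)
Definition plane_integral (f : 'rV[R]_2 -> R) : R :=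
  \int[(@lebesgue_measure R \x @lebesgue_measure R)%E]_(p in setT)
    f (row_of_pair p).

Definition weak_solution (h : R -> R) (u : 'rV[R]_2 -> 'rV[R]_2) : Prop :=
  (forall x, divergence u x = 0) /\
  forall phi, test_field phi -> (forall x, divergence phi x = 0) ->
    plane_integral (fun x =>
      frob_dot (mx_gradient (Hpot h) (sym_grad u x)) (sym_grad phi x)) +
    plane_integral (fun x => frob_dot (convection u x) (phi x)) = 0.

End Plane.

(* Main.v *)
Require Import Defs.
From HB Require Import structures.
From mathcomp Require Import all_boot all_order all_algebra.
From mathcomp Require Import all_classical all_reals all_analysis.
From mathcomp Require Import measurable_realfun ring lra.
Set Implicit Arguments.
Unset Strict Implicit.
Unset Printing Implicit Defensive.
Import Order.TTheory GRing.Theory Num.Theory.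
Import numFieldNormedType.Exports.
Local Open Scope classical_set_scope.
Local Open Scope ring_scope.

(** Why bounded entire solutions are constant.

Write eps for the symmetric gradient of u, tau = DH(eps) for the stress, and M
for a bound of the components of u. No second derivatives of u are available,
so the argument works with difference quotients of step s in the two
coordinate directions and lets s tend to 0 only in integrals of continuous
functions.

Energy estimate. The difference quotient W of u is divergence free, and it has
an explicit stream function: up to sign, the average of one component of u
over the segment from x to x + s e_l, hence bounded by M for every s. The
rotated gradient of (cutoff times stream function) is therefore an admissible
test field, and the difference of the shifted and the unshifted equation
bounds the energy E(r), the integral of a cutoff of radius r against the
product of the quotients of tau and eps. Every error term carries a derivative
of the cutoff, except for a cubic one whose limit at s = 0, summed over the
two directions, is the trace of A A^T A with A = Du; this vanishes for
trace-free 2 x 2 matrices. The outcome is energy_limit: for r >= 1, E(r) is at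
most C/r times (1 + the integral of |Du|^2 over the transition annulus), up to
an error that vanishes with s.

Interpolation. Conversely |Du|^2 = 2 Du : eps - D_i u_j D_j u_i, the last term
being a divergence. Integrating by parts moves a difference quotient from u to
eps, which leaves the bounded factor u; Young's inequality and the coercivity
of the stress, degenerate like (1 + |eps|)^(-mu), then bound the integral of
|Du|^2 by the energy, a lower order term, and a lateral term with the gradient
of the cutoff (interpolation).

Three passes over these two estimates. First, a parameter of order r in
Young's inequality shows that the integral of |Du|^2 over the disc of radius r
grows at most linearly and that E(r) stays bounded (linear_growth,
energy_bounded); here mu < 2 serves to absorb the degenerate weight by a high
power of the cutoff (half_power). Second, the same argument localized to an
annulus bounds E(r) by a multiple of L (E(2r) - E(r/2)) + 1/L + L/r
(energy_recursion); summed over dyadic radii the differences telescope, and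
since E is bounded it has to vanish with s for every r (recursion_vanish,
energy_vanish). Third, without the energy the interpolation inequality bounds
the integral of |Du|^2 by its lateral term alone, and the same telescoping
forces it to be 0 (dirichlet_hi_eq0). So Du = 0. *)

(** * Continuity of pointwise operations *)

Section Continuity.
Context {R : realType}.

Lemma cont_comp (T U W : topologicalType) (g : T -> U) (f : U -> W) :
  continuous g -> continuous f -> continuous (fun x => f (g x)).
Proof. by move=> cg cf x; exact: (continuous_comp (cg x) (cf (g x))). Qed.

Lemma cont_cst (T U : topologicalType) (c : U) : continuous (fun _ : T => c).
Proof. by move=> x; exact: cvg_cst. Qed.

Lemma cont_id (T : topologicalType) : continuous (fun x : T => x).
Proof. by move=> x; exact: cvg_id. Qed.

Variables (T : topologicalType) (W : normedModType R).

Lemma contD (f g : T -> W) :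
  continuous f -> continuous g -> continuous (fun x => f x + g x).
Proof. by move=> cf cg x; apply: cvgD; [exact: cf|exact: cg]. Qed.

Lemma contN (f : T -> W) : continuous f -> continuous (fun x => - f x).
Proof. by move=> cf x; apply: cvgN; exact: cf. Qed.

Lemma contB (f g : T -> W) :
  continuous f -> continuous g -> continuous (fun x => f x - g x).
Proof. by move=> cf cg x; apply: cvgB; [exact: cf|exact: cg]. Qed.

Lemma contZ (a : T -> R) (f : T -> W) :
  continuous a -> continuous f -> continuous (fun x => a x *: f x).
Proof. by move=> cf cg x; apply: cvgZ; [exact: cf|exact: cg]. Qed.

Lemma contM (f g : T -> R) :
  continuous f -> continuous g -> continuous (fun x => f x * g x).
Proof. by move=> cf cg x; apply: cvgM; [exact: cf|exact: cg]. Qed.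

Lemma contX (f : T -> R) n : continuous f -> continuous (fun x => f x ^+ n).
Proof.
move=> cf; elim: n => [|n IH]; first exact: cont_cst.
rewrite (_ : (fun _ => _) = (fun x => f x * f x ^+ n)).
  exact: contM.
by apply: funext => x; rewrite exprS.
Qed.

Lemma cont_norm (f : T -> W) : continuous f -> continuous (fun x => `|f x|).
Proof. by move=> cf; apply: cont_comp => // x; exact: norm_continuous. Qed.

Lemma cont_sum (f : 'I_2 -> T -> W) :
  (forall j, continuous (f j)) -> continuous (fun x => \sum_j f j x).
Proof.
move=> cf; rewrite (_ : (fun _ => _) = (fun x => f 0 x + f 1 x)).
  exact: contD.
by apply: funext => x; rewrite !big_ord_recl big_ord0 addr0; congr (_ + f _ x); exact: val_inj.
Qed.

Lemma cont_max (f g : T -> R) :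
  continuous f -> continuous g -> continuous (fun x => Num.max (f x) (g x)).
Proof. by move=> cf cg x; exact: continuous_max (cf x) (cg x). Qed.

End Continuity.

(** * The plane integral of compactly supported continuous functions *)

Section Integral.
Context {R : realType}.
Notation V := 'rV[R]_2.
Notation mu := (@lebesgue_measure R).
Notation mu2 := (@lebesgue_measure R \x @lebesgue_measure R)%E.
Implicit Types f g : V -> R.

(** The sigma-algebra on the plane is the product one; boxes with rational
centres exhaust an open set countably. *)
Lemma open_prod_measurable (U : set (R * R)) : open U ->
  measurable (U : set (measurableTypeR R * measurableTypeR R)).
Proof.
move=> oU.
pose B (p q : rat) (n : nat) : set (R * R) :=
  ball (ratr p : R) n.+1%:R^-1 `*` ball (ratr q : R) n.+1%:R^-1.
pose C p q n := if `[< B p q n `<=` U >] then B p q n else set0.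
have -> : U = \bigcup_p \bigcup_q \bigcup_n C p q n.
  apply/seteqP; split => [[x y] Uxy|z [p _ [q _ [n _]]]]; last first.
    by rewrite /C; case: asboolP => // h; exact: h.
  have : nbhs (x, y) U by apply: open_nbhs_nbhs.
  move=> /nbhs_ballP[e /= e0 eU].
  have [n ne] : exists n, n.+1%:R^-1 < e / 2.
    have e20 : 0 < e / 2 by rewrite divr_gt0.
    have [n _ nP] := near_infty_natSinv_lt (PosNum e20).
    by exists n; exact: (nP n (leqnn n)).
  have rt (d z : R) : 0 < d -> exists p : rat, ball (ratr p : R) d z.
    move=> d0; have : z - d < z + d by lra.
    move=> /rat_in_itvoo[p]; rewrite in_itv/= => /andP[h1 h2]; exists p.
    by rewrite /ball/= ltr_norml; apply/andP; split; lra.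
  have n0 : 0 < n.+1%:R^-1 :> R by rewrite invr_gt0.
  have [p px] := rt _ x n0; have [q qy] := rt _ y n0.
  move: n0 ne px qy; set d : R := _^-1 => n0 ne px qy.
  exists p => //; exists q => //; exists n => //.
  rewrite /C; case: asboolP => // -[] [a b] [/= pa qb].
  apply: eU; split => /=.
    apply: (@le_ball _ _ _ (d + d)); first lra.
    by apply: (ball_triangle _ pa); exact: ball_sym.
  apply: (@le_ball _ _ _ (d + d)); first lra.
  by apply: (ball_triangle _ qb); exact: ball_sym.
apply: bigcupT_measurable_rat => p; apply: bigcupT_measurable_rat => q.
apply: bigcup_measurable => n _; rewrite /C; case: ifP => // _.
by apply: measurableX; exact: measurable_ball.
Qed.

Lemma continuous_prod_measurable (f : R * R -> R) : continuous f ->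
  measurable_fun [set: measurableTypeR R * measurableTypeR R] f.
Proof.
move=> cf; apply: (measurability _ (RGenOpens.measurableE R)) => //.
move=> _ [_ [a [b ->] <-]]; rewrite setTI.
by apply: open_prod_measurable; apply: open_comp => //; exact: interval_open.
Qed.

Lemma row_of_pair_continuous : continuous (@row_of_pair R).
Proof.
move=> p A /nbhs_ballP[e e0 eA].
have := @nbhsx_ballx _ _ p e e0; apply: filterS => q [h1 h2]; apply: eA.
by split => // i j; rewrite !mxE; case: ifP.
Qed.

Definition csupp f (r : R) := forall x : V, r <= `|x| -> f x = 0.
(** Integrability is automatic in this class, which contains every integrand
below. *)
Definition Cc f := continuous f /\ exists r, csupp f r.

Definition rtrans (v : V) (p : R * R) : R * R := (p.1 + v 0 0, p.2 + v 0 1).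

Lemma addr_measurable (a : R) : measurable_fun [set: measurableTypeR R]
  (fun x : R => x + a : measurableTypeR R).
Proof.
apply: continuous_measurable_fun => x.
by apply: cvgD; [exact: cvg_id|exact: cvg_cst].
Qed.

Lemma lebesgue_shift (a : R) (A : set (measurableTypeR R)) : measurable A ->
  mu ((fun x => x + a) @^-1` A) = mu A.
Proof.
move=> mA; have H := @lebesgue_measure_unique R
  (@pushforward _ _ (measurableTypeR R) (measurableTypeR R) R mu (fun x : R => x + a)).
rewrite [RHS]H//; first exact: addr_measurable.
move=> ? _ [[c d] _ <-]; rewrite /= /pushforward/=.
have -> : (fun x : R => x + a) @^-1` `]c, d] = `]c - a, d - a]%classic.
  by apply/seteqP; split => x; rewrite /= !in_itv/= ltrBlDr lerBrDr.
rewrite !lebesgue_measure_itv /= !lte_fin ltrD2r.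
case: ifP => // _; rewrite -!EFinD; congr EFin; ring.
Qed.

Lemma rtrans_measurable v :
  measurable_fun [set: measurableTypeR R * measurableTypeR R]
    (rtrans v : _ -> measurableTypeR R * measurableTypeR R).
Proof.
apply/measurable_fun_pairP; split => /=.
  by apply: (measurableT_comp (addr_measurable _)); exact: measurable_fst.
by apply: (measurableT_comp (addr_measurable _)); exact: measurable_snd.
Qed.

(** By uniqueness of the product measure it suffices to translate one
coordinate at a time. *)
Lemma lebesgue2_shift (v : V) (A : set (measurableTypeR R * measurableTypeR R)) :
  measurable A -> mu2 (rtrans v @^-1` A) = mu2 A.
Proof.
move=> mA.
have H := @product_measure_unique _ _ _ _ R mu mu
  (@pushforward _ _ _ (measurableTypeR R * measurableTypeR R)%type R mu2 (rtrans v)).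
rewrite [RHS]H//; first exact: rtrans_measurable.
move=> ? B C mB mC; rewrite /pushforward.
rewrite -[LHS]/(mu2 (((fun x => x + v 0 0) @^-1` B) `*`
                       ((fun x => x + v 0 1) @^-1` C))).
rewrite product_measure1E ?lebesgue_shift//.
  by congr (_ * _)%E; exact: lebesgue_shift.
  by have := addr_measurable (v 0 0) measurableT mB; rewrite setTI.
by have := addr_measurable (v 0 1) measurableT mC; rewrite setTI.
Qed.

Lemma ord2P (P : 'I_2 -> Prop) : P 0 -> P 1 -> forall i, P i.
Proof.
move=> P0 P1; case=> -[|[|//]] i.
  by rewrite (_ : Ordinal i = 0)//; exact: val_inj.
by rewrite (_ : Ordinal i = 1)//; exact: val_inj.
Qed.

Lemma coord_le_norm (x : V) i : `|x 0 i| <= `|x|.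
Proof.
rewrite [leRHS]/Num.Def.normr/= mx_normrE.
exact: (le_bigmax _ (fun j : 'I_1 * 'I_2 => `|x j.1 j.2|) (0, i)).
Qed.

Lemma norm_le_coord (x : V) r : 0 <= r -> (forall i, `|x 0 i| <= r) -> `|x| <= r.
Proof.
move=> r0 h; rewrite [leLHS]/Num.Def.normr/= mx_normrE bigmax_le//= => -[i j] _ /=.
by rewrite ord1.
Qed.

Lemma row_of_pair_shift p v : row_of_pair p + v = row_of_pair (rtrans v p).
Proof. by apply/rowP; apply: ord2P; rewrite !mxE. Qed.

Definition pbox (r : R) : set (measurableTypeR R * measurableTypeR R) :=
  `[- r, r] `*` `[- r, r].

Lemma pbox_measurable r : measurable (pbox r).
Proof. by apply: measurableX; exact: measurable_itv. Qed.

Lemma pbox_measure r : 0 <= r -> mu2 (pbox r) = (4 * r ^+ 2)%:E.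
Proof.
move=> r0.
transitivity (mu `[(- r)%R, r] * mu `[(- r)%R, r])%E.
  by apply: product_measure1E; exact: measurable_itv.
rewrite !lebesgue_measure_itv /= !lte_fin; case: ifPn => h.
  by rewrite -!EFinD -EFinM; congr EFin; ring.
have -> : r = 0 by lra.
by rewrite mul0e expr0n mulr0.
Qed.

Lemma csupp_pbox f r : 0 <= r -> csupp f r -> forall p, ~ pbox r p ->
  f (row_of_pair p) = 0.
Proof.
move=> r0 sf p np; apply: sf; rewrite leNgt; apply/negP => h; apply: np.
have c i := le_lt_trans (coord_le_norm (row_of_pair p) i) h.
have := c 0; have := c 1; rewrite !mxE/= => h1 h2.
by split; rewrite /= in_itv/= -ler_norml ltW.
Qed.

Lemma ball_compact (r : R) : compact [set x : V | `|x| <= r].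
Proof.
apply: bounded_closed_compact.
  by exists r; split; [exact: num_real|move=> M rM x /= /le_trans; apply; exact: ltW].
apply: (@closed_comp _ _ (fun x : V => `|x|) [set y | y <= r]).
  by move=> x _; exact: norm_continuous.
exact: closed_le.
Qed.

Lemma continuous_compact_bound f r : continuous f ->
  exists M, 0 <= M /\ forall x, `|x| <= r -> `|f x| <= M.
Proof.
move=> cf.
have [M [_ HM]] := compact_bounded (continuous_compact (continuous_subspaceT cf) (@ball_compact r)).
exists (`|M| + 1); split=> [|x xr]; first by rewrite addr_ge0.
apply: (HM (`|M| + 1)); last by exists x.
by rewrite (le_lt_trans (ler_norm _))// ltrDl.
Qed.

Lemma Cc_bound f : Cc f -> exists M r, [/\ 0 <= M, 0 <= r, csupp f r & forall x, `|f x| <= M].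
Proof.
move=> [cf [r sf]]; have [M [M0 HM]] := continuous_compact_bound (`|r|) cf.
exists M, `|r|; split => // x.
  by move=> rx; apply: sf; apply: le_trans rx; exact: ler_norm.
have [|h] := leP `|x| `|r|; first exact: HM.
by rewrite sf ?normr0//; apply: le_trans (ler_norm _) (ltW h).
Qed.

Lemma pbox_indic_integrable r : 0 <= r ->
  mu2.-integrable setT (EFin \o (\1_(pbox r) : _ -> R)).
Proof.
move=> r0; have mb := pbox_measurable r; apply/integrableP; split.
  by apply/measurable_EFinP; exact: measurable_indic.
under eq_integral do rewrite /= ger0_norm//.
by rewrite integral_indic// setIT [ltLHS](pbox_measure r0) ltry.
Qed.

Lemma indic_integrable (M r : R) : 0 <= r ->
  mu2.-integrable setT (EFin \o (fun p => M * \1_(pbox r) p)).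
Proof.
move=> r0; apply: (eq_integrable _ (fun p => M%:E * (\1_(pbox r) p)%:E)%E) => //.
by apply: integrableZl => //; exact: pbox_indic_integrable.
Qed.

Lemma I_integrable f : Cc f ->
  mu2.-integrable setT (EFin \o (f \o @row_of_pair R)).
Proof.
move=> Cf; have [M [r [M0 r0 sf bf]]] := Cc_bound Cf.
apply: (le_integrable _ _ _ (indic_integrable M r0)) => //.
  apply/measurable_EFinP; apply: continuous_prod_measurable.
  move=> p; apply: continuous_comp; first exact: row_of_pair_continuous.
  exact: Cf.1.
move=> p _ /=; rewrite lee_fin indicE.
have [|np] := boolP (p \in pbox r); first by rewrite mulr1 (ger0_norm M0).
by rewrite (csupp_pbox r0 sf) ?normr0 ?mulr0 ?normr0//; move/negP: np; rewrite inE.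
Qed.

Notation I := (@plane_integral R).

Lemma ID f g : Cc f -> Cc g -> I (fun x => f x + g x) = I f + I g.
Proof. by move=> Cf Cg; apply: RintegralD => //; exact: I_integrable. Qed.

Lemma IB f g : Cc f -> Cc g -> I (fun x => f x - g x) = I f - I g.
Proof. by move=> Cf Cg; apply: RintegralB => //; exact: I_integrable. Qed.

Lemma IZ c f : Cc f -> I (fun x => c * f x) = c * I f.
Proof. by move=> Cf; apply: RintegralZl => //; exact: I_integrable. Qed.

Lemma I_le f g : Cc f -> Cc g -> (forall x, f x <= g x) -> I f <= I g.
Proof.
by move=> Cf Cg fg; apply: le_Rintegral => //; exact: I_integrable.
Qed.

Lemma I_ge0 f : (forall x, 0 <= f x) -> 0 <= I f.
Proof. by move=> f0; apply: Rintegral_ge0. Qed.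

Lemma I_bound f K r : 0 <= r -> continuous f -> csupp f r -> (forall x, `|f x| <= K) ->
  `|I f| <= K * (4 * r ^+ 2).
Proof.
move=> r0 cf sf bf; have Cf : Cc f by split => //; exists r.
have K0 : 0 <= K by apply: le_trans (bf 0).
apply: le_trans (le_normr_Rintegral _ (I_integrable Cf)) _ => //.
apply: (@le_trans _ _ (\int[mu2]_p (K * \1_(pbox r) p))).
  apply: le_Rintegral => //.
  - by have := integrable_abse (I_integrable Cf).
  - exact: indic_integrable.
  move=> p _ /=; rewrite indicE.
  have [|np] := boolP (p \in pbox r); first by rewrite mulr1.
  by rewrite (csupp_pbox r0 sf) ?normr0 ?mulr0 ?normr0//; move/negP: np; rewrite inE.
rewrite RintegralZl//; last exact: pbox_indic_integrable.
rewrite /Rintegral integral_indic//; last exact: pbox_measurable.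
by rewrite setIT [X in fine X]pbox_measure.
Qed.

Lemma Cc_shift f v : Cc f -> Cc (fun x => f (x + v)).
Proof.
move=> Cf; split.
  apply: cont_comp Cf.1; apply: contD; [exact: cont_id|exact: cont_cst].
have [M [r [_ r0 sf _]]] := Cc_bound Cf; exists (r + `|v|) => x h; apply: sf.
by have := ler_normB (x + v) v; rewrite addrK; lra.
Qed.

Lemma I_shift f (v : V) : Cc f -> I (fun x => f (x + v)) = I f.
Proof.
move=> Cf; have m := rtrans_measurable v.
have iS : mu2.-integrable setT (EFin \o (f \o @row_of_pair R) \o rtrans v).
  have := I_integrable (Cc_shift v Cf); apply: eq_integrable => // p _ /=.
  by rewrite row_of_pair_shift.
have mf := measurable_int _ (I_integrable Cf).
have E := integral_pushforward m mf iS measurableT.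
rewrite /plane_integral /Rintegral; congr fine.
transitivity (\int[mu2]_p ((EFin \o (f \o @row_of_pair R) \o rtrans v) p))%E.
  by apply: eq_integral => p _ /=; rewrite row_of_pair_shift.
rewrite -[LHS]E; apply: eq_measure_integral => A mA _.
exact: lebesgue2_shift.
Qed.

(** The integral bounds at the end only give vanishing integrals; this turns
them into a pointwise identity. *)
Lemma I_gt0 f (x0 : V) : Cc f -> (forall x, 0 <= f x) -> 0 < f x0 -> 0 < I f.
Proof.
move=> Cf f0 fx0; rewrite -(I_shift x0 Cf).
have [cg sg] := Cc_shift x0 Cf; set g := fun x => f (x + x0) in cg sg *.
have g0 : 0 < g 0 by rewrite /g add0r.
have : \forall x \near (0 : V), g 0 / 2 < g x.
  by apply: (cvgr_gt (g 0) (cg 0)); lra.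
move=> /nbhs_ballP[e /= e0 eg].
have e20 : 0 <= e / 2 by lra.
(* After translation f is at least half its value on a small square. *)
apply: (@lt_le_trans _ _ (\int[mu2]_p (g 0 / 2 * \1_(pbox (e / 2)) p))).
  rewrite RintegralZl//; last exact: pbox_indic_integrable.
  rewrite /Rintegral integral_indic//; last exact: pbox_measurable.
  rewrite setIT [X in fine X]pbox_measure//=.
  by rewrite !mulr_gt0// ?divr_gt0.
apply: le_Rintegral => //.
- exact: (indic_integrable (g 0 / 2) e20).
- exact: I_integrable.
move=> p _; rewrite indicE; have [|_] := boolP (p \in pbox (e / 2)); last first.
  by rewrite mulr0; exact: f0.
rewrite inE mulr1 => -[/=]; rewrite !in_itv/= -!ler_norml => h1 h2.
apply/ltW/eg; rewrite -ball_normE /= sub0r normrN.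
apply: (@le_lt_trans _ _ (e / 2)); last lra.
by apply: norm_le_coord => //; apply: ord2P; rewrite !mxE.
Qed.

End Integral.

(** * Segment averages and difference quotients *)

Section Averages.
Context {R : realType}.
Notation V := 'rV[R]_2.
Notation mu := (@lebesgue_measure R).
Notation I := (@plane_integral R).
Notation e := (fun l : 'I_2 => delta_mx 0 l : 'rV[R]_2).
Implicit Types f g : V -> R.

(** The tube lemma for a continuous function of two variables: over a compact
set the convergence is uniform, which is how limits are taken under the
integrals. *)
Lemma near_uniform (P Y : topologicalType) (F : P -> Y -> R) (K : set Y) p0 (d : R) :
  compact K -> continuous (fun q : P * Y => F q.1 q.2) -> 0 < d ->
  \forall p \near p0, forall y, K y -> `|F p y - F p0 y| < d.
Proof.
move=> /compact_near_coveringP cK cF d0.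
apply: (cK P (nbhs p0) (fun p y => `|F p y - F p0 y| < d)) => y Ky.
have d20 : 0 < d / 2 by rewrite divr_gt0.
have c1 := cF (p0, y).
have /cvgrPdist_lt /(_ _ d20)[/= [A B] [/= nA nB] AB] := c1.
exists (B, A) => //= -[y' p] [/= By Ap].
have h1 := AB (p, y') (conj Ap By).
have h2 := AB (p0, y') (conj (nbhs_singleton nA) By).
move: h1 h2; rewrite /= => h1 h2.
rewrite (_ : F p y' - F p0 y' = (F p0 y - F p0 y') - (F p0 y - F p y')); last ring.
apply: (le_lt_trans (ler_normB _ _)); lra.
Qed.

Definition unit_integral (f : R -> R) : R := \int[mu]_(t in `[0, 1]) f t.
Notation J := unit_integral.

Lemma unit_integrable (f : R -> R) : continuous f ->
  mu.-integrable `[0, 1] (EFin \o f).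
Proof.
move=> cf; apply: continuous_compact_integrable; first exact: segment_compact.
exact: continuous_subspaceT.
Qed.

Lemma JB (f g : R -> R) : continuous f -> continuous g -> J (fun t => f t - g t) = J f - J g.
Proof. by move=> cf cg; apply: RintegralB => //; exact: unit_integrable. Qed.

Lemma J_cst (c : R) : J (fun=> c) = c.
Proof.
rewrite /J Rintegral_cst// (_ : fine _ = 1) ?mulr1//.
rewrite [X in fine X](lebesgue_measure_itv `[0%R, 1%R]) /= lte_fin ltr01.
by rewrite oppr0 adde0.
Qed.

Lemma J_bound (f : R -> R) K : continuous f ->
  (forall t, t \in `[0, 1] -> `|f t| <= K) -> `|J f| <= K.
Proof.
move=> cf bf; have := unit_integrable cf => i.
apply: le_trans (le_normr_Rintegral _ i) _ => //.
apply: (@le_trans _ _ (\int[mu]_(t in `[0, 1]) K)).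
  apply: le_Rintegral => //; first by have := integrable_abse i.
    exact: (@unit_integrable (fun=> K) (@cont_cst _ _ K)).
by rewrite [leLHS]J_cst.
Qed.

Lemma cont_slice (P Y : topologicalType) (F : P -> Y -> R) p :
  continuous (fun q : P * Y => F q.1 q.2) -> continuous (F p).
Proof.
move=> cF; apply: (cont_comp (g := fun y => (p, y)) (f := fun q => F q.1 q.2)) cF.
by move=> y; apply: cvg_pair => //=; exact: cvg_cst.
Qed.

Lemma J_continuous (P : topologicalType) (F : P -> R -> R) :
  continuous (fun q : P * R => F q.1 q.2) -> continuous (fun p => J (F p)).
Proof.
move=> cF p0; apply/cvgrPdist_le => d d0.
have := near_uniform p0 (@segment_compact R 0 1) cF d0.
apply: filterS => p Hp; rewrite distrC -JB; [|exact: cont_slice..].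
apply: J_bound; first by apply: contB; exact: cont_slice.
by move=> t t01; apply/ltW/Hp.
Qed.

Lemma I_continuous (P : topologicalType) (F : P -> V -> R) r p0 :
  continuous (fun q : P * V => F q.1 q.2) ->
  (\forall p \near p0, csupp (F p) r) ->
  {for p0, continuous (fun p => I (F p))}.
Proof.
move=> cF nr; apply/cvgrPdist_le => d d0.
set r1 := `|r| + 1; have r10 : 0 <= r1 by rewrite addr_ge0.
have nr1 : \forall p \near p0, csupp (F p) r1.
  apply: filterS nr => p h x hx; apply: h; apply: le_trans hx.
  by apply: le_trans (ler_norm r) _; rewrite lerDl.
have k0 : 0 < 4 * r1 ^+ 2 by rewrite mulr_gt0// exprn_gt0// ltr_wpDl.
have d'0 : 0 < d / (4 * r1 ^+ 2) by rewrite divr_gt0.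
have H := near_uniform p0 (@ball_compact R r1) cF d'0.
have s0 := nbhs_singleton nr1.
near=> p.
have sp : csupp (F p) r1 by near: p.
have Hp : forall y, `|y| <= r1 -> `|F p y - F p0 y| < d / (4 * r1 ^+ 2) by near: p.
rewrite distrC -IB; [|by split; [exact: cont_slice|exists r1]..].
rewrite -(@divfK _ (4 * r1 ^+ 2) _ d) ?gt_eqF//; apply: I_bound => //.
- by apply: contB; exact: cont_slice.
- by move=> x hx; rewrite sp// s0// subrr.
move=> x; have [h|h] := leP `|x| r1; first exact/ltW/Hp.
by rewrite sp ?s0 ?subrr ?normr0; [exact: ltW|exact: ltW..].
Unshelve. all: by end_near. Qed.

(** Caratheodory's form of differentiability: exhibiting a continuous quotient
q reduces a derivative to a continuity statement. *)
Lemma is_derive_quot (U : normedModType R) (f : U -> R) (x v : U) (q : R -> R) : {for 0, continuous q} ->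
  (forall h, f (h *: v + x) - f x = h * q h) -> is_derive x v f (q 0).
Proof.
move=> cq fq.
have H : h^-1 *: (f (h *: v + x) - f x) @[h --> 0^'] --> q 0.
  apply: (@cvg_trans _ (q @ 0^')); last by apply: cvg_within_filter; exact: cq.
  apply: near_eq_cvg; near=> h.
  have h0 : h != 0 by near: h; exact: nbhs_dnbhs_neq.
  by rewrite fq /GRing.scale/= mulKf.
by apply: DeriveDef; [apply/cvg_ex; exists (q 0)|exact: cvg_lim].
Unshelve. all: by end_near. Qed.

(** The partial derivatives are carried as data, since the fields built below
are C1 with explicitly known partials. *)
Definition isC1 (f : V -> R) (df : 'I_2 -> V -> R) := continuous f /\
  forall j, (forall x, is_derive x (e j) f (df j x)) /\ continuous (df j).

(** Hadamard's device: applied to the partial derivative of f in direction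
e_l, this average is the difference quotient of f (avg_quot), and it is
jointly continuous in the step s and the point, including at s = 0. *)
Definition avg (l : 'I_2) f (s : R) (x : V) := J (fun t => f (x + (t * s) *: e l)).

Lemma cont_fst (S T : topologicalType) : continuous (fun q : S * T => q.1).
Proof. by move=> q; exact: cvg_fst. Qed.

Lemma cont_snd (S T : topologicalType) : continuous (fun q : S * T => q.2).
Proof. by move=> q; exact: cvg_snd. Qed.

Lemma cont_pair (T0 S T : topologicalType) (f : T0 -> S) (g : T0 -> T) :
  continuous f -> continuous g -> continuous (fun x => (f x, g x)).
Proof. by move=> cf cg x; apply: cvg_pair; [exact: cf|exact: cg]. Qed.

Lemma avg_continuous l f : continuous f ->
  continuous (fun q : R * V => avg l f q.1 q.2).
Proof.
move=> cf.
apply: (J_continuous (F := fun (q : R * V) t => f (q.2 + (t * q.1) *: e l))).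
apply: cont_comp cf; apply: contD.
  by apply: cont_comp (@cont_snd _ _); exact: cont_fst.
apply: contZ; last exact: cont_cst.
apply: contM; first exact: cont_snd.
by apply: (cont_comp (f := fst)); exact: cont_fst.
Qed.

Lemma avg0 l f x : avg l f 0 x = f x.
Proof.
rewrite /avg (_ : (fun _ => _) = fun=> f x) ?J_cst//.
by apply: funext => t; rewrite mulr0 scale0r addr0.
Qed.

Lemma line_derive f (x v : V) (d : R -> R) t :
  is_derive (x + t *: v) v f (d t) ->
  is_derive t 1 (fun s => f (x + s *: v)) (d t).
Proof.
move=> [df fd].
have E : (fun h : R => h^-1 *: (f (x + (h *: 1 + t) *: v) - f (x + t *: v))) =
         (fun h => h^-1 *: (f (h *: v + (x + t *: v)) - f (x + t *: v))).
  apply: funext => h; congr (_ *: (f _ - _)).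
  by rewrite scalerDl /GRing.scale/= mulr1 addrCA addrA.
apply: DeriveDef; first by rewrite /derivable /= E.
by rewrite /derive /= E.
Qed.

Lemma JZ c (f : R -> R) : continuous f -> J (fun t => c * f t) = c * J f.
Proof. by move=> cf; apply: RintegralZl => //; exact: unit_integrable. Qed.

Lemma line_FTC f df (x v : V) s : continuous df ->
  (forall y, is_derive y v f (df y)) ->
  s * J (fun t => df (x + (t * s) *: v)) = f (x + s *: v) - f x.
Proof.
move=> cdf dd.
have cl : continuous (fun t : R => df (x + (t * s) *: v)).
  apply: cont_comp cdf; apply: contD; first exact: cont_cst.
  by apply: contZ; [apply: contM; [exact: cont_id|exact: cont_cst]|exact: cont_cst].
rewrite -JZ//.
pose F t := f (x + (t * s) *: v).
have D t : is_derive t (1:R) F (s * df (x + (t * s) *: v)).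
  rewrite mulrC.
  apply: (is_derive1_comp (f := fun t => f (x + t *: v)) (g := fun t => t * s)).
    exact: (line_derive (d := fun t => df (x + t *: v))).
  apply: (is_derive_eq (is_deriveM (is_derive_id t 1) (is_derive_cst s t 1))).
  by rewrite /GRing.scale /= mulr0 add0r mulr1.
have cF : continuous F.
  move=> t; apply: differentiable_continuous.
  by apply/derivable1_diffP; exact: ex_derive.
have := @continuous_FTC2 R (fun t => s * df (x + (t * s) *: v)) F 0 1.
rewrite /J /Rintegral => -> //.
- by rewrite /F mul1r mul0r scale0r addr0.
- by apply: continuous_subspaceT; apply: contM; [exact: cont_cst|].
- split; first by move=> t _; exact: ex_derive.
    by apply: cvg_at_right_filter; exact: cF.
  by apply: cvg_at_left_filter; exact: cF.
- by move=> t _; rewrite derive1E; exact: derive_val.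
Qed.

Lemma avg_quot l f df s x : isC1 f df ->
  f (x + s *: e l) - f x = s * avg l (df l) s x.
Proof. by move=> [_ H]; rewrite -(line_FTC x s (H l).2 (H l).1). Qed.

Lemma norm_scale_basis c l : `|c *: e l| <= `|c|.
Proof.
apply: norm_le_coord => // i; rewrite !mxE/=.
by case: (_ == _); rewrite ?mulr1// mulr0 normr0.
Qed.

Lemma avg_csupp l f r s : csupp f r -> csupp (avg l f s) (r + `|s|).
Proof.
move=> sf x hx; rewrite /avg -(J_cst 0); apply: eq_Rintegral => t.
rewrite inE/= in_itv/= => /andP[t0 t1]; apply: sf.
have := norm_scale_basis (t * s) l; rewrite normrM (ger0_norm t0) => h.
have := ler_normB (x + (t * s) *: e l) ((t * s) *: e l); rewrite addrK => h'.
have := ler_piMl (normr_ge0 s) t1; lra.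
Qed.

(** Averaging avg_quot in direction e_j over the segment in direction e_l
gives a Caratheodory quotient. *)
Lemma is_derive_avg l f df s x j : isC1 f df ->
  is_derive x (e j) (avg l f s) (avg l (df j) s x).
Proof.
move=> Cf.
have cl g h : continuous g -> continuous (fun t : R => g (h + x + (t * s) *: e l)).
  move=> cg; apply: cont_comp cg; apply: contD; first exact: cont_cst.
  by apply: contZ; [apply: contM; [exact: cont_id|exact: cont_cst]|exact: cont_cst].
have cA : continuous (fun q : R * R => avg j (df j) q.1 (x + (q.2 * s) *: e l)).
  apply: (cont_comp (g := fun q : R * R => (q.1, x + (q.2 * s) *: e l))
    (f := fun q => avg j (df j) q.1 q.2)); last by apply: avg_continuous; exact: (Cf.2 j).2.
  apply: cont_pair; first exact: cont_fst.
  apply: (contD (f := fun=> x) (g := fun q : R * R => (q.2 * s) *: e l)); first exact: cont_cst.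
  by apply: contZ; [apply: contM; [exact: cont_snd|exact: cont_cst]|exact: cont_cst].
have := @is_derive_quot _ (avg l f s) x (e j)
   (fun h => J (fun t => avg j (df j) h (x + (t * s) *: e l))).
have -> : J (fun t => avg j (df j) 0 (x + (t * s) *: e l)) = avg l (df j) s x.
  by congr J; apply: funext => t; rewrite avg0.
apply.
  exact: (@J_continuous _ (fun h t => avg j (df j) h (x + (t * s) *: e l)) cA).
move=> h; rewrite -JZ; last first.
  exact: (@cont_slice R R (fun h t => avg j (df j) h (x + (t * s) *: e l)) h cA).
rewrite -JB; [|exact: cl Cf.1|by rewrite -[x]add0r; exact: cl Cf.1].
congr J; apply: funext => t.
by rewrite -(avg_quot _ _ _ Cf); congr (f _ - _); rewrite -addrA addrC.
Qed.

Lemma avg_C1 l f df s : isC1 f df ->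
  isC1 (avg l f s) (fun j => avg l (df j) s).
Proof.
move=> Cf; have c g : continuous g -> continuous (avg l g s).
  by move=> cg; apply: (@cont_slice _ _ (avg l g) s); exact: avg_continuous.
split; first exact: c Cf.1.
move=> j; split; last exact: c (Cf.2 j).2.
by move=> x; exact: is_derive_avg.
Qed.

Lemma quot_csupp f df l r s : isC1 f df -> csupp f r -> s != 0 ->
  csupp (avg l (df l) s) (r + `|s|).
Proof.
move=> Cf sf s0 x hx; apply: (mulfI s0); rewrite -(avg_quot _ _ _ Cf) mulr0.
have h := norm_scale_basis s l; have h0 := normr_ge0 s.
have := ler_normB (x + s *: e l) (s *: e l); rewrite addrK => h'.
by rewrite !sf ?subrr//; lra.
Qed.

Lemma cvg_eq0 (q : R -> R) : {for 0, continuous q} ->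
  (\forall s \near 0^', q s = 0) -> q 0 = 0.
Proof.
move=> cq q0.
have H : q @ 0^' --> q 0 by apply: cvg_within_filter; exact: cq.
have H' : q @ 0^' --> (0 : R).
  apply: (@cvg_trans _ ((fun=> 0) @ 0^')); last exact: cvg_cst.
  by apply: near_eq_cvg; apply: filterS q0 => s ->.
exact: (cvg_unique _ H H').
Qed.

Lemma small_near0 : \forall s \near (0 : R), `|s| <= 1.
Proof. by apply: filterS (nbhs0_lt (@ltr01 R)) => s; exact: ltW. Qed.

(** A difference quotient of step at most 1 vanishes at distance 1 from the
support, and the partial derivative is its limit. *)
Lemma partial_csupp f df j r : isC1 f df -> csupp f r -> csupp (df j) (r + 1).
Proof.
move=> Cf sf x hx; rewrite -(avg0 j).
have c : continuous (fun s : R => avg j (df j) s x).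
  apply: (cont_comp (g := fun s => (s, x)) (f := fun q => avg j (df j) q.1 q.2)).
    by apply: cont_pair; [exact: cont_id|exact: cont_cst].
  by apply: avg_continuous; exact: (Cf.2 j).2.
apply: (@cvg_eq0 (fun s => avg j (df j) s x) (c 0)).
near=> s.
have s0 : s != 0 by near: s; exact: nbhs_dnbhs_neq.
have Q := @quot_csupp f df j r s Cf sf s0. apply: Q.
have : `|s| <= 1 by near: s; apply: cvg_within; exact: small_near0.
lra.
Unshelve. all: by end_near. Qed.

Lemma partial_Cc f df j : isC1 f df -> Cc f -> Cc (df j).
Proof.
move=> Cf [_ [r sf]]; split; first exact: (Cf.2 j).2.
by exists (r + 1); exact: partial_csupp sf.
Qed.

Lemma I_avg_cvg l f r : continuous f -> csupp f r ->
  {for 0, continuous (fun s => I (avg l f s))}.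
Proof.
move=> cf sf; apply: (@I_continuous _ (avg l f) (r + 1)).
  exact: avg_continuous.
apply: filterS small_near0 => s s1 x hx.
by have Q := @avg_csupp l f r s sf; apply: Q; lra.
Qed.

(** Translation invariance kills the mean of the difference quotients, hence
of their limit. *)
Lemma I_partial0 f df j : isC1 f df -> Cc f -> I (df j) = 0.
Proof.
move=> Cf Ccf; have [_ [r sf]] := Ccf.
have -> : I (df j) = I (avg j (df j) 0).
  by congr I; apply: funext => x; rewrite avg0.
apply: (@cvg_eq0 (fun s => I (avg j (df j) s))).
  by apply: I_avg_cvg (@partial_csupp f df j r Cf sf); exact: (Cf.2 j).2.
near=> s.
have s0 : s != 0 by near: s; exact: nbhs_dnbhs_neq.
apply: (mulfI s0); rewrite mulr0 -IZ; last first.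
  split; last by exists (r + `|s|); exact: quot_csupp sf s0.
  by apply: (@cont_slice R V (avg j (df j)) s); apply: avg_continuous; exact: (Cf.2 j).2.
under eq_fun do rewrite -(avg_quot _ _ _ Cf).
by rewrite IB//; [rewrite I_shift// subrr|exact: Cc_shift].
Unshelve. all: by end_near. Qed.

End Averages.

(** * Calculus of C1 functions on the plane *)

Section C1Calculus.
Context {R : realType}.
Notation V := 'rV[R]_2.
Notation I := (@plane_integral R).
Notation e := (fun l : 'I_2 => delta_mx 0 l : 'rV[R]_2).
Implicit Types f g : V -> R.

Lemma isC1_ext f df dg : isC1 f df -> (forall j x, df j x = dg j x) -> isC1 f dg.
Proof.
move=> Cf E; have -> : dg = df by apply: funext => j; apply: funext => x; rewrite E.
exact: Cf.
Qed.

Lemma isC1_cst (c : R) : isC1 (fun=> c) (fun _ _ => 0).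
Proof.
by split=> [|j]; [exact: cont_cst|split=> [x|]; [exact: is_derive_cst|exact: cont_cst]].
Qed.

Lemma isC1D f g df dg : isC1 f df -> isC1 g dg ->
  isC1 (fun x => f x + g x) (fun j x => df j x + dg j x).
Proof.
move=> [cf Hf] [cg Hg]; split; first exact: contD.
move=> j; split=> [x|]; last exact: contD (Hf j).2 (Hg j).2.
by apply: is_deriveD; [exact: (Hf j).1|exact: (Hg j).1].
Qed.

Lemma isC1M f g df dg : isC1 f df -> isC1 g dg ->
  isC1 (fun x => f x * g x) (fun j x => df j x * g x + f x * dg j x).
Proof.
move=> [cf Hf] [cg Hg]; split; first exact: contM.
move=> j; split=> [x|]; last first.
  by apply: contD; apply: contM => //; [exact: (Hf j).2|exact: (Hg j).2].
apply: (is_derive_eq (is_deriveM ((Hf j).1 x) ((Hg j).1 x))).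
by rewrite /GRing.scale/= addrC mulrC.
Qed.

Lemma isC1Z c f df : isC1 f df -> isC1 (fun x => c * f x) (fun j x => c * df j x).
Proof.
move=> Hf; apply: (isC1_ext (isC1M (isC1_cst c) Hf)) => j x.
by rewrite mul0r add0r.
Qed.

Lemma isC1N f df : isC1 f df -> isC1 (fun x => - f x) (fun j x => - df j x).
Proof.
move=> Hf; have := isC1Z (-1) Hf.
by under eq_fun do rewrite mulN1r; move/isC1_ext; apply=> j x; rewrite mulN1r.
Qed.

Lemma isC1B f g df dg : isC1 f df -> isC1 g dg ->
  isC1 (fun x => f x - g x) (fun j x => df j x - dg j x).
Proof. by move=> Hf Hg; exact: (isC1D Hf (isC1N Hg)). Qed.

Lemma cont_coord i : continuous (fun x : V => x 0 i).
Proof. exact: coord_continuous. Qed.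

Lemma isC1_coord i : isC1 (fun x : V => x 0 i) (fun j _ => (i == j)%:R).
Proof.
split; first exact: cont_coord.
move=> j; split=> [x|]; last exact: cont_cst.
have := @is_derive_quot R _ (fun x : V => x 0 i) x (e j) (fun=> (i == j)%:R).
by apply; [exact: cst_continuous|move=> h; rewrite !mxE /= addrK].
Qed.

Lemma line_is_derive (U : normedModType R) (f : U -> R) (x v : U) d :
  is_derive (0 : R) 1 (fun s : R => f (x + s *: v)) d -> is_derive x v f d.
Proof.
move=> [df fd].
have E : (fun h : R => h^-1 *: (f (x + (h *: 1 + 0 : R) *: v) - f (x + (0 : R) *: v))) =
         (fun h : R => h^-1 *: (f (h *: v + x) - f x)).
  apply: funext => h; congr (_ *: (f _ - f _)); last by rewrite scale0r addr0.
  by rewrite addr0 /GRing.scale/= mulr1 addrC.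
move: df fd; rewrite /derivable /derive /= E => df fd.
by apply: DeriveDef.
Qed.

Lemma isC1_comp (F F' : R -> R) f df : (forall t, is_derive t (1 : R) F (F' t)) ->
  continuous F' -> isC1 f df -> isC1 (fun x => F (f x)) (fun j x => F' (f x) * df j x).
Proof.
move=> dF cF' [cf Hf].
have cF : continuous F.
  by move=> t; apply: differentiable_continuous; apply/derivable1_diffP; exact: ex_derive.
split; first exact: cont_comp cf cF.
move=> j; split=> [x|]; last first.
  by apply: contM; [exact: cont_comp cf cF'|exact: (Hf j).2].
apply: line_is_derive.
have -> : f x = f (x + 0 *: e j) by rewrite scale0r addr0.
apply: (is_derive1_comp (f := F) (g := fun s : R => f (x + s *: e j))) => //.
apply: (line_derive (d := fun s => df j x)); rewrite scale0r addr0; exact: (Hf j).1.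
Qed.

Lemma isC1_comp_shift f df v : isC1 f df ->
  isC1 (fun x => f (x + v)) (fun j x => df j (x + v)).
Proof.
have cs : continuous (fun x : V => x + v).
  by apply: contD; [exact: cont_id|exact: cont_cst].
move=> Hf; split; first exact: cont_comp cs Hf.1.
move=> j; split=> [x|]; last exact: cont_comp cs (Hf.2 j).2.
have Cd := (Hf.2 j).2.
have := @is_derive_quot R _ (fun x => f (x + v)) x (e j) (fun s => avg j (df j) s (x + v)).
rewrite avg0; apply.
  apply: (cont_comp (g := fun s => (s, x + v)) (f := fun q => avg j (df j) q.1 q.2)).
    by apply: cont_pair; [exact: cont_id|exact: cont_cst].
  exact: avg_continuous.
by move=> h; rewrite -(avg_quot _ _ _ Hf) -addrA addrC.
Qed.

Lemma differentiable_second_order (U W : normedModType R) (F : U -> W) (x : U) :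
  (forall d, 0 < d -> \forall h \near (0 : U), `|F (h + x) - F x| <= d * `|h|) ->
  differentiable F x.
Proof.
move=> small.
have o : F \o shift x = cst (F x) + \0 +o_ 0 id.
  apply/eqaddoP => _/posnumP[d]; apply: filterS (small _ (gt0 d)) => h /=.
  by rewrite !fctE addr0.
have E : ('d F x : U -> W) = 0.
  by apply: diff_unique => //; exact: cst_continuous.
apply/diff_locallyP; rewrite E; split; [exact: cst_continuous|exact: o].
Qed.

(** The product of a vanishing coordinate with a vanishing continuous function
is of second order. *)
Lemma differentiable_coordM0 (g : V -> R) (x : V) i : {for x, continuous g} ->
  differentiable (fun y : V => (y 0 i - x 0 i) * (g y - g x)) x.
Proof.
move=> cg; apply: differentiable_second_order => d d0.
have cg' : g (h + x) @[h --> (0 : V)] --> g x.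
  apply: (@cvg_comp _ _ _ (fun h : V => h + x) g _ (nbhs x)); last exact: cg.
  have := @contD R _ V id (fun=> x) (@cont_id _) (@cont_cst _ _ x) 0.
  by rewrite /continuous_at /= add0r.
have /cvgrPdist_lt /(_ _ d0) := cg'; apply: filterS => h hd.
rewrite subrr mul0r subr0 mxE addrK normrM mulrC.
apply: ler_pM => //; first by rewrite distrC ltW.
exact: coord_le_norm.
Qed.

Lemma row2_split (h : V) : h = h 0 0 *: e 0 + h 0 1 *: e 1.
Proof. by apply/rowP; apply: ord2P; rewrite !mxE /= ?mulr1 ?mulr0 ?addr0 ?add0r. Qed.

(** By avg_quot along both axes, f differs from an affine function by a sum of
products of the kind treated in differentiable_coordM0. *)
Lemma isC1_differentiable f df x : isC1 f df -> differentiable f x.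
Proof.
move=> Hf.
pose g0 (y : V) := avg 0 (df 0) (y 0 0 - x 0 0) x.
pose g1 (y : V) := avg 1 (df 1) (y 0 1 - x 0 1) (x + (y 0 0 - x 0 0) *: e 0).
have cc i : continuous (fun y : V => y 0 i - x 0 i).
  by apply: contB; [exact: cont_coord|exact: cont_cst].
have cg0 : continuous g0.
  apply: (cont_comp (g := fun y : V => (y 0 0 - x 0 0, x))
    (f := fun q => avg 0 (df 0) q.1 q.2)).
    by apply: cont_pair; [exact: cc|exact: cont_cst].
  by apply: avg_continuous; exact: (Hf.2 0).2.
have cg1 : continuous g1.
  apply: (cont_comp (g := fun y : V => (y 0 1 - x 0 1, x + (y 0 0 - x 0 0) *: e 0))
    (f := fun q => avg 1 (df 1) q.1 q.2)).
    apply: cont_pair; first exact: cc.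
    apply: contD; first exact: cont_cst.
    by apply: contZ; [exact: cc|exact: cont_cst].
  by apply: avg_continuous; exact: (Hf.2 1).2.
have -> : f = (fun y : V => f x + (g0 x * y 0 0 + (- (g0 x) * x 0 0)) +
     (g1 x * y 0 1 + (- (g1 x) * x 0 1)) +
     ((y 0 0 - x 0 0) * (g0 y - g0 x) + (y 0 1 - x 0 1) * (g1 y - g1 x))).
  apply: funext => y.
  have E0 := avg_quot 0 (y 0 0 - x 0 0) x Hf.
  have E1 := avg_quot 1 (y 0 1 - x 0 1) (x + (y 0 0 - x 0 0) *: e 0) Hf.
  have E : x + (y 0 0 - x 0 0) *: e 0 + (y 0 1 - x 0 1) *: e 1 = y.
    by rewrite -addrA; apply/rowP; apply: ord2P; rewrite !mxE /=; ring.
  rewrite E in E1; rewrite -/(g0 y) in E0; rewrite -/(g1 y) in E1.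
  have -> : f y = f x + ((y 0 0 - x 0 0) * g0 y + (y 0 1 - x 0 1) * g1 y).
    by rewrite -E0 -E1; ring.
  ring.
have dl i (c d : R) : differentiable (fun y : V => c * y 0 i + d) x.
  apply: (differentiableD (f := fun y : V => c * y 0 i) (g := cst d)) => //.
  exact: (differentiableZ c (differentiable_coord x 0 i)).
apply: (differentiableD (f := fun y : V => f x + (g0 x * y 0 0 + (- (g0 x) * x 0 0)) +
     (g1 x * y 0 1 + (- (g1 x) * x 0 1)))).
  apply: (differentiableD (f := fun y : V => f x + (g0 x * y 0 0 + (- (g0 x) * x 0 0)))) => //.
  exact: (differentiableD (f := cst (f x))).
apply: (differentiableD (f := fun y : V => (y 0 0 - x 0 0) * (g0 y - g0 x))).
  exact: differentiable_coordM0 (cg0 x).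
exact: differentiable_coordM0 (cg1 x).
Qed.

(** Higher derivatives never have to be written down: it is enough that the
components lie in some class closed under partial derivatives. For the test
fields it is the class of convolutions against the algebra of bumps. *)
Lemma Ck_of_stable (S : (V -> R) -> Prop) :
  (forall f, S f -> exists2 df, isC1 f df & forall j, S (df j)) ->
  forall n (phi : V -> V), (forall i, S (fun x => phi x 0 i)) -> Ck n phi.
Proof.
move=> HS; have dphi (phi : V -> V) : (forall i, S (fun x => phi x 0 i)) ->
    forall x, differentiable phi x.
  move=> Hphi x.
  have -> : phi = (fun x => (phi x 0 0) *: e 0) + (fun x => (phi x 0 1) *: e 1).
    by apply: funext => y /=; rewrite {1}[phi y]row2_split.
  have d i : differentiable (fun x => phi x 0 i) x.
    by have [df Hf _] := HS _ (Hphi i); exact: isC1_differentiable Hf.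
  by apply: differentiableD; exact: differentiableZl.
elim=> [|n IH] phi Hphi /=.
  by move=> x; apply: differentiable_continuous; exact: dphi.
split; first exact: dphi.
move=> j; apply: IH => i.
have [df Hf Sdf] := HS _ (Hphi i).
have -> : (fun x => 'D_(e j) phi x 0 i) = df j; last exact: Sdf.
apply: funext => x; rewrite derive_mx ?mxE.
  by have := (Hf.2 j).1 x => ?; exact: derive_val.
by apply: diff_derivable; exact: dphi.
Qed.

(** The sign c = 1 puts the derivative of a convolution on the mollified
function, the sign c = -1 on the kernel. *)
Lemma isC1_conv (m k : V -> R) dk (c : R) : Cc m -> isC1 k dk ->
  isC1 (fun x => I (fun y => m y * k (x + c *: y)))
       (fun j x => I (fun y => m y * dk j (x + c *: y))).
Proof.
move=> [cm [r sm]] Hk.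
have cl : continuous (fun q : V * V => q.1 + c *: q.2).
  apply: contD; first exact: cont_fst.
  by apply: contZ; [exact: cont_cst|exact: cont_snd].
have cmk g : continuous g -> continuous (fun q : V * V => m q.2 * g (q.1 + c *: q.2)).
  move=> cg; apply: contM; first by apply: cont_comp cm; exact: cont_snd.
  exact: cont_comp cl cg.
have cI g : continuous g -> continuous (fun x : V => I (fun y => m y * g (x + c *: y))).
  move=> cg x; apply: (@I_continuous _ V (fun x y : V => m y * g (x + c *: y)) r).
    exact: cmk.
  by near=> p => y hy; rewrite sm ?mul0r.
have Cg g (x : V) : continuous g -> Cc (fun y => m y * g (x + c *: y)).
  move=> cg; split; last by exists r => y hy; rewrite sm ?mul0r.
  exact: (@cont_slice R V V (fun x y : V => m y * g (x + c *: y)) x (cmk _ cg)).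
split; first exact: cI Hk.1.
move=> j; split=> [x|]; last exact: cI (Hk.2 j).2.
have ca : continuous (fun q : R * V => m q.2 * avg j (dk j) q.1 (x + c *: q.2)).
  apply: contM; first by apply: cont_comp cm; exact: cont_snd.
  apply: (cont_comp (g := fun q : R * V => (q.1, x + c *: q.2))
    (f := fun q => avg j (dk j) q.1 q.2)).
    apply: cont_pair; first exact: cont_fst.
    apply: contD; first exact: cont_cst.
    by apply: contZ; [exact: cont_cst|exact: cont_snd].
  by apply: avg_continuous; exact: (Hk.2 j).2.
have := @is_derive_quot R _ (fun x => I (fun y => m y * k (x + c *: y))) x (e j)
   (fun h => I (fun y => m y * avg j (dk j) h (x + c *: y))).
have -> : I (fun y => m y * avg j (dk j) 0 (x + c *: y)) =
          I (fun y => m y * dk j (x + c *: y)).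
  by congr I; apply: funext => y; rewrite avg0.
apply.
  apply: (@I_continuous _ R (fun h (y : V) => m y * avg j (dk j) h (x + c *: y)) r _ ca).
  by near=> p => y hy; rewrite sm ?mul0r.
move=> h; rewrite -IZ; last first.
  split; last by exists r => y hy; rewrite sm ?mul0r.
  exact: (@cont_slice R R V (fun h (y : V) => m y * avg j (dk j) h (x + c *: y)) h ca).
rewrite -IB; [|exact: Cg Hk.1..].
congr I; apply: funext => y.
rewrite mulrCA -(avg_quot _ _ _ Hk) mulrBr.
by congr (_ * k _ - _); rewrite -addrA addrC.
Unshelve. all: by end_near. Qed.

End C1Calculus.

(** * A smooth bump and convolution with it *)

Section Bump.
Context {R : realType}.
Notation V := 'rV[R]_2.
Notation I := (@plane_integral R).

(** The functions t^-m exp(-1/t), extended by 0: the powers of 1/t are those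
produced by differentiating exp(-1/t), so that the family is stable. *)
Definition flat_exp (m : nat) (t : R) : R :=
  if 0 < t then t^-1 ^+ m * expR (- t^-1) else 0.

Lemma flat_exp_bound m : exists K, 0 <= K /\ forall t, 0 <= flat_exp m t <= K.
Proof.
exists (m.+1`!%:R + 1); split=> [|t]; first by rewrite addr_ge0.
rewrite /flat_exp; case: ifP => [t0|_]; last by rewrite lexx addr_ge0.
have y0 : 0 <= t^-1 by rewrite invr_ge0 ltW.
set y := t^-1 in y0 *; rewrite mulr_ge0 ?exprn_ge0 ?expR_ge0//=.
rewrite expRN ler_pdivrMr ?expR_gt0//.
have f0 : 0 < m.+1`!%:R :> R by rewrite ltr0n fact_gt0.
have h := expR_ge1Dxn m y0.
have h2 : y ^+ m <= 1 + y ^+ m.+1.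
  have [y1|y1] := leP y 1; first by apply: le_trans (exprn_ile1 _ y0 y1) _; rewrite lerDl exprn_ge0.
  by rewrite exprS (@le_trans _ _ (y * y ^+ m))// ?lerDr// ler_peMl ?exprn_ge0// ltW.
have h3 : m.+1`!%:R * expR y >= m.+1`!%:R + y ^+ m.+1.
  have := ler_wpM2l (ltW f0) h; rewrite mulrDr mulr1.
  by rewrite mulrCA divff ?gt_eqF// mulr1.
have := expR_ge1Dx y; lra.
Qed.

Lemma flat_exp_mul m t : flat_exp m t = t * flat_exp m.+1 t.
Proof.
rewrite /flat_exp; case: ifP => [t0|_]; last by rewrite mulr0.
by rewrite exprS !mulrA divff ?gt_eqF// mul1r.
Qed.

Lemma flat_exp_le0 m t : t <= 0 -> flat_exp m t = 0.
Proof. by move=> t0; rewrite /flat_exp ltNge t0. Qed.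

Lemma is_derive_flat_exp m (t : R) : is_derive t 1 (flat_exp m)
  (- m%:R * flat_exp m.+1 t + flat_exp m.+2 t).
Proof.
have [t0|t0|t0] := ltgtP t 0.
- rewrite !flat_exp_le0 ?ltW// mulr0 addr0.
  apply: (@near_eq_is_derive _ _ _ (cst 0)).
  by near=> s; rewrite flat_exp_le0//; apply/ltW; near: s; exact: lt_nbhsl.
- have N : \near t, t^-1 ^+ m * expR (- t^-1) = flat_exp m t.
    near=> s; rewrite /flat_exp; have -> // : 0 < s.
    by near: s; exact: lt_nbhsr.
  apply: (near_eq_is_derive N).
  have dV : is_derive t (1 : R) (fun s : R => s^-1) (- t ^- 2).
    have := is_deriveV (f := id) (x := t) (v := 1) (t := 1); rewrite gt_eqF// => /(_ isT).
    by move=> /(_ (is_derive_id t 1)); rewrite /GRing.scale/= mulr1.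
  have dN : is_derive t (1 : R) (fun s : R => - s^-1) (t ^- 2).
    by have := is_deriveN dV; rewrite opprK.
  have dE : is_derive t (1 : R) (fun s : R => expR (- s^-1)) (expR (- t^-1) * t ^- 2).
    apply: (is_derive1_comp (f := expR) (g := fun s : R => - s^-1)) => //.
  have dX := is_deriveX m dV.
  have -> : (fun s : R => s^-1 ^+ m * expR (- s^-1)) =
      ((fun s : R => s^-1) ^+ m * (fun s : R => expR (- s^-1))).
    by apply: funext => s; rewrite !fctE.
  apply: (is_derive_eq (is_deriveM dX dE)); rewrite !fctE.
  rewrite /flat_exp t0 /GRing.scale/=.
  set x := t^-1; set E := expR _; rewrite -!exprVn -/x.
  case: m {dX N} => [|m] /=; first by rewrite /GRing.scale /= !expr0; ring.
  by rewrite !exprS /GRing.scale /=; ring.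
- rewrite t0 !flat_exp_le0// mulr0 addr0.
  have [K [K0 HK]] := flat_exp_bound m.+2.
  have L : K * `|h| @[h --> (0 : R)^'] --> (0 : R).
    apply: cvg_within_filter.
    have := @contM R R (fun=> K) (fun h => `|h|) (@cont_cst _ _ K)
      (@norm_continuous _ R) 0.
    by rewrite /continuous_at normr0 mulr0.
  have H : h^-1 *: (flat_exp m (h *: 1 + 0) - flat_exp m 0) @[h --> 0^'] --> (0 : R).
    apply: (@squeeze_cvgr _ _ _ _ (fun h => - (K * `|h|)) (fun h => K * `|h|)) => //.
      near=> h; have h0 : h != 0 by near: h; exact: nbhs_dnbhs_neq.
      rewrite (flat_exp_le0 _ (lexx 0)) subr0 addr0 /GRing.scale/= mulr1.
      (* The quotient at 0 is h * flat_exp m.+2 h, and flat_exp m.+2 is bounded. *)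
      rewrite flat_exp_mul mulKf// flat_exp_mul -ler_norml normrM mulrC.
      by have /andP[a b] := HK h; rewrite ler_wpM2r// ger0_norm.
    by rewrite -[X in _ --> X]oppr0; apply: cvgN.
  by apply: DeriveDef; [apply/cvg_ex; exists 0|exact: cvg_lim].
Unshelve. all: by end_near. Qed.

Lemma flat_exp_continuous m : continuous (flat_exp m).
Proof.
move=> t; apply: differentiable_continuous; apply/derivable1_diffP.
exact: (@ex_derive _ _ _ _ _ _ _ (is_derive_flat_exp m t)).
Qed.

(** Generated by the polynomials and the functions flat_exp m (d - |x|^2),
hence stable under partial derivatives by the product and chain rules. *)
Inductive bump_algebra : (V -> R) -> Prop :=
| bump_flat m d : bump_algebra (fun x => flat_exp m (d - (x 0 0 ^+ 2 + x 0 1 ^+ 2)))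
| bump_cst c : bump_algebra (fun=> c)
| bump_coord i : bump_algebra (fun x => x 0 i)
| bump_add f g : bump_algebra f -> bump_algebra g -> bump_algebra (fun x => f x + g x)
| bump_mul f g : bump_algebra f -> bump_algebra g -> bump_algebra (fun x => f x * g x).

Lemma bump_algebra_stable f : bump_algebra f ->
  exists2 df, isC1 f df & forall j, bump_algebra (df j).
Proof.
elim=> [m d|c|i|{}f g _ [df Hf Sf] _ [dg Hg Sg]|{}f g Sf' [df Hf Sf] Sg' [dg Hg Sg]].
- pose dq j (x : V) : R := - 2 * x 0 j.
  have Hq : isC1 (fun x : V => d - (x 0 0 ^+ 2 + x 0 1 ^+ 2)) dq.
    have := isC1B (isC1_cst d) (isC1D (isC1M (isC1_coord 0) (isC1_coord 0))
      (isC1M (isC1_coord 1) (isC1_coord 1))) => H.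
    apply: (isC1_ext H) => j x; rewrite /dq; move: j.
    by apply: ord2P => /=; ring.
  exists (fun j x => (- m%:R * flat_exp m.+1 (d - (x 0 0 ^+ 2 + x 0 1 ^+ 2)) +
     flat_exp m.+2 (d - (x 0 0 ^+ 2 + x 0 1 ^+ 2))) * (- 2 * x 0 j)).
    apply: (isC1_comp (F := flat_exp m)
       (F' := fun t => - m%:R * flat_exp m.+1 t + flat_exp m.+2 t)) Hq.
      exact: is_derive_flat_exp.
    apply: contD; last exact: flat_exp_continuous.
    by apply: contM; [exact: cont_cst|exact: flat_exp_continuous].
  move=> j; apply: bump_mul; last by apply: bump_mul; [exact: bump_cst|exact: bump_coord].
  apply: bump_add; last exact: bump_flat.
  by apply: bump_mul; [exact: bump_cst|exact: bump_flat].
- by exists (fun _ _ => 0) => [|j]; [exact: isC1_cst|exact: bump_cst].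
- by exists (fun j _ => (i == j)%:R) => [|j]; [exact: isC1_coord|exact: bump_cst].
- exists (fun j x => df j x + dg j x); first exact: isC1D.
  by move=> j; apply: bump_add.
- exists (fun j x => df j x * g x + f x * dg j x); first exact: isC1M.
  by move=> j; apply: bump_add; apply: bump_mul.
Qed.

(** The classical exp(-1/(d^2 - |x|^2)), not normalized: its integral is
divided out where it is used. *)
Definition bump (d : R) (x : V) : R := flat_exp 0 (d ^+ 2 - (x 0 0 ^+ 2 + x 0 1 ^+ 2)).

Lemma bump_ge0 d x : 0 <= bump d x.
Proof. by have [K [_ /(_ (d ^+ 2 - (x 0 0 ^+ 2 + x 0 1 ^+ 2)))/andP[]]] := flat_exp_bound 0. Qed.

Lemma norm_coord (x : V) : exists i, `|x| = `|x 0 i|.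
Proof.
have [h|h] := leP `|x 0 0| `|x 0 1|.
  exists 1; apply/eqP; rewrite eq_le coord_le_norm andbT.
  by apply: norm_le_coord => //; apply: ord2P.
exists 0; apply/eqP; rewrite eq_le coord_le_norm andbT.
by apply: norm_le_coord => //; apply: ord2P => //; exact: ltW.
Qed.

Lemma norm_le_sq (x : V) : `|x| ^+ 2 <= x 0 0 ^+ 2 + x 0 1 ^+ 2.
Proof.
have [i ->] := norm_coord x; rewrite real_normK ?num_real//.
by move: i; apply: ord2P; rewrite ?lerDl ?lerDr sqr_ge0.
Qed.

Lemma bump_csupp d : 0 <= d -> csupp (bump d) d.
Proof.
move=> d0 x hx; apply: flat_exp_le0; rewrite subr_le0; apply: le_trans (norm_le_sq x).
by rewrite lerXn2r// nnegrE.
Qed.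

Lemma bump_continuous d : continuous (bump d).
Proof. by have [df Hf _] := bump_algebra_stable (bump_flat 0 (d ^+ 2)); exact: Hf.1. Qed.

Lemma bump_Cc d : 0 <= d -> Cc (bump d).
Proof. by move=> d0; split; [exact: bump_continuous|exists d; exact: bump_csupp]. Qed.

Lemma I_bump_gt0 d : 0 < d -> 0 < I (bump d).
Proof.
move=> d0; apply: (I_gt0 (x0 := 0) (bump_Cc (ltW d0)) (bump_ge0 d)).
by rewrite /bump !mxE expr0n addr0 subr0 /flat_exp exprn_gt0// expr0 mul1r expR_gt0.
Qed.

Definition conv (m k : V -> R) (c : R) (x : V) := I (fun y => m y * k (x + c *: y)).

(** Translation moves the shift onto the bump, which is even. *)
Lemma conv_swap d f x : 0 <= d -> continuous f -> conv (bump d) f 1 x = conv f (bump d) (-1) x.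
Proof.
move=> d0 cf; rewrite /conv -(@I_shift R (fun y => f y * _) x); last first.
  split; last first.
    exists (`|x| + d) => y hy; rewrite (bump_csupp d0) ?mulr0// scaleN1r.
    by have := ler_distD x y; have := lerB_normD y (- x); rewrite normrN distrC; lra.
  apply: contM => //; apply: cont_comp (@bump_continuous d).
  by apply: contD; [exact: cont_cst|apply: contZ; [exact: cont_cst|exact: cont_id]].
congr I; apply: funext => y; rewrite mulrC scale1r [x + y]addrC scaleN1r.
congr (_ * _); rewrite opprD addrCA subrr addr0 /bump !mxE !sqrrN //.
Qed.

End Bump.

(** * Test fields of class C1 *)

Section Extension.
Context {R : realType}.
Notation V := 'rV[R]_2.
Notation I := (@plane_integral R).
Notation e := (fun l : 'I_2 => delta_mx 0 l : 'rV[R]_2).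

Implicit Types f g : V -> R.
Implicit Types phi : 'I_2 -> V -> R.

Lemma normM_le (x y a b : R) : `|x| <= a -> `|y| <= b -> `|x * y| <= a * b.
Proof. by move=> xa yb; rewrite normrM ler_pM. Qed.

Lemma normD_le (x y a b : R) : `|x| <= a -> `|y| <= b -> `|x + y| <= a + b.
Proof. by move=> xa yb; apply: le_trans (ler_normD _ _) _; exact: lerD. Qed.

Lemma sum2 (W : nmodType) (F : 'I_2 -> W) : \sum_(i < 2) F i = F 0 + F 1.
Proof. by rewrite !big_ord_recl big_ord0 addr0; congr (_ + F _); exact: val_inj. Qed.

Lemma cvg_sum2 (T : Type) (D : set_system T) (FD : Filter D) (f : 'I_2 -> T -> R) (l : 'I_2 -> R) :
  (forall i, f i x @[x --> D] --> l i) -> (\sum_i f i x) @[x --> D] --> \sum_i l i.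
Proof.
move=> fl; rewrite sum2 (_ : (fun x => _) = (fun x => f 0 x + f 1 x)).
  exact: cvgD.
by apply: funext => x; rewrite sum2.
Qed.

Lemma CcMl (g f : V -> R) : continuous g -> Cc f -> Cc (fun x => g x * f x).
Proof.
move=> cg [cf [r sf]]; split; first exact: contM.
by exists r => x hx; rewrite sf ?mulr0.
Qed.

Lemma CcMr (g f : V -> R) : continuous g -> Cc f -> Cc (fun x => f x * g x).
Proof.
by move=> cg Cf; under eq_fun do rewrite mulrC; exact: CcMl.
Qed.

Lemma CcD (g f : V -> R) : Cc g -> Cc f -> Cc (fun x => g x + f x).
Proof.
move=> [cg [r1 sg]] [cf [r2 sf]]; split; first exact: contD.
exists (Num.max r1 r2) => x; rewrite ge_max => /andP[h1 h2].
by rewrite sf ?sg ?addr0.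
Qed.

Lemma CcZ c (f : V -> R) : Cc f -> Cc (fun x => c * f x).
Proof. by apply: CcMl; exact: cont_cst. Qed.

Lemma CcN (f : V -> R) : Cc f -> Cc (fun x => - f x).
Proof. by move=> Cf; under eq_fun do rewrite -mulN1r; exact: CcZ. Qed.

Lemma CcB (g f : V -> R) : Cc g -> Cc f -> Cc (fun x => g x - f x).
Proof. by move=> Cg Cf; apply: CcD => //; exact: CcN. Qed.

Lemma Cc_sum (f : 'I_2 -> V -> R) : (forall i, Cc (f i)) -> Cc (fun x => \sum_i f i x).
Proof.
by move=> Cf; rewrite (_ : (fun _ => _) = (fun x => f 0 x + f 1 x)); [exact: CcD|apply: funext => x; rewrite sum2].
Qed.

Lemma I_sum (f : 'I_2 -> V -> R) : (forall i, Cc (f i)) ->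
  I (fun x => \sum_i f i x) = \sum_i I (f i).
Proof. by move=> Cf; under eq_fun do rewrite sum2; rewrite ID// sum2. Qed.

Lemma I0 : I (fun=> 0) = 0.
Proof.
rewrite (_ : (fun _ => _) = (fun x => 0 * bump 1 x)) ?IZ ?mul0r//.
  exact: bump_Cc.
by apply: funext => x; rewrite mul0r.
Qed.

Lemma conv_csupp d f r : 0 <= d -> csupp f r -> csupp (conv (bump d) f 1) (r + d).
Proof.
move=> d0 sf x hx; rewrite /conv (_ : (fun _ => _) = fun=> 0); first last.
  apply: funext => y; have [hy|hy] := leP d `|y|; first by rewrite bump_csupp ?mul0r.
  rewrite sf ?mulr0// scale1r; have := ler_normB (x + y) y; rewrite addrK; lra.
exact: I0.
Qed.

Lemma conv_slice d f x : 0 <= d -> continuous f -> Cc (fun y => bump d y * f (x + 1 *: y)).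
Proof.
move=> d0 cf; apply: CcMr; last exact: bump_Cc.
apply: cont_comp cf; apply: contD; first exact: cont_cst.
by apply: contZ; [exact: cont_cst|exact: cont_id].
Qed.

Lemma conv_continuous d f : 0 <= d -> continuous f -> continuous (conv (bump d) f 1).
Proof.
move=> d0 cf x; apply: (@I_continuous _ V (fun x y : V => bump d y * f (x + 1 *: y)) d).
  apply: contM; first by apply: cont_comp (@bump_continuous _ d); exact: cont_snd.
  apply: cont_comp cf; apply: contD; first exact: cont_fst.
  by apply: contZ; [exact: cont_cst|exact: cont_snd].
by near=> p => y hy; rewrite bump_csupp ?mul0r.
Unshelve. all: by end_near. Qed.

Lemma conv_Cc d f : 0 <= d -> Cc f -> Cc (conv (bump d) f 1).
Proof.
move=> d0 [cf [r sf]]; split; first exact: conv_continuous.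
by exists (r + d); exact: conv_csupp.
Qed.

Lemma moll_uniform f r (eps : R) : continuous f -> 0 < eps -> \forall d \near (0 : R)^'+,
  forall x, `|x| <= r -> `|conv (bump d) f 1 x / I (bump d) - f x| <= eps.
Proof.
move=> cf e0.
have cF : continuous (fun q : V * V => f (q.2 + q.1)).
  by apply: cont_comp cf; apply: contD; [exact: cont_snd|exact: cont_fst].
have := near_uniform (F := fun y x : V => f (x + y)) 0 (@ball_compact R r) cF e0.
move=> /nbhs_ballP[del /= del0 H].
near=> d.
have d0 : 0 < d by near: d; exact: nbhs_right_gt.
have dd : d < del by near: d; exact: nbhs_right_lt.
move=> x xr.
have B0 := I_bump_gt0 d0.
have Cb := bump_Cc (ltW d0).
rewrite -(@ler_pM2r _ (I (bump d)))// -{2}(ger0_norm (ltW B0)) -normrM mulrBl divfK ?gt_eqF//.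
rewrite -IZ// /conv -IB; [|exact: conv_slice (ltW d0) cf|exact: CcZ].
have K y : `|bump d y * f (x + 1 *: y) - f x * bump d y| <= eps * bump d y.
  have [hy|hy] := leP d `|y|.
    by rewrite (bump_csupp (ltW d0))// mul0r !mulr0 subrr normr0.
  rewrite mulrC -mulrBl normrM (ger0_norm (bump_ge0 _ _)) ler_wpM2r ?bump_ge0//.
  have := H y; rewrite -ball_normE /= sub0r normrN => /(_ (lt_trans hy dd) x xr).
  by rewrite scale1r addr0 => /ltW.
have CB : Cc (fun y => bump d y * f (x + 1 *: y) - f x * bump d y).
  by apply: CcB; [exact: conv_slice (ltW d0) cf|exact: CcZ].
rewrite ler_norml; apply/andP; split.
  rewrite -mulNr -IZ//; apply: I_le => //; first exact: CcZ.
  by move=> y; have := K y; rewrite ler_norml mulNr => /andP[].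
rewrite -IZ//; apply: I_le => //; first exact: CcZ.
by move=> y; have := K y; rewrite ler_norml => /andP[].
Unshelve. all: by end_near. Qed.

Lemma moll_cvg f g : Cc f -> continuous g ->
  I (fun x => g x * conv (bump d) f 1 x) / I (bump d) @[d --> (0 : R)^'+] -->
  I (fun x => g x * f x).
Proof.
move=> Cf cg; have [M [r [M0 r0 sf bf]]] := Cc_bound Cf; have cf := Cf.1.
have [G [G0 HG]] := continuous_compact_bound (r + 1) cg.
apply/cvgrPdist_le => eps e0.
set A := 4 * (r + 1) ^+ 2.
have A0 : 0 < A by rewrite mulr_gt0// exprn_gt0// ltr_wpDl.
have eps'0 : 0 < eps / ((G + 1) * A) by rewrite divr_gt0// mulr_gt0// ltr_wpDl.
have H := moll_uniform (r + 1) cf eps'0.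
near=> d.
have d0 : 0 < d by near: d; exact: nbhs_right_gt.
have d1 : d < 1 by near: d; exact: nbhs_right_lt.
have Hd : forall x, `|x| <= r + 1 -> `|conv (bump d) f 1 x / I (bump d) - f x| <= eps / ((G + 1) * A).
  by near: d.
have Cc' := conv_Cc (ltW d0) Cf.
rewrite mulrC -IZ; last exact: CcMl.
rewrite -IB; [|exact: CcMl|by apply: CcZ; exact: CcMl].
have -> : eps = G * (eps / ((G + 1) * A)) * A + eps / (G + 1).
  by field; rewrite !gt_eqF//= ltr_wpDl.
apply: ler_wpDr; first by rewrite divr_ge0 ?addr_ge0// ltW.
apply: I_bound => //; first by rewrite addr_ge0.
- apply: contB; first exact: contM.
  by apply: contM; [exact: cont_cst|apply: contM => //; exact: Cc'.1].
- move=> x hx; rewrite sf ?(conv_csupp (ltW d0) sf) ?mulr0 ?subrr//; lra.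
move=> x; have [hx|hx] := leP `|x| (r + 1); last first.
  rewrite sf ?(conv_csupp (ltW d0) sf) ?mulr0 ?subrr ?normr0//; [|lra|lra].
  by rewrite mulr_ge0// ltW.
rewrite mulrCA -mulrBr normrM; apply: ler_pM => //; first exact: HG.
by rewrite distrC mulrC; exact: Hd.
Unshelve. all: by end_near. Qed.

Definition moll_field (phi : 'I_2 -> V -> R) d (x : V) : V :=
  \row_i conv (bump d) (phi i) 1 x.

Lemma isC1_moll d f df : 0 <= d -> isC1 f df ->
  isC1 (conv (bump d) f 1) (fun j => conv (bump d) (df j) 1).
Proof. by move=> d0 Hf; apply: isC1_conv => //; exact: bump_Cc. Qed.

Lemma moll_field_smooth phi d n : 0 <= d -> (forall i, Cc (phi i)) ->
  Ck n (moll_field phi d).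
Proof.
move=> d0 Cphi.
apply: (@Ck_of_stable _ (fun f => exists m k, [/\ Cc m, bump_algebra k & f = conv m k (-1)])).
  move=> _ [m [k [Cm Bk ->]]]; have [dk Hk Bdk] := bump_algebra_stable Bk.
  exists (fun j => conv m (dk j) (-1)); first exact: isC1_conv.
  by move=> j; exists m, (dk j).
move=> i; exists (phi i), (bump d); split => //; first exact: bump_flat.
by apply: funext => x; rewrite mxE conv_swap//; exact: (Cphi i).1.
Qed.

Lemma jacobianE (u : V -> V) x j i : differentiable u x ->
  'J u x j i = 'D_(e j) (fun y => u y 0 i) x.
Proof.
move=> du; have := deriveEjacobian (e j) du.
rewrite derive_mx; last exact: diff_derivable.
by rewrite -rowE => /rowP/(_ i); rewrite !mxE.
Qed.

Lemma moll_jacobian phi dphi d x j i : 0 <= d -> (forall i, Cc (phi i)) ->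
  (forall i, isC1 (phi i) (dphi i)) ->
  'J (moll_field phi d) x j i = conv (bump d) (dphi i j) 1 x.
Proof.
move=> d0 Cphi Hphi; rewrite jacobianE; last first.
  by have [] := moll_field_smooth 1 d0 Cphi.
have := ((isC1_moll d0 (Hphi i)).2 j).1 x => H.
have -> : (fun y => moll_field phi d y 0 i) = conv (bump d) (phi i) 1.
  by apply: funext => y; rewrite mxE.
exact: derive_val.
Qed.

Lemma moll_test phi d : 0 <= d -> (forall i, Cc (phi i)) -> test_field (moll_field phi d).
Proof.
move=> d0 Cphi; split; first by move=> n; exact: moll_field_smooth.
have [_ [r0 s0]] := Cphi 0; have [_ [r1 s1]] := Cphi 1.
apply: (subclosed_compact _ (@ball_compact R (Num.max r0 r1 + d))).
  exact: closed_closure.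
have cl : closed [set x : V | `|x| <= Num.max r0 r1 + d].
  apply: (@closed_comp _ _ (fun x : V => `|x|) [set y | y <= Num.max r0 r1 + d]).
    by move=> x _; exact: norm_continuous.
  exact: closed_le.
rewrite closureE; apply: smallest_sub => // x /= nx.
rewrite leNgt; apply/negP => hx; move/negP: nx; apply; apply/eqP.
apply/rowP; apply: ord2P; rewrite !mxE.
  by apply: (conv_csupp d0 s0); rewrite (le_trans _ (ltW hx))// lerD2r le_max lexx.
by apply: (conv_csupp d0 s1); rewrite (le_trans _ (ltW hx))// lerD2r le_max lexx orbT.
Qed.

Lemma sym_gradE (u : V -> V) x i j :
  sym_grad u x i j = 2^-1 * ('J u x i j + 'J u x j i).
Proof. by rewrite /sym_grad; move: ('J u x) => A; rewrite !mxE. Qed.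

(** Test fields made of difference quotients of u are only C1. Mollifying them
gives smooth divergence-free fields, and the equation passes to the limit
because T and b are continuous. *)
Lemma weak_form_C1 (T : V -> 'M[R]_2) (b : V -> V) :
  (forall i j, continuous (fun x => T x i j)) -> (forall x, (T x)^T = T x) ->
  (forall i, continuous (fun x => b x 0 i)) ->
  (forall phi : V -> V, test_field phi -> (forall x, divergence phi x = 0) ->
    I (fun x => frob_dot (T x) (sym_grad phi x)) + I (fun x => frob_dot (b x) (phi x)) = 0) ->
  forall phi (dphi : 'I_2 -> 'I_2 -> V -> R), (forall i, isC1 (phi i) (dphi i)) -> (forall i, Cc (phi i)) ->
  (forall x, dphi 0 0 x + dphi 1 1 x = 0) ->
  I (fun x => \sum_i \sum_j T x i j * dphi j i x + \sum_i b x 0 i * phi i x) = 0.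
Proof.
move=> cT sT cb weak phi dphi Hphi Cphi div0.
have Cd i j : Cc (dphi i j) by exact: partial_Cc (Hphi i) (Cphi i).
have Ed d : 0 < d -> \sum_i \sum_j (I (fun x => T x i j * conv (bump d) (dphi j i) 1 x) / I (bump d)) +
   \sum_i (I (fun x => b x 0 i * conv (bump d) (phi i) 1 x) / I (bump d)) = 0.
  move=> d0; have Cm f := conv_Cc (ltW d0) (f := f).
  have dz : forall x, divergence (moll_field phi d) x = 0.
    move=> x; rewrite /divergence sum2 !(moll_jacobian _ _ _ (ltW d0) Cphi Hphi).
    rewrite /conv -ID; [|exact: conv_slice (ltW d0) (Cd _ _).1..].
    rewrite (_ : (fun _ => _) = (fun x => 0 * bump d x)); last first.
      by apply: funext => y; rewrite -mulrDr div0 mulr0 mul0r.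
    by rewrite IZ ?mul0r//; exact: bump_Cc (ltW d0).
  have := weak _ (moll_test (ltW d0) Cphi) dz.
  have -> : (fun x => frob_dot (T x) (sym_grad (moll_field phi d) x)) =
     (fun x => \sum_i \sum_j T x i j * conv (bump d) (dphi j i) 1 x).
    apply: funext => x; rewrite /frob_dot !sum2 !sym_gradE.
    rewrite !(moll_jacobian _ _ _ (ltW d0) Cphi Hphi).
    have -> : T x 1 0 = T x 0 1 by rewrite -{1}(sT x) mxE.
    by field.
  have -> : (fun x => frob_dot (b x) (moll_field phi d x)) =
     (fun x => \sum_i b x 0 i * conv (bump d) (phi i) 1 x).
    by apply: funext => x; rewrite /frob_dot big_ord1; apply: eq_bigr => i _; rewrite mxE.
  rewrite I_sum => [|i]; last by apply: Cc_sum => j; apply: CcMl => //; exact: Cm.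
  rewrite I_sum => [|i]; last by apply: CcMl => //; exact: Cm.
  (* Normalize by the integral of the bump before letting d tend to 0. *)
  move=> /(congr1 (fun z => z / I (bump d))); rewrite mul0r mulrDl !mulr_suml => E0.
  apply: etrans E0; congr (_ + _); apply: eq_bigr => i _.
  rewrite I_sum => [|j]; last by apply: CcMl => //; exact: Cm.
  by rewrite mulr_suml.
have L : \sum_i \sum_j (I (fun x => T x i j * conv (bump d) (dphi j i) 1 x) / I (bump d)) +
   \sum_i (I (fun x => b x 0 i * conv (bump d) (phi i) 1 x) / I (bump d)) @[d --> (0 : R)^'+] -->
   \sum_i \sum_j I (fun x => T x i j * dphi j i x) + \sum_i I (fun x => b x 0 i * phi i x).
  by apply: cvgD; apply: cvg_sum2 => i; [apply: cvg_sum2 => j|]; exact: moll_cvg.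
have L0 : \sum_i \sum_j (I (fun x => T x i j * conv (bump d) (dphi j i) 1 x) / I (bump d)) +
   \sum_i (I (fun x => b x 0 i * conv (bump d) (phi i) 1 x) / I (bump d)) @[d --> (0 : R)^'+] --> 0.
  apply: (@cvg_trans _ ((fun=> 0) @ (0 : R)^'+)); last exact: cvg_cst.
  apply: near_eq_cvg; near=> d; rewrite Ed//; near: d; exact: nbhs_right_gt.
rewrite ID; [|by apply: Cc_sum => i; apply: Cc_sum => j; apply: CcMl|by apply: Cc_sum => i; apply: CcMl].
rewrite !I_sum => [|i|i]; [|by apply: CcMl|by apply: Cc_sum => j; apply: CcMl].
under eq_bigr do (rewrite I_sum; last by move=> j; apply: CcMl).
exact: (cvg_unique _ L L0).
Unshelve. all: by end_near. Qed.

End Extension.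

(** * One-sided calculus on the half-line *)

Section HalfLineCalculus.
Context {R : realType}.
Implicit Types f h : R -> R.

Lemma derive_ge0P f t : derivable_ge0 f t -> forall eps, 0 < eps ->
  exists2 d, 0 < d & forall s, 0 <= s -> s != t -> `|s - t| < d ->
   `|derive_ge0 f t - (f s - f t) / (s - t)| <= eps.
Proof.
move=> df eps e0; have : diffquot_ge0 f t @ within `[0, +oo[ (t^') --> derive_ge0 f t by exact: df.
move=> /cvgrPdist_le/(_ _ e0) /=.
rewrite /within /= => /nbhs_ballP[d /= d0 H]; exists d => // s s0 st sd.
apply: H => //=; first by rewrite /ball/= distrC.
by rewrite in_itv/= s0.
Qed.

Lemma is_derive_ge0 f t : derivable_ge0 f t -> 0 < t -> is_derive t (1 : R) f (derive_ge0 f t).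
Proof.
move=> df t0.
have H : h^-1 *: (f (h *: 1 + t) - f t) @[h --> 0^'] --> derive_ge0 f t.
  apply/cvgrPdist_le => eps e0; have [d d0 Hd] := derive_ge0P df e0.
  near=> h.
  have h0 : h != 0 by near: h; exact: nbhs_dnbhs_neq.
  have hd : `|h| < d by near: h; exact: dnbhs0_lt.
  have ht : `|h| < t by near: h; exact: dnbhs0_lt.
  have := Hd (h + t); rewrite addrK /GRing.scale/= mulr1 [h^-1 * _]mulrC; apply => //.
    by have := ler_norm (- h); rewrite normrN; lra.
  by rewrite -subr_eq0 addrK.
by apply: DeriveDef; [apply/cvg_ex; exists (derive_ge0 f t)|exact: cvg_lim].
Unshelve. all: by end_near. Qed.

(** Constant extension to the left of 0, so that the mean value theorem of the
line applies on intervals that start at 0. *)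
Definition ge0_ext f (t : R) := f (Num.max 0 t).

Lemma ge0_ext_continuous f : (forall t, 0 <= t -> derivable_ge0 f t) -> continuous (ge0_ext f).
Proof.
move=> df.
have C t : 0 <= t -> forall eps, 0 < eps -> exists2 d, 0 < d &
   forall s, 0 <= s -> `|s - t| < d -> `|f t - f s| <= eps.
  move=> t0 eps e0; have [d d0 Hd] := derive_ge0P (df t t0) (@ltr01 R).
  set K := `|derive_ge0 f t| + 1; have K0 : 0 < K by rewrite ltr_wpDl.
  exists (Num.min d (eps / K)); first by rewrite lt_min d0 divr_gt0.
  move=> s s0; rewrite lt_min => /andP[sd se].
  have [->|st] := eqVneq s t; first by rewrite subrr normr0 ltW.
  have := Hd s s0 st sd; set q := _ / _ => Hq.
  have -> : f t - f s = - (q * (s - t)) by rewrite /q divfK ?subr_eq0// opprB.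
  rewrite normrN normrM.
  have qK : `|q| <= K.
    have := ler_normB (derive_ge0 f t) (derive_ge0 f t - q).
    by rewrite opprB addrC subrK /K; lra.
  apply: le_trans (_ : K * (eps / K) <= _); last by rewrite mulrC divfK ?gt_eqF.
  by apply: ler_pM => //; exact: ltW.
move=> t; apply/cvgrPdist_le => eps e0.
have m0 s : 0 <= Num.max (0 : R) s by rewrite le_max lexx.
have [d d0 Hd] := C _ (m0 t) _ e0.
apply/nbhs_ballP; exists d => //= s; rewrite /ball/= => st.
apply: Hd => //; apply: le_lt_trans st; rewrite distrC.
by rewrite /Num.max; case: ltP => h1; case: ltP => h2; rewrite ?ler_norml; apply/andP; split;
  (have := ler_norm (t - s); have := ler_norm (s - t); rewrite distrC; lra).
Qed.

Lemma ge0_MVT f a b : (forall t, 0 <= t -> derivable_ge0 f t) -> 0 <= a -> a < b ->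
  exists2 c, a < c < b & f b - f a = derive_ge0 f c * (b - a).
Proof.
move=> df a0 ab.
have D x : x \in `]a, b[ -> is_derive x (1 : R) (ge0_ext f) (derive_ge0 f x).
  rewrite in_itv/= => /andP[ax xb]; have x0 : 0 < x by exact: le_lt_trans ax.
  have N : \near x, f x = ge0_ext f x.
    near=> s; rewrite /ge0_ext max_r//; apply/ltW; near: s; exact: lt_nbhsr.
  by apply: (near_eq_is_derive N); apply: is_derive_ge0 => //; apply: df; exact: ltW.
have [c ci] := MVT ab D (continuous_subspaceT (ge0_ext_continuous df)).
rewrite /ge0_ext !max_r; [|exact: a0|exact: le_trans (ltW ab)].
by move=> E; exists c => //; move: ci; rewrite in_itv.
Unshelve. all: by end_near. Qed.

End HalfLineCalculus.

(** * Monotonicity of the stress *)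

Section Tensor.
Context {R : realType}.
Implicit Types A B : 'M[R]_2.

Lemma frob_dotE A B : frob_dot A B =
  A 0 0 * B 0 0 + A 0 1 * B 0 1 + A 1 0 * B 1 0 + A 1 1 * B 1 1.
Proof. by rewrite /frob_dot !sum2 !addrA. Qed.

Lemma frob_dot_ge0 A : 0 <= frob_dot A A.
Proof. by rewrite frob_dotE -!expr2 !addr_ge0 ?sqr_ge0. Qed.

Lemma frob_norm_sq A : frob_norm A ^+ 2 = frob_dot A A.
Proof. by rewrite sqr_sqrtr// frob_dot_ge0. Qed.

Lemma frob_norm_ge0 A : 0 <= frob_norm A.
Proof. exact: sqrtr_ge0. Qed.

Lemma frob_CS A B : frob_dot A B <= frob_norm A * frob_norm B.
Proof.
rewrite -sqrtrM ?frob_dot_ge0//; apply: le_trans (ler_norm _) _.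
rewrite -sqrtr_sqr ler_wsqrtr// !frob_dotE.
set a := A 0 0; set b := A 0 1; set c := A 1 0; set d := A 1 1.
set x := B 0 0; set y := B 0 1; set z := B 1 0; set w := B 1 1.
(* Lagrange's identity. *)
rewrite -subr_ge0 (_ : _ - _ = (a * y - b * x) ^+ 2 + (a * z - c * x) ^+ 2 +
  (a * w - d * x) ^+ 2 + (b * z - c * y) ^+ 2 + (b * w - d * y) ^+ 2 +
  (c * w - d * z) ^+ 2); last ring.
by rewrite !addr_ge0 ?sqr_ge0.
Qed.

Lemma frob_eq0 A : frob_norm A = 0 -> A = 0.
Proof.
move=> A0; have := frob_norm_sq A; rewrite A0 expr0n/= frob_dotE => E.
have [a [b [c d]]] : A 0 0 = 0 /\ A 0 1 = 0 /\ A 1 0 = 0 /\ A 1 1 = 0.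
  by do !split; nra.
by apply/matrixP; apply: ord2P; apply: ord2P; rewrite mxE.
Qed.

Variables (h : R -> R) (c1 c2 mu : R).
Hypotheses (h_C2 : Ck_ge0 2 h) (dh0 : derive_ge0 h 0 = 0)
  (c1_gt0 : 0 < c1) (c2_gt0 : 0 < c2) (mu_gt1 : 1 < mu)
  (h_lower : forall t : R, 0 <= t ->
      c1 * (1 + t) `^ (- mu)
        <= Num.min (derive_ge0 (derive_ge0 h) t) (derive_quot h t))
  (h_upper : forall t : R, 0 <= t ->
      Num.max (derive_ge0 (derive_ge0 h) t) (derive_quot h t)
        <= c2 / (1 + t)).
Notation f := (derive_ge0 h).
Notation al := (derive_quot h).

Lemma quot_mul t : al t * t = f t.
Proof.
by rewrite /derive_quot; case: eqVneq => [->|t0]; rewrite ?mulr0 ?dh0// divfK.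
Qed.

Lemma upper_bounds t : 0 <= t -> derive_ge0 f t <= c2 /\ al t <= c2.
Proof.
move=> t0; have := h_upper t0; rewrite ge_max => /andP[a b].
have : c2 / (1 + t) <= c2 by rewrite ler_pdivrMr ?ltr_pwDl// ler_peMr ?lerDl// ltW.
by split; [exact: le_trans a _|exact: le_trans b _].
Qed.

Lemma lower_bounds t Y : 0 <= t -> 1 + t <= Y ->
  c1 * Y `^ (- mu) <= derive_ge0 f t /\ c1 * Y `^ (- mu) <= al t.
Proof.
move=> t0 tY; have := h_lower t0; rewrite le_min => /andP[a b].
have : c1 * Y `^ (- mu) <= c1 * (1 + t) `^ (- mu).
  rewrite ler_wpM2l ?(ltW c1_gt0)// !powRN lef_pV2 ?posrE ?powR_gt0 ?ltr_pwDl//.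
    have mu0 : 0 <= mu by exact: le_trans ler01 (ltW mu_gt1).
    by apply: ge0_ler_powR => //; rewrite ?nnegrE; lra.
  by lra.
by split; [exact: le_trans a|exact: le_trans b].
Qed.

Lemma lower_const_gt0 (Y : R) : 0 < Y -> 0 < c1 * Y `^ (- mu).
Proof. by move=> Y0; rewrite mulr_gt0// powR_gt0. Qed.

(** By the mean value theorem, the bounds on the second derivative of h
control the increments of the first one. *)
Lemma slope (a b Y : R) : 0 <= a -> 0 <= b -> 1 + a <= Y -> 1 + b <= Y ->
  c1 * Y `^ (- mu) * (a - b) ^+ 2 <= (f a - f b) * (a - b) /\
  (f a - f b) ^+ 2 <= c2 * ((f a - f b) * (a - b)).
Proof.
wlog ab : a b / b <= a.
  move=> H a0 b0 aY bY; have [ab|ab] := leP b a; first exact: H.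
  have [] := H b a (ltW ab) b0 a0 bY aY.
  have -> : (b - a) ^+ 2 = (a - b) ^+ 2 by ring.
  have -> : (f b - f a) ^+ 2 = (f a - f b) ^+ 2 by ring.
  by have -> : (f b - f a) * (b - a) = (f a - f b) * (a - b) by ring.
move=> a0 b0 aY bY; move: ab; rewrite le_eqVlt => /predU1P[->|ab].
  by rewrite !subrr !expr0n !mulr0.
have [c /andP[bc ca] E] := ge0_MVT (f := f) h_C2.2.1 b0 ab.
have c0 : 0 <= c by lra.
have [u _] := upper_bounds c0; have cY : 1 + c <= Y by lra.
have [l _] := lower_bounds c0 cY.
have Yp : 0 < c1 * Y `^ (- mu) by apply: lower_const_gt0; lra.
rewrite E; set m := c1 * _ in l Yp *; set g := derive_ge0 _ _ in u l *.
have -> : (g * (a - b)) ^+ 2 = g * (g * (a - b) ^+ 2) by ring.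
have -> : g * (a - b) * (a - b) = g * (a - b) ^+ 2 by ring.
have s0 := sqr_ge0 (a - b); split; first by rewrite ler_wpM2r.
by rewrite ler_wpM2r// mulr_ge0//; lra.
Qed.

(** The gradient of H, by mx_gradient_Hpot. *)
Definition stress A : 'M[R]_2 := al (frob_norm A) *: A.

(** With a = |A| and b = |B|, each side is the corresponding expression for
the numbers h'(a) and h'(b), see slope, plus a multiple of ab - A:B. The
latter is nonnegative by Cauchy-Schwarz, and the multiples compare by the
bounds on h'(t)/t. *)
Lemma stress_mono A B (Y := 1 + frob_norm A + frob_norm B)
    (Q := frob_dot (stress A - stress B) (A - B)) :
  frob_dot (stress A - stress B) (stress A - stress B) <= c2 * Q /\
  c1 * Y `^ (- mu) * frob_dot (A - B) (A - B) <= Q.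
Proof.
have a0 := frob_norm_ge0 A; have b0 := frob_norm_ge0 B.
have aY : 1 + frob_norm A <= Y by rewrite /Y; lra.
have bY : 1 + frob_norm B <= Y by rewrite /Y; lra.
have [s1 s2] := slope a0 b0 aY bY.
have [l1 l2] := (lower_bounds a0 aY, lower_bounds b0 bY).
have [u1 u2] := (upper_bounds a0, upper_bounds b0).
have CS := frob_CS A B.
have EA := frob_norm_sq A; have EB := frob_norm_sq B.
have Yp : 0 < c1 * Y `^ (- mu) by apply: lower_const_gt0; rewrite /Y; lra.
have E1 : Q = al (frob_norm A) * frob_dot A A + al (frob_norm B) * frob_dot B B -
    (al (frob_norm A) + al (frob_norm B)) * frob_dot A B.
  by rewrite /Q /stress !frob_dotE !mxE; ring.
have E2 : frob_dot (stress A - stress B) (stress A - stress B) =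
    al (frob_norm A) ^+ 2 * frob_dot A A + al (frob_norm B) ^+ 2 * frob_dot B B -
    2 * al (frob_norm A) * al (frob_norm B) * frob_dot A B.
  by rewrite /stress !frob_dotE !mxE; ring.
have E3 : frob_dot (A - B) (A - B) = frob_dot A A + frob_dot B B - 2 * frob_dot A B.
  by rewrite !frob_dotE !mxE; ring.
move: s1 s2 l1 l2 u1 u2 CS E1 E2 E3 Yp.
rewrite -EA -EB -!quot_mul; move: (frob_dot A B) (al _) (al _) => g y x.
set m := c1 * _; move: (frob_norm A) (frob_norm B) => a b.
move=> s1 s2 [_ l1] [_ l2] [_ u1] [_ u2] CS -> -> -> m0.
have xy0 : 0 <= a * b - g by lra.
split.
  have -> : c2 * (x * a ^+ 2 + y * b ^+ 2 - (x + y) * g) =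
    c2 * ((x * a - y * b) * (a - b)) + c2 * (x + y) * (a * b - g) by ring.
  have -> : x ^+ 2 * a ^+ 2 + y ^+ 2 * b ^+ 2 - 2 * x * y * g =
    (x * a - y * b) ^+ 2 + 2 * x * y * (a * b - g) by ring.
  apply: lerD => //; apply: ler_wpM2r => //; nra.
have -> : x * a ^+ 2 + y * b ^+ 2 - (x + y) * g =
    (x * a - y * b) * (a - b) + (x + y) * (a * b - g) by ring.
have -> : m * (a ^+ 2 + b ^+ 2 - 2 * g) = m * (a - b) ^+ 2 + 2 * m * (a * b - g) by ring.
by apply: lerD => //; apply: ler_wpM2r => //; lra.
Qed.

(** Cocoercivity, the first half of stress_mono, bounds |D|^2 by c2 D:E for D
the increment of the stress and E that of the matrix; expanding |D - c2 E|^2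
>= 0 concludes. *)
Lemma stress_lipschitz A B i j :
  `|stress A i j - stress B i j| <= c2 * frob_norm (A - B).
Proof.
have [H _] := stress_mono A B.
set D := stress A - stress B in H; set E := A - B in H *.
have H2 : frob_dot D D <= c2 ^+ 2 * frob_dot E E.
  have P : 0 <= frob_dot (D - c2 *: E) (D - c2 *: E) by exact: frob_dot_ge0.
  have E1 : frob_dot (D - c2 *: E) (D - c2 *: E) =
     frob_dot D D - 2 * (c2 * frob_dot D E) + c2 ^+ 2 * frob_dot E E.
    by rewrite !frob_dotE ![(_ - c2 *: E) _ _]mxE ![(- (c2 *: E)) _ _]mxE ![(c2 *: E) _ _]mxE; ring.
  by rewrite E1 in P; lra.
have -> : stress A i j - stress B i j = D i j by rewrite !mxE.
have Dij : `|D i j| <= frob_norm D.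
  rewrite -sqrtr_sqr /frob_norm ler_wsqrtr// frob_dotE -!expr2.
  have [] := (sqr_ge0 (D 0 0), sqr_ge0 (D 0 1)); have [] := (sqr_ge0 (D 1 0), sqr_ge0 (D 1 1)).
  by move: i j; apply: ord2P; apply: ord2P; lra.
apply: le_trans Dij _; rewrite -(ger0_norm (ltW c2_gt0)) -sqrtr_sqr -sqrtrM ?sqr_ge0//.
exact: ler_wsqrtr.
Qed.

Lemma frob_dot_line A i j (s : R) :
  frob_dot (A + s *: delta_mx i j) (A + s *: delta_mx i j) =
  frob_dot A A + (2 * A i j) * s + s ^+ 2.
Proof.
rewrite !frob_dotE !mxE; move: i j.
by apply: ord2P; apply: ord2P; rewrite /=; ring.
Qed.

(** At the zero matrix the norm is not differentiable, but s |-> h(|s|) is,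
with derivative h'(0) = 0. *)
Lemma mx_gradient_Hpot A : mx_gradient (Hpot h) A = stress A.
Proof.
apply/matrixP => i j; rewrite !mxE.
suff H : is_derive (0 : R) (1 : R) (fun s => Hpot h (A + s *: delta_mx i j))
    (al (frob_norm A) * A i j).
  by have H' := line_is_derive H; exact: derive_val.
have -> : (fun s : R => Hpot h (A + s *: delta_mx i j)) =
   (fun s => h (Num.sqrt (frob_dot A A + (2 * A i j) * s + s ^+ 2))).
  by apply: funext => s; rewrite /Hpot /frob_norm frob_dot_line.
have [A0|A0] := eqVneq (frob_norm A) 0; last first.
  have a0 : 0 < frob_norm A by rewrite lt_neqAle eq_sym A0 frob_norm_ge0.
  have dq : is_derive (0 : R) (1 : R) (fun s => frob_dot A A + (2 * A i j) * s + s ^+ 2) (2 * A i j).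
    have D1 := is_derive_id (0 : R) (1 : R).
    have D2 := is_deriveZ (2 * A i j) D1.
    have D3 := is_deriveM D1 D1.
    have D4 := is_deriveD (is_deriveD (is_derive_cst (frob_dot A A) (0 : R) (1 : R)) D2) D3.
    apply: (is_derive_eq D4); rewrite /GRing.scale/=; ring.
  have E0 : frob_dot A A + 2 * A i j * 0 + 0 ^+ 2 = frob_dot A A by rewrite mulr0 expr0n !addr0.
  have q0 : 0 < frob_dot A A + 2 * A i j * 0 + 0 ^+ 2 by rewrite E0 -frob_norm_sq exprn_gt0.
  have dr := is_derive1_comp (f := Num.sqrt)
    (g := fun s : R => frob_dot A A + 2 * A i j * s + s ^+ 2) (is_derive1_sqrt q0) dq.
  have dh : is_derive (Num.sqrt (frob_dot A A + 2 * A i j * 0 + 0 ^+ 2)) (1 : R) h (f (frob_norm A)).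
    by rewrite E0; apply: is_derive_ge0 => //; apply: h_C2.1; exact: ltW.
  have := is_derive1_comp (f := h)
    (g := fun s : R => Num.sqrt (frob_dot A A + 2 * A i j * s + s ^+ 2)) dh dr; congr is_derive.
  rewrite E0 -/(frob_norm A) -quot_mul; field; exact: A0.
rewrite (frob_eq0 A0) [(0 : 'M[R]_2) i j]mxE !mulr0.
have -> : (fun s : R => h (Num.sqrt (frob_dot (0 : 'M[R]_2) 0 + 0 * s + s ^+ 2))) =
   (fun s => h `|s|).
  by apply: funext => s; rewrite -sqrtr_sqr frob_dotE !mxE; congr (h (Num.sqrt _)); ring.
suff H : forall v : R, v = 0 ->
    (fun s : R => s^-1 *: (h `|s *: (1 : R) + 0| - h `|0 : R|)) @ (0 : R)^' --> v.
  by apply: DeriveDef; [apply/cvg_ex; exists 0; exact: H|apply: cvg_lim; [|exact: H]].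
move=> v v0; apply/cvgrPdist_le => eps e0.
have [d d0 Hd] := derive_ge0P (h_C2.1 0 (lexx 0)) e0.
near=> s.
have s0 : s != 0 by near: s; exact: nbhs_dnbhs_neq.
have sd : `|s| < d by near: s; exact: dnbhs0_lt.
have := Hd `|s| (normr_ge0 s); rewrite normr_eq0 => /(_ s0).
rewrite subr0 normr_id => /(_ sd).
rewrite v0 dh0 /GRing.scale/= mulr1 addr0 normr0 !sub0r !normrN !normrM normfV normr_id.
by rewrite normfV mulrC.
Unshelve. all: by end_near. Qed.

End Tensor.

(** * Radial cutoffs *)

Section Cutoff.
Context {R : realType}.
Notation V := 'rV[R]_2.
Notation I := (@plane_integral R).

Definition pospow (n : nat) (t : R) : R := Num.max 0 t ^+ n.

Lemma pospow_continuous n : continuous (pospow n).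
Proof. by apply: contX; apply: cont_max; [exact: cont_cst|exact: cont_id]. Qed.

Lemma pospow_ge0 n t : 0 <= pospow n t.
Proof. by rewrite exprn_ge0// le_max lexx. Qed.

Lemma is_derive_pospow n (t : R) :
  is_derive t (1 : R) (pospow n.+2) (n.+2%:R * pospow n.+1 t).
Proof.
have [t0|t0|t0] := ltgtP t 0.
- have N : \near t, cst (0 : R) t = pospow n.+2 t.
    near=> s; rewrite /pospow max_l ?expr0n//; apply/ltW; near: s; exact: lt_nbhsl.
  rewrite /pospow max_l ?(ltW t0)// expr0n mulr0.
  by apply: (near_eq_is_derive N); exact: is_derive_cst.
- have N : \near t, (fun s => s ^+ n.+2) t = pospow n.+2 t.
    near=> s; rewrite /pospow max_r//; apply/ltW; near: s; exact: lt_nbhsr.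
  rewrite /pospow max_r ?(ltW t0)//.
  apply: (near_eq_is_derive N).
  have H := is_deriveX n.+2 (is_derive_id t (1 : R)).
  have -> : (fun s : R => s ^+ n.+2) = (id : R -> R) ^+ n.+2.
    by apply: funext => s; rewrite !fctE.
  by apply: (is_derive_eq H); rewrite /GRing.scale/= mulr1.
have p0 m : pospow m.+1 0 = 0 by rewrite /pospow maxxx expr0n.
rewrite t0 p0 mulr0.
have := @is_derive_quot R R (pospow n.+2) 0 1 (pospow n.+1).
rewrite p0; apply; first exact: pospow_continuous.
move=> h; rewrite addr0 /GRing.scale/= mulr1 p0 subr0 /pospow exprS.
by case: ltP => // h0; rewrite expr0n /= !mulr0.
Unshelve. all: by end_near. Qed.

Variable r : R.
Hypothesis r0 : 0 < r.

Definition sqdist (x : V) : R := (x 0 0 ^+ 2 + x 0 1 ^+ 2) / r ^+ 2.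
Definition dsqdist (j : 'I_2) (x : V) : R := 2 * x 0 j / r ^+ 2.
Definition profile (x : V) : R := 1 - pospow 3 (sqdist x - 1).
Definition dprofile (j : 'I_2) (x : V) : R := - (3 * pospow 2 (sqdist x - 1) * dsqdist j x).
Definition ddprofile (j i : 'I_2) (x : V) : R :=
  - (6 * pospow 1 (sqdist x - 1) * dsqdist i x * dsqdist j x +
     3 * pospow 2 (sqdist x - 1) * (2 * (j == i)%:R / r ^+ 2)).

(** The power p^n of one profile p = max(0, 1 - max(0, |x|^2/r^2 - 1)^3),
which is 1 on the disc of radius r and 0 outside that of radius sqrt 2 * r.
Differentiating costs one power of p, so the derivatives of a cutoff are
bounded by cutoffs of lower exponent. *)
Definition cut (n : nat) (x : V) : R := pospow n (profile x).
Definition dcut (n : nat) (j : 'I_2) (x : V) : R := n%:R * cut n.-1 x * dprofile j x.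
Definition ddcut (n : nat) (j i : 'I_2) (x : V) : R :=
  n%:R * (n.-1%:R * cut n.-2 x * dprofile i x * dprofile j x + cut n.-1 x * ddprofile j i x).

Lemma sqdist_C1 : isC1 sqdist dsqdist.
Proof.
have := isC1Z (r ^- 2) (isC1D (isC1M (isC1_coord 0) (isC1_coord 0))
      (isC1M (isC1_coord 1) (isC1_coord 1))) => H.
have -> : sqdist = (fun x => r ^- 2 * (x 0 0 * x 0 0 + x 0 1 * x 0 1)).
  by apply: funext => x; rewrite /sqdist mulrC !expr2.
apply: (isC1_ext H) => j x; rewrite /dsqdist; move: j.
by apply: ord2P => /=; ring.
Qed.

Lemma dsqdist_C1 j : isC1 (dsqdist j) (fun i _ => 2 * (j == i)%:R / r ^+ 2).
Proof.
have := isC1Z (2 / r ^+ 2) (isC1_coord j) => H.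
have -> : dsqdist j = (fun x => (2 / r ^+ 2) * x 0 j).
  by apply: funext => x; rewrite /dsqdist mulrAC.
by apply: (isC1_ext H) => i x; rewrite mulrAC.
Qed.

Lemma pospow_sqdist_C1 n : isC1 (fun x => pospow n.+2 (sqdist x - 1))
  (fun j x => n.+2%:R * pospow n.+1 (sqdist x - 1) * dsqdist j x).
Proof.
have H : isC1 (fun x => sqdist x - 1) dsqdist.
  apply: (isC1_ext (isC1B sqdist_C1 (isC1_cst 1))) => j x; exact: subr0.
apply: (isC1_comp (F := pospow n.+2) (F' := fun t => n.+2%:R * pospow n.+1 t)) H.
  exact: is_derive_pospow.
by apply: contM; [exact: cont_cst|exact: pospow_continuous].
Qed.

Lemma profile_C1 : isC1 profile dprofile.
Proof.
apply: (isC1_ext (isC1B (isC1_cst 1) (pospow_sqdist_C1 1))) => j x.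
by rewrite sub0r.
Qed.

Lemma dprofile_C1 j : isC1 (dprofile j) (ddprofile j).
Proof.
have H := isC1N (isC1M (isC1Z 3 (pospow_sqdist_C1 0)) (dsqdist_C1 j)).
by apply: (isC1_ext H) => i x; rewrite /ddprofile; ring.
Qed.

Lemma cut_C1 n : isC1 (cut n.+2) (dcut n.+2).
Proof.
apply: (isC1_comp (F := pospow n.+2) (F' := fun t => n.+2%:R * pospow n.+1 t)) profile_C1.
  exact: is_derive_pospow.
by apply: contM; [exact: cont_cst|exact: pospow_continuous].
Qed.

Lemma dcut_C1 n j : isC1 (dcut n.+3 j) (ddcut n.+3 j).
Proof.
have H := isC1M (isC1Z n.+3%:R (cut_C1 n)) (dprofile_C1 j).
by apply: (isC1_ext H) => i x; rewrite /ddcut /dcut /=; ring.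
Qed.

Lemma cut_continuous n : continuous (cut n).
Proof. by apply: cont_comp (@pospow_continuous n); exact: profile_C1.1. Qed.

Lemma cut_ge0 n x : 0 <= cut n x.
Proof. exact: pospow_ge0. Qed.

Lemma cutD n m x : cut (n + m) x = cut n x * cut m x.
Proof. exact: exprD. Qed.

Lemma cutS n x : cut n.+1 x = cut 1 x * cut n x.
Proof. by rewrite -cutD. Qed.

Lemma cut0 x : cut 0 x = 1.
Proof. exact: expr0. Qed.

Lemma sqdist_ge0 x : 0 <= sqdist x.
Proof. by rewrite divr_ge0// ?addr_ge0 ?sqr_ge0. Qed.

Lemma cut1_le1 x : cut 1 x <= 1.
Proof. by rewrite /cut /pospow expr1 ge_max ler01 /= gerBl pospow_ge0. Qed.

Lemma cut_le1 n x : cut n x <= 1.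
Proof.
by elim: n => [|n IH]; rewrite ?cut0// cutS mulr_ile1 ?cut_ge0// cut1_le1.
Qed.

Lemma cut_anti n m x : (n <= m)%N -> cut m x <= cut n x.
Proof.
by move=> nm; rewrite -(subnK nm) cutD ler_piMl ?cut_ge0// cut_le1.
Qed.

Lemma cut1_gt0 x : 0 < cut 1 x -> sqdist x < 2.
Proof.
rewrite /cut /pospow expr1 lt_max ltxx /= subr_gt0 => h.
rewrite ltNge; apply/negP => q2; move: h; apply/negP; rewrite -leNgt.
rewrite exprn_ege1//.
rewrite le_max; apply/orP; right; lra.
Qed.

Lemma cut_eq0 n x : 2 <= sqdist x -> cut n.+1 x = 0.
Proof.
move=> q2; rewrite cutS; have [->|] := eqVneq (cut 1 x) 0; first by rewrite mul0r.
by move=> c0; have := @cut1_gt0 x; rewrite lt_neqAle eq_sym c0 cut_ge0 => /(_ isT); lra.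
Qed.

Lemma cut_eq1 n x : sqdist x <= 1 -> cut n x = 1.
Proof.
move=> q1; rewrite /cut /profile.
have -> : pospow 3 (sqdist x - 1) = 0 by rewrite /pospow max_l ?expr0n//; lra.
by rewrite subr0 /pospow max_r ?expr1n.
Qed.

Lemma cut_csupp n : csupp (cut n.+1) (2 * r).
Proof.
move=> x hx; apply: cut_eq0; rewrite /sqdist ler_pdivlMr ?exprn_gt0//.
apply: le_trans (norm_le_sq x); apply: le_trans (_ : (2 * r) ^+ 2 <= _).
  by rewrite exprMn ler_wpM2r ?sqr_ge0//; lra.
by rewrite lerXn2r ?nnegrE ?mulr_ge0// ltW.
Qed.

Lemma cut_Cc n : Cc (cut n.+1).
Proof. by split; [exact: cut_continuous|exists (2 * r); exact: cut_csupp]. Qed.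

Lemma I_cut_le n : I (cut n.+1) <= 16 * r ^+ 2.
Proof.
apply: le_trans (ler_norm _) _.
have -> : 16 * r ^+ 2 = 1 * (4 * (2 * r) ^+ 2) by ring.
apply: I_bound; [by rewrite mulr_ge0// ltW|exact: cut_continuous|exact: cut_csupp|].
by move=> x; rewrite ger0_norm ?cut_ge0// cut_le1.
Qed.

Lemma dsqdist_bound j x : 0 < cut 1 x -> `|dsqdist j x| <= 4 / r.
Proof.
move=> c0; have q2 := cut1_gt0 c0; have q0 := sqdist_ge0 x.
have r2 : 0 < r ^+ 2 by rewrite exprn_gt0.
have xj : `|x 0 j| <= 2 * r.
  have : x 0 j ^+ 2 <= (2 * r) ^+ 2.
    have : x 0 0 ^+ 2 + x 0 1 ^+ 2 < 2 * r ^+ 2 by rewrite -ltr_pdivrMr.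
    have [] := (sqr_ge0 (x 0 0), sqr_ge0 (x 0 1)); rewrite exprMn.
    by move: j; apply: ord2P; lra.
  by rewrite -[x 0 j ^+ 2]real_normK ?num_real// ler_pXn2r ?nnegrE ?mulr_ge0// ltW.
rewrite /dsqdist !normrM normfV (ger0_norm (ltW r2)) ler_pdivrMr//.
rewrite (ger0_norm (_ : 0 <= 2 :> R))//.
have -> : 4 / r * r ^+ 2 = 2 * (2 * r) by field; rewrite gt_eqF.
by rewrite ler_pM2l.
Qed.

Lemma dprofile_bound j x : 0 < cut 1 x -> `|dprofile j x| <= 12 / r.
Proof.
move=> c0; have q2 := cut1_gt0 c0.
have m1 : 0 <= Num.max 0 (sqdist x - 1) <= 1 by rewrite le_max lexx ge_max ler01 /=; lra.
have p2 : `|3 * pospow 2 (sqdist x - 1)| <= 3.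
  move/andP: m1 => [a b]; rewrite ger0_norm ?mulr_ge0 ?pospow_ge0//.
  by rewrite -[leRHS]mulr1 ler_pM2l// exprn_ile1.
rewrite normrN normrM; have -> : 12 / r = 3 * (4 / r) by ring.
by apply: ler_pM => //; exact: dsqdist_bound.
Qed.

Lemma ddprofile_bound j i x : 0 < cut 1 x -> `|ddprofile j i x| <= 102 / r ^+ 2.
Proof.
move=> c0; have q2 := cut1_gt0 c0.
have r2 : 0 < r ^+ 2 by rewrite exprn_gt0.
have [di dj] := (dsqdist_bound i c0, dsqdist_bound j c0).
have m1 : 0 <= Num.max 0 (sqdist x - 1) <= 1 by rewrite le_max lexx ge_max ler01 /=; lra.
have p n : `|pospow n (sqdist x - 1)| <= 1.
  move/andP: m1 => [a b]; rewrite ger0_norm ?pospow_ge0//; exact: exprn_ile1.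
have -> : 102 / r ^+ 2 = 6 * 1 * (4 / r) * (4 / r) + 3 * 1 * (2 * 1 / r ^+ 2).
  by field; rewrite gt_eqF.
have nn n : `|n%:R : R| <= n%:R by rewrite ger0_norm.
rewrite normrN; apply: normD_le.
  by apply: normM_le => //; apply: normM_le => //; apply: normM_le.
apply: normM_le; first by apply: normM_le.
apply: normM_le; last by rewrite normfV (ger0_norm (ltW r2)).
by apply: normM_le => //; case: (_ == _); rewrite ?normr1 ?normr0.
Qed.

Lemma pospow_in n x : sqdist x <= 1 -> pospow n.+1 (sqdist x - 1) = 0.
Proof. by move=> q1; rewrite /pospow max_l ?expr0n//; lra. Qed.

Lemma dprofile_in j x : sqdist x <= 1 -> dprofile j x = 0.
Proof. by move=> q1; rewrite /dprofile pospow_in// mulr0 mul0r oppr0. Qed.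

Lemma ddprofile_in j i x : sqdist x <= 1 -> ddprofile j i x = 0.
Proof. by move=> q1; rewrite /ddprofile !pospow_in// !mulr0 !mul0r addr0 oppr0. Qed.

End Cutoff.

(** * The energy of difference quotients *)

Ltac nonneg := repeat first [assumption | done | exact: sqr_ge0 | apply: exprn_ge0 |
  apply: mulr_ge0 | apply: addr_ge0].

Section Energy.
Context {R : realType}.
Notation V := 'rV[R]_2.
Notation I := (@plane_integral R).
Notation e := (fun l : 'I_2 => delta_mx 0 l : 'rV[R]_2).

Definition strain (du : 'I_2 -> 'I_2 -> V -> R) (x : V) : 'M[R]_2 :=
  \matrix_(i, j) (2^-1 * (du i j x + du j i x)).

Variables (u : 'I_2 -> V -> R) (du : 'I_2 -> 'I_2 -> V -> R) (T : V -> 'M[R]_2)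
  (M c2 : R).
Hypotheses (Hu : forall i, isC1 (u i) (du i))
  (div0 : forall x, du 0 0 x + du 1 1 x = 0)
  (uM : forall i x, `|u i x| <= M)
  (c2_gt0 : 0 < c2)
  (cT : forall i j, continuous (fun x => T x i j)) (sT : forall x, (T x)^T = T x)
  (Tcoco : forall x y, frob_dot (T y - T x) (T y - T x) <=
     c2 * frob_dot (T y - T x) (strain du y - strain du x))
  (weak : forall phi (dphi : 'I_2 -> 'I_2 -> V -> R),
     (forall i, isC1 (phi i) (dphi i)) -> (forall i, Cc (phi i)) ->
     (forall x, dphi 0 0 x + dphi 1 1 x = 0) ->
     I (fun x => \sum_i \sum_j T x i j * dphi j i x +
                 \sum_i (\sum_k u k x * du i k x) * phi i x) = 0).

Definition quotT (l : 'I_2) (s : R) (x : V) : 'M[R]_2 := s^-1 *: (T (x + s *: e l) - T x).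
Definition quotE (l : 'I_2) (s : R) (x : V) : 'M[R]_2 :=
  s^-1 *: (strain du (x + s *: e l) - strain du x).
(** Nonnegative by monotonicity of the stress. Its integral against a cutoff
plays the role of the integral of D^2H(eps)(D eps, D eps), which would involve
second derivatives of u. *)
Definition density (l : 'I_2) (s : R) (x : V) : R := frob_dot (quotT l s x) (quotE l s x).

Lemma quotTE l s x i j : quotT l s x i j = s^-1 * (T (x + s *: e l) i j - T x i j).
Proof. by rewrite !mxE. Qed.

Lemma strainE x i j : strain du x i j = 2^-1 * (du i j x + du j i x).
Proof. by rewrite mxE. Qed.

Lemma quotEE l s x i j :
  quotE l s x i j = s^-1 * (strain du (x + s *: e l) i j - strain du x i j).
Proof. by rewrite /quotE; move: (strain _ _) (strain _ x) => A B; rewrite !mxE. Qed.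

Definition quotU (l i : 'I_2) (s : R) (x : V) : R := avg l (du i l) s x.
(** A stream function of the difference quotient of u in direction e_l: the
partials of this average of a component of u are, up to sign, the entries of
the quotient, by div u = 0. It is bounded uniformly in s, which is where the
boundedness of u enters the energy estimate. *)
Definition stream (l : 'I_2) (s : R) (x : V) : R :=
  if l == 0 then - avg 0 (u 1) s x else avg 1 (u 0) s x.
Definition dstream (l j : 'I_2) (s : R) (x : V) : R :=
  if j == 0 then - quotU l 1 s x else quotU l 0 s x.
Definition dquotU (l i j : 'I_2) (s : R) (x : V) : R :=
  s^-1 * (du i j (x + s *: e l) - du i j x).

Lemma cont_at_shift (f : V -> R) (v : V) : continuous f ->
  continuous (fun x : V => f (x + v)).
Proof.
move=> cf; apply: cont_comp cf.
by apply: contD; [exact: cont_id|exact: cont_cst].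
Qed.

Lemma strain_continuous i j : continuous (fun x => strain du x i j).
Proof.
under eq_fun do rewrite strainE.
apply: contM; first exact: cont_cst.
by apply: contD; [exact: ((Hu i).2 j).2|exact: ((Hu j).2 i).2].
Qed.

Lemma quotE_continuous l s i j : continuous (fun x => quotE l s x i j).
Proof.
under eq_fun do rewrite quotEE.
apply: contM; first exact: cont_cst.
apply: contB; last exact: strain_continuous.
by apply: (cont_at_shift (f := fun y => strain du y i j)); exact: strain_continuous.
Qed.

Lemma quotT_continuous l s i j : continuous (fun x => quotT l s x i j).
Proof.
under eq_fun do rewrite quotTE.
apply: contM; first exact: cont_cst.
by apply: contB => //; exact: (cont_at_shift (f := fun y => T y i j)).
Qed.

Lemma quotUE l i s x : s != 0 -> quotU l i s x = s^-1 * (u i (x + s *: e l) - u i x).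
Proof. by move=> s0; rewrite (avg_quot _ _ _ (Hu i)) mulKf. Qed.

Lemma quotU_C1 l i s : s != 0 -> isC1 (quotU l i s) (fun j => dquotU l i j s).
Proof.
move=> s0; have -> : quotU l i s = (fun x => s^-1 * (u i (x + s *: e l) - u i x)).
  by apply: funext => x; exact: quotUE.
exact: isC1Z (isC1B (isC1_comp_shift _ (Hu i)) (Hu i)).
Qed.

Lemma avgN l (f : V -> R) s x : continuous f -> avg l (fun y => - f y) s x = - avg l f s x.
Proof.
move=> cf; rewrite /avg -mulN1r -JZ; last first.
  apply: cont_comp cf; apply: contD; first exact: cont_cst.
  by apply: contZ; [apply: contM; [exact: cont_id|exact: cont_cst]|exact: cont_cst].
by congr unit_integral; apply: funext => t; rewrite mulN1r.
Qed.

Lemma du11 x : du 1 1 x = - du 0 0 x.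
Proof. by apply/eqP; rewrite -addr_eq0 addrC div0. Qed.

Lemma stream_C1 l s : isC1 (stream l s) (fun j => dstream l j s).
Proof.
have c00 : continuous (du 0 0) by exact: ((Hu 0).2 0).2.
have E : du 1 1 = (fun y => - du 0 0 y) by apply: funext => x; exact: du11.
rewrite /stream; move: l; apply: ord2P => /=.
  apply: (isC1_ext (isC1N (avg_C1 0 s (Hu 1)))) => j x; rewrite /dstream /quotU.
  by move: j; apply: ord2P => //=; rewrite E avgN// opprK.
apply: (isC1_ext (avg_C1 1 s (Hu 0))) => j x; rewrite /dstream /quotU.
by move: j; apply: ord2P => //=; rewrite E avgN// opprK.
Qed.

Lemma dquotU_div l s x : dquotU l 0 0 s x + dquotU l 1 1 s x = 0.
Proof. by rewrite /dquotU !du11; ring. Qed.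

Lemma weak_shift v phi dphi : (forall i, isC1 (phi i) (dphi i)) -> (forall i, Cc (phi i)) ->
  (forall x, dphi 0 0 x + dphi 1 1 x = 0) ->
  I (fun x => \sum_i \sum_j T (x + v) i j * dphi j i x +
              \sum_i (\sum_k u k (x + v) * du i k (x + v)) * phi i x) = 0.
Proof.
move=> Hphi Cphi dv.
have := @weak (fun i x => phi i (x - v)) (fun i j x => dphi i j (x - v)).
have Cd i j : Cc (dphi i j) by exact: partial_Cc (Hphi i) (Cphi i).
have cb i : continuous (fun x => \sum_k u k x * du i k x).
  by apply: cont_sum => k; apply: contM; [exact: (Hu k).1|exact: ((Hu i).2 k).2].
move=> H; rewrite -[RHS]H.
- apply/esym; rewrite -(@I_shift _ (fun x => _ + _) v).
    by congr I; apply: funext => x; rewrite !sum2 !addrK.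
  apply: CcD; apply: Cc_sum => i.
    by apply: Cc_sum => j; apply: CcMl => //; exact: Cc_shift.
  by apply: CcMl => //; exact: Cc_shift.
- by move=> i; exact: isC1_comp_shift.
- by move=> i; exact: Cc_shift.
- by move=> x; exact: dv.
Qed.

Section Scale.
Variables (m : nat) (r : R).
Hypothesis r_gt0 : 0 < r.
Notation cut := (cut r).
Notation dcut := (dcut r).
Notation ddcut := (ddcut r).

(** The first partials of the cutoff of exponent m+5 with the factor of
exponent m+3 taken out (dcutE); ddweight does the same for the second ones.
Taking out a common power lets Young's inequality distribute the powers. *)
Definition dweight (i : 'I_2) (x : V) : R := m.+4.+1%:R * cut 1 x * dprofile r i x.
Definition ddweight (i j : 'I_2) (x : V) : R :=
  m.+4.+1%:R * (m.+4%:R * dprofile r j x * dprofile r i x + cut 1 x * ddprofile r i j x).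
Definition perp (i : 'I_2) (x : V) : R := if i == 0 then dweight 1 x else - dweight 0 x.
Definition dperp (i j : 'I_2) (x : V) : R := if i == 0 then ddweight 1 j x else - ddweight 0 j x.

Lemma dcutE i x : dcut m.+4.+1 i x = cut m.+3 x * dweight i x.
Proof. by rewrite /dcut /dweight /= (cutS r m.+3); ring. Qed.

Lemma ddcutE i j x : ddcut m.+4.+1 i j x = cut m.+3 x * ddweight i j x.
Proof. by rewrite /ddcut /ddweight /= (cutS r m.+3); ring. Qed.

(** The partials of the test field are the cutoff times those of the
difference quotient, plus cut m.+3 times these corrections. *)
Definition corr (l i j : 'I_2) (s : R) (x : V) : R :=
  dweight i x * quotU l j s x + dstream l i s x * perp j x + stream l s x * dperp j i x.

(** What the convection terms leave once the two fluxes below have moved all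
derivatives off the difference quotient. *)
Definition convect (l : 'I_2) (s : R) (x : V) : R :=
  - cut 2 x * (\sum_i \sum_k quotU l i s x * quotU l k s x * du i k (x + s *: e l))
  - stream l s x * (\sum_i \sum_k perp i x * quotU l k s x * du i k (x + s *: e l))
  + 2^-1 * (quotU l 0 s x ^+ 2 + quotU l 1 s x ^+ 2) * (\sum_k dweight k x * u k x)
  + \sum_k \sum_i (dstream l k s x * perp i x + stream l s x * dperp i k x) * u k x * quotU l i s x.

(** An upper bound for half of the weighted density up to terms of zero
integral. In its first summand the corrections are separated from the stress
by Young's inequality, with weights chosen so that the stress is absorbed. *)
Definition remainder (l : 'I_2) (s : R) (x : V) : R :=
  c2 / 2 * cut m.+1 x * (\sum_i \sum_j corr l i j s x ^+ 2) + cut m.+3 x * convect l s x.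

(** The rotated gradient of cut m.+4.+1 times the stream function, hence
divergence free. *)
Let phi l s (i : 'I_2) (x : V) : R :=
  cut m.+4.+1 x * quotU l i s x +
  stream l s x * (if i == 0 then dcut m.+4.+1 1 x else - dcut m.+4.+1 0 x).
Let dphi l s (i j : 'I_2) (x : V) : R :=
  cut m.+4.+1 x * dquotU l i j s x + cut m.+3 x * corr l j i s x.

Lemma perp_C1 (i : 'I_2) : isC1 (fun x : V => if i == 0 then dcut m.+4.+1 1 x else - dcut m.+4.+1 0 x)
  (fun j (x : V) => if i == 0 then ddcut m.+4.+1 1 j x else - ddcut m.+4.+1 0 j x).
Proof. by move: i; apply: ord2P => /=; [|apply: isC1N]; exact: dcut_C1. Qed.

Lemma dcut_Cc j : Cc (dcut m.+4.+1 j).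
Proof. by apply: partial_Cc (cut_C1 r m.+3) (cut_Cc r_gt0 m.+4). Qed.

Lemma perp_Cc (i : 'I_2) : Cc (fun x : V => if i == 0 then dcut m.+4.+1 1 x else - dcut m.+4.+1 0 x).
Proof. by move: i; apply: ord2P => /=; [|apply: CcN]; exact: dcut_Cc. Qed.

Lemma phi_C1 l s i : s != 0 -> isC1 (phi l s i) (dphi l s i).
Proof.
move=> s0.
have H := isC1D (isC1M (cut_C1 r m.+3) (quotU_C1 l i s0))
  (isC1M (stream_C1 l s) (perp_C1 i)).
apply: (isC1_ext H) => j x; rewrite /dphi /corr !dcutE !ddcutE /perp /dperp.
by case: (i == 0); ring.
Qed.

Lemma phi_Cc l s i : s != 0 -> Cc (phi l s i).
Proof.
move=> s0; apply: CcD.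
  by apply: CcMr; [exact: (quotU_C1 l i s0).1|exact: cut_Cc].
by apply: CcMl; [exact: (stream_C1 l s).1|exact: perp_Cc].
Qed.

Lemma phi_div l s x : s != 0 -> dphi l s 0 0 x + dphi l s 1 1 x = 0.
Proof.
move=> s0; have := dquotU_div l s x; rewrite /dphi /corr /perp /dperp /dstream /=.
have -> : ddweight 1 0 x = ddweight 0 1 x by rewrite /ddweight /ddprofile /=; ring.
by move=> /eqP; rewrite addrC addr_eq0 => /eqP ->; ring.
Qed.

Lemma quot_weak l s : s != 0 ->
  I (fun x => \sum_i \sum_j quotT l s x i j * dphi l s j i x +
    \sum_i (\sum_k (quotU l k s x * du i k (x + s *: e l) + u k x * dquotU l i k s x))
      * phi l s i x) = 0.
Proof.
move=> s0.
have Hp i := phi_C1 l i s0; have Cp i := phi_Cc l i s0; have Dp x := phi_div l x s0.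
have W1 := weak_shift (s *: e l) Hp Cp Dp.
have W0 := weak Hp Cp Dp.
have Cd i j : Cc (dphi l s i j) by exact: partial_Cc (Hp i) (Cp i).
have cb i : continuous (fun x => \sum_k u k x * du i k x).
  by apply: cont_sum => k; apply: contM; [exact: (Hu k).1|exact: ((Hu i).2 k).2].
have C0 : Cc (fun x => \sum_i \sum_j T x i j * dphi l s j i x +
                 \sum_i (\sum_k u k x * du i k x) * phi l s i x).
  apply: CcD; apply: Cc_sum => i; last exact: CcMl.
  by apply: Cc_sum => j; apply: CcMl.
have C1 : Cc (fun x => \sum_i \sum_j T (x + s *: e l) i j * dphi l s j i x +
          \sum_i (\sum_k u k (x + s *: e l) * du i k (x + s *: e l)) * phi l s i x).
  apply: CcD; apply: Cc_sum => i.
    apply: Cc_sum => j; apply: CcMl => //. exact: (cont_at_shift (f := fun y => T y i j)).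
  apply: CcMl => //.
  exact: (cont_at_shift (f := fun y => \sum_k u k y * du i k y)).
have := IB C1 C0; rewrite W0 W1 subrr => E.
have := IZ s^-1 (CcB C1 C0); rewrite E mulr0 => E2; apply: etrans E2; congr I; apply: funext => x.
rewrite !sum2 /quotT !mxE /dquotU !quotUE//.
by field.
Qed.

Lemma I_div (B : 'I_2 -> V -> R) dB : (forall k, isC1 (B k) (dB k)) -> (forall k, Cc (B k)) ->
  I (fun x => dB 0 0 x + dB 1 1 x) = 0.
Proof.
move=> HB CB; rewrite ID; [|exact: partial_Cc (HB _) (CB _)..].
by rewrite (I_partial0 0 (HB 0) (CB 0)) (I_partial0 1 (HB 1) (CB 1)) addr0.
Qed.

(** Transport by u: since div u = 0, the divergence of this flux moves the
derivative from the difference quotient W, in u_k W_i D_k W_i, to the cutoff.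
*)
Lemma kinetic_flux l s : s != 0 ->
  let B k x := cut m.+4.+1 x * (u k x * (2^-1 * (quotU l 0 s x * quotU l 0 s x +
     quotU l 1 s x * quotU l 1 s x))) in
  let dB k j x := dcut m.+4.+1 j x * (u k x * (2^-1 * (quotU l 0 s x * quotU l 0 s x +
     quotU l 1 s x * quotU l 1 s x))) + cut m.+4.+1 x * (du k j x *
     (2^-1 * (quotU l 0 s x * quotU l 0 s x + quotU l 1 s x * quotU l 1 s x)) +
     u k x * (quotU l 0 s x * dquotU l 0 j s x + quotU l 1 s x * dquotU l 1 j s x)) in
  (forall k, isC1 (B k) (dB k)) /\ (forall k, Cc (B k)).
Proof.
move=> s0 /=; have H k := isC1M (cut_C1 r m.+3) (isC1M (Hu k) (isC1Z 2^-1
    (isC1D (isC1M (quotU_C1 l 0 s0) (quotU_C1 l 0 s0))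
           (isC1M (quotU_C1 l 1 s0) (quotU_C1 l 1 s0))))).
split=> k; last first.
  apply: CcMr; last exact: cut_Cc.
  have := (isC1M (Hu k) (isC1Z 2^-1
    (isC1D (isC1M (quotU_C1 l 0 s0) (quotU_C1 l 0 s0))
           (isC1M (quotU_C1 l 1 s0) (quotU_C1 l 1 s0))))).1; exact.
by apply: (isC1_ext (H k)) => j x; field.
Qed.

(** The same for the convection of W tested with the part of the test field
that contains the stream function. *)
Lemma stream_flux l s : s != 0 ->
  let N i x := if i == 0 :> 'I_2 then dcut m.+4.+1 1 x else - dcut m.+4.+1 0 x in
  let dN i j x := if i == 0 :> 'I_2 then ddcut m.+4.+1 1 j x else - ddcut m.+4.+1 0 j x in
  let B k x := stream l s x * (u k x * (N 0 x * quotU l 0 s x + N 1 x * quotU l 1 s x)) in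
  let dB k j x := dstream l j s x * (u k x * (N 0 x * quotU l 0 s x + N 1 x * quotU l 1 s x)) +
    stream l s x * (du k j x * (N 0 x * quotU l 0 s x + N 1 x * quotU l 1 s x) +
    u k x * (dN 0 j x * quotU l 0 s x + N 0 x * dquotU l 0 j s x +
             (dN 1 j x * quotU l 1 s x + N 1 x * dquotU l 1 j s x))) in
  (forall k, isC1 (B k) (dB k)) /\ (forall k, Cc (B k)).
Proof.
move=> s0 N dN /=.
have HW i : isC1 (fun x => N i x * quotU l i s x) _ := isC1M (perp_C1 i) (quotU_C1 l i s0).
split=> k; first exact: isC1M (stream_C1 l s) (isC1M (Hu k) (isC1D (HW 0) (HW 1))).
apply: CcMl; first exact: (stream_C1 l s).1.
apply: CcMl; first exact: (Hu k).1.
have CN i : Cc (N i) by exact: perp_Cc.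
by apply: CcD; apply: CcMr => //; exact: (quotU_C1 l _ s0).1.
Qed.

Lemma density_continuous l s : continuous (density l s).
Proof. by apply: cont_sum => i; apply: cont_sum => j; apply: contM; [exact: quotT_continuous|exact: quotE_continuous]. Qed.

Lemma remainder_continuous l : continuous (fun q : R * V => remainder l q.1 q.2).
Proof.
have cx (f : V -> R) : continuous f -> continuous (fun q : R * V => f q.2).
  by move=> cf; apply: cont_comp cf; exact: cont_snd.
have cW i : continuous (fun q : R * V => quotU l i q.1 q.2).
  by apply: avg_continuous; exact: ((Hu i).2 l).2.
have cg : continuous (fun q : R * V => stream l q.1 q.2).
  rewrite /stream; case: (l == 0); last by apply: avg_continuous; exact: (Hu 0).1.
  by apply: contN; apply: avg_continuous; exact: (Hu 1).1.
have cdg j : continuous (fun q : R * V => dstream l j q.1 q.2).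
  by rewrite /dstream; case: (j == 0) => //; exact: contN.
have cds i k : continuous (fun q : R * V => du i k (q.2 + q.1 *: e l)).
  apply: cont_comp ((Hu i).2 k).2; apply: contD; first exact: cont_snd.
  by apply: contZ; [exact: cont_fst|exact: cont_cst].
have cdw i : continuous (dweight i).
  apply: contM; first by apply: contM; [exact: cont_cst|exact: cut_continuous].
  exact: (dprofile_C1 r i).1.
have cddp i j : continuous (ddprofile r i j) by exact: ((dprofile_C1 r i).2 j).2.
have cddw i j : continuous (ddweight i j).
  apply: contM; first exact: cont_cst.
  apply: contD; last by apply: contM => //; exact: cut_continuous.
  apply: contM; last exact: (dprofile_C1 r i).1.
  by apply: contM; [exact: cont_cst|exact: (dprofile_C1 r j).1].
have cp i : continuous (perp i).
  by rewrite /perp; case: (i == 0) => //; exact: contN.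
have cdp i j : continuous (dperp i j).
  by rewrite /dperp; case: (i == 0) => //; exact: contN.
have cc n : continuous (fun q : R * V => cut n q.2) by apply: cx; exact: cut_continuous.
have ccorr i j : continuous (fun q : R * V => corr l i j q.1 q.2).
  by apply: contD; [apply: contD|]; apply: contM => //; apply: cx.
apply: contD.
  apply: contM; first by apply: contM; [exact: cont_cst|].
  by apply: cont_sum => i; apply: cont_sum => j; exact: contX.
apply: contM => //.
apply: contD; last first.
  apply: cont_sum => k; apply: cont_sum => i; apply: contM => //; apply: contM; last exact: cx (Hu k).1.
  by apply: contD; apply: contM => //; exact: cx.
apply: contD; last first.
  apply: contM.
    by apply: contM; [exact: cont_cst|apply: contD; exact: contX].
  by apply: cont_sum => k; apply: contM; [exact: cx|exact: cx (Hu k).1].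
apply: contB.
  apply: contM; first exact: contN.
  by apply: cont_sum => i; apply: cont_sum => k; do 2?apply: contM.
apply: contM => //.
apply: cont_sum => i; apply: cont_sum => k; apply: contM => //; apply: contM => //.
exact: cx.
Qed.

Lemma remainder_csupp l s : csupp (remainder l s) (2 * r).
Proof.
by move=> x hx; rewrite /remainder !(cut_csupp r_gt0)// mulr0 !mul0r addr0.
Qed.

Lemma young_stress (k t z : R) : 0 <= k ->
  - (k * t * z) <= 2^-1 * (k * t ^+ 2 / c2) + c2 / 2 * (k * z ^+ 2).
Proof.
move=> k0; rewrite -subr_ge0.
have -> : 2^-1 * (k * t ^+ 2 / c2) + c2 / 2 * (k * z ^+ 2) - - (k * t * z) =
  k * (t + c2 * z) ^+ 2 / (2 * c2) by field; rewrite gt_eqF.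
by apply: divr_ge0; [rewrite mulr_ge0 ?sqr_ge0|rewrite mulr_ge0 ?(ltW c2_gt0)].
Qed.

(** The difference of the shifted and unshifted equations, tested with phi,
minus the divergences of the two fluxes, is pointwise free of derivatives of
the difference quotient of u; cocoercivity absorbs the stress in half of the
density. *)
Lemma energy_half l s : s != 0 ->
  2^-1 * I (fun x => cut m.+4.+1 x * density l s x) <= I (remainder l s).
Proof.
move=> s0.
have F1 := quot_weak l s0.
have [HB1 CB1] := kinetic_flux l s0; have F2 := I_div HB1 CB1.
have [HB2 CB2] := stream_flux l s0; have F3 := I_div HB2 CB2.
move: F1 F2 F3; set f1 := fun x => _ + _; set f2 := fun x => _ + _; set f3 := fun x => _ + _.
move=> F1 F2 F3.
(* All terms with dquotU, the derivatives of the quotients, cancel here. *)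
have E x : f1 x - f2 x - f3 x = cut m.+4.+1 x * density l s x +
    cut m.+3 x * (\sum_i \sum_j quotT l s x i j * corr l i j s x) -
    cut m.+3 x * convect l s x.
  rewrite /f1 /f2 /f3 /dphi /phi /density /frob_dot /convect /corr /perp /dperp !dcutE !ddcutE.
  have T10 : quotT l s x 1 0 = quotT l s x 0 1.
    by rewrite !quotTE -[in LHS](sT x) -[in LHS](sT (x + _)) !mxE.
  have cE : cut m.+4.+1 x = cut m.+3 x * cut 2 x by rewrite -cutD addn2.
  rewrite !sum2 !quotEE !strainE /= T10 cE /dquotU !du11.
  by field.
have Cq i j := @quotT_continuous l s i j.
have Cf1 : Cc f1.
  apply: CcD; apply: Cc_sum => i.
    apply: Cc_sum => j; apply: CcMl => //.
    exact: partial_Cc (phi_C1 l j s0) (phi_Cc l j s0).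
  apply: CcMl; last exact: phi_Cc.
  apply: cont_sum => k; apply: contD; apply: contM.
  - exact: (quotU_C1 l k s0).1.
  - refine (@cont_at_shift (du i k) (s *: e l) _); exact: ((Hu i).2 k).2.
  - exact: (Hu k).1.
  - exact: ((quotU_C1 l i s0).2 k).2.
have Cf2 : Cc f2 by apply: CcD; exact: partial_Cc (HB1 _) (CB1 _).
have Cf3 : Cc f3 by apply: CcD; exact: partial_Cc (HB2 _) (CB2 _).
have CQ : Cc (fun x => cut m.+4.+1 x * density l s x).
  by apply: CcMr; [exact: density_continuous|exact: cut_Cc].
have CR : Cc (remainder l s).
  split; last by exists (2 * r); exact: remainder_csupp.
  exact: (@cont_slice R R V (remainder l) s (@remainder_continuous l)).
have E0 : I (fun x => f1 x - f2 x - f3 x) = 0.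
  rewrite IB//; last exact: CcB.
  by rewrite IB// F1 F2 F3 !subrr.
rewrite -subr_le0 -IZ// -IB//; last exact: CcZ.
rewrite -[leRHS]E0; apply: I_le; [by apply: CcB => //; exact: CcZ|by apply: CcB => //; exact: CcB|].
move=> x; rewrite E /remainder -subr_ge0.
have co : frob_dot (quotT l s x) (quotT l s x) <= c2 * density l s x.
  have := Tcoco x (x + s *: e l); rewrite /density !frob_dotE !quotTE !quotEE.
  move: (T _) (T x) (strain du _) (strain du x) => A B C D; rewrite !mxE => H.
  have s2 : 0 <= s^-1 ^+ 2 by rewrite sqr_ge0.
  by have := ler_wpM2l s2 H; congr (is_true (_ <= _)); ring.
have c30 : cut m.+3 x = cut m.+1 x * cut 2 x by rewrite -cutD addn2.
have c40 : cut m.+4.+1 x = cut m.+1 x * cut 2 x ^+ 2.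
  by rewrite expr2 -!cutD !addnS !addn0.
have k0 := cut_ge0 r m.+1 x.
have Y i j := young_stress (cut 2 x * quotT l s x i j) (corr l i j s x) k0.
have S : cut m.+1 x * (cut 2 x ^+ 2 * frob_dot (quotT l s x) (quotT l s x)) / c2 <=
         cut m.+4.+1 x * density l s x.
  rewrite ler_pdivrMr// c40 mulrA -[leRHS]mulrA [_ * c2]mulrC.
  by apply: ler_wpM2l => //; rewrite mulr_ge0 ?sqr_ge0.
have := (Y 0 0, Y 0 1, Y 1 0, Y 1 1); move: S; rewrite frob_dotE c30 !sum2.
set D := density l s x; set C := cut m.+4.+1 x; set K := cut m.+1 x; set p := cut 2 x.
set t00 := quotT _ _ _ 0 0; set t01 := quotT _ _ _ 0 1; set t10 := quotT _ _ _ 1 0.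
set t11 := quotT _ _ _ 1 1; set z00 := corr _ 0 0 _ _; set z01 := corr _ 0 1 _ _.
set z10 := corr _ 1 0 _ _; set z11 := corr _ 1 1 _ _; set cv := convect _ _ _.
move=> S [[[Y00 Y01] Y10] Y11].
have E1 : K * (p ^+ 2 * (t00 * t00 + t01 * t01 + t10 * t10 + t11 * t11)) / c2 =
   K * (p * t00) ^+ 2 / c2 + K * (p * t01) ^+ 2 / c2 + K * (p * t10) ^+ 2 / c2 +
   K * (p * t11) ^+ 2 / c2 by ring.
rewrite E1 in S.
have -> : C * D + K * p * (t00 * z00 + t01 * z01 + (t10 * z10 + t11 * z11)) - K * p * cv -
  (2^-1 * (C * D) - (c2 / 2 * K * (z00 ^+ 2 + z01 ^+ 2 + (z10 ^+ 2 + z11 ^+ 2)) + K * p * cv)) =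
  2^-1 * (C * D) + (K * (p * t00) * z00 + c2 / 2 * (K * z00 ^+ 2)) +
  (K * (p * t01) * z01 + c2 / 2 * (K * z01 ^+ 2)) +
  (K * (p * t10) * z10 + c2 / 2 * (K * z10 ^+ 2)) +
  (K * (p * t11) * z11 + c2 / 2 * (K * z11 ^+ 2)) by field.
move: Y00 Y01 Y10 Y11 S.
move: (K * (p * t00) ^+ 2 / c2) (K * (p * t01) ^+ 2 / c2) (K * (p * t10) ^+ 2 / c2)
  (K * (p * t11) ^+ 2 / c2) => a b c d; lra.
Qed.

Definition gradsq (x : V) : R := \sum_i \sum_j du i j x ^+ 2.
Definition gradn (x : V) : R := Num.sqrt (gradsq x).

Lemma gradsq_ge0 x : 0 <= gradsq x.
Proof. by rewrite /gradsq !sum2 !addr_ge0 ?sqr_ge0. Qed.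

Lemma du_le_gradn i j x : `|du i j x| <= gradn x.
Proof.
rewrite -sqrtr_sqr ler_wsqrtr// /gradsq !sum2.
have [] := (sqr_ge0 (du 0 0 x), sqr_ge0 (du 0 1 x)); have [] := (sqr_ge0 (du 1 0 x), sqr_ge0 (du 1 1 x)).
by move: i j; apply: ord2P; apply: ord2P; lra.
Qed.

Lemma gradn_sq x : gradn x ^+ 2 = gradsq x.
Proof. by rewrite sqr_sqrtr// gradsq_ge0. Qed.

Lemma gradsq_continuous : continuous gradsq.
Proof.
by apply: cont_sum => i; apply: cont_sum => j; apply: contX; exact: ((Hu i).2 j).2.
Qed.

Let K1 : R := 12 * m.+4.+1%:R.
Let K2 : R := m.+4.+1%:R * (m.+4%:R * 144 + 102).

Lemma dweight_bound i x : 0 < cut 1 x -> `|dweight i x| <= K1 * r^-1 * cut 1 x.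
Proof.
move=> c0; have := dprofile_bound r_gt0 i c0 => h.
rewrite /dweight (_ : K1 * r^-1 * cut 1 x = m.+4.+1%:R * cut 1 x * (12 / r)); last first.
  by rewrite /K1; ring.
apply: normM_le h; apply: normM_le; first by rewrite ger0_norm.
by rewrite ger0_norm ?cut_ge0.
Qed.

Lemma ddweight_bound i j x : 0 < cut 1 x -> `|ddweight i j x| <= K2 * r^-1 ^+ 2.
Proof.
move=> c0; have di := dprofile_bound r_gt0 i c0; have dj := dprofile_bound r_gt0 j c0.
have dd := ddprofile_bound r_gt0 i j c0.
rewrite (_ : K2 * r^-1 ^+ 2 = m.+4.+1%:R * (m.+4%:R * (12 / r) * (12 / r) + 1 * (102 / r ^+ 2))); last first.
  by rewrite /K2; field; rewrite gt_eqF.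
apply: normM_le; first by rewrite ger0_norm.
apply: normD_le; last first.
  by apply: normM_le dd; rewrite ger0_norm ?cut_ge0// cut1_le1.
by apply: normM_le di; apply: normM_le dj; rewrite ger0_norm.
Qed.

Lemma quotU0 l i x : quotU l i 0 x = du i l x.
Proof. exact: avg0. Qed.

Lemma stream0_bound l x : `|stream l 0 x| <= M.
Proof. by rewrite /stream !avg0; case: (l == 0); rewrite ?normrN. Qed.

Lemma dstream0_bound l j x : `|dstream l j 0 x| <= gradn x.
Proof.
by rewrite /dstream !quotU0; case: (j == 0); rewrite ?normrN; exact: du_le_gradn.
Qed.

Lemma perp_bound i x : 0 < cut 1 x -> `|perp i x| <= K1 * r^-1 * cut 1 x.
Proof. by move=> c0; rewrite /perp; case: (i == 0); rewrite ?normrN; exact: dweight_bound. Qed.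

Lemma dperp_bound i j x : 0 < cut 1 x -> `|dperp i j x| <= K2 * r^-1 ^+ 2.
Proof. by move=> c0; rewrite /dperp; case: (i == 0); rewrite ?normrN; exact: ddweight_bound. Qed.

Lemma corr0_bound l i j x : 0 < cut 1 x ->
  corr l i j 0 x ^+ 2 <= 8 * (K1 * r^-1 * cut 1 x * gradn x) ^+ 2 + 2 * (M * (K2 * r^-1 ^+ 2)) ^+ 2.
Proof.
move=> c0.
have H : `|corr l i j 0 x| <= K1 * r^-1 * cut 1 x * gradn x + gradn x * (K1 * r^-1 * cut 1 x) +
    M * (K2 * r^-1 ^+ 2).
  apply: normD_le; [apply: normD_le|]; apply: normM_le.
  - exact: dweight_bound.
  - by rewrite quotU0; exact: du_le_gradn.
  - exact: dstream0_bound.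
  - exact: perp_bound.
  - exact: stream0_bound.
  - exact: dperp_bound.
rewrite -[corr _ _ _ _ _ ^+ 2]real_normK ?num_real//.
move: H; set A := K1 * r^-1 * cut 1 x * gradn x; set B := M * _.
rewrite [gradn x * _]mulrC -/A => H; have n0 := normr_ge0 (corr l i j 0 x).
have H2 : `|corr l i j 0 x| ^+ 2 <= (A + A + B) ^+ 2 by rewrite lerXn2r ?nnegrE//; lra.
apply: le_trans H2 _; rewrite -subr_ge0.
by rewrite (_ : _ - _ = (2 * A - B) ^+ 2) ?sqr_ge0//; ring.
Qed.

Definition cubic (l : 'I_2) (x : V) : R := \sum_i \sum_k du i l x * du k l x * du i k x.

(** The trace of A A^T A vanishes for a trace-free 2 x 2 matrix A, as A^2 is
then scalar. *)
Lemma cubic_sum x : cubic 0 x + cubic 1 x = 0.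
Proof. by rewrite /cubic !sum2 du11; ring. Qed.

Lemma convect0_bound l x : 0 < cut 1 x ->
  `|convect l 0 x + cut 2 x * cubic l x| <=
   r^-1 * gradn x ^+ 2 * (10 * M * K1) + r^-1 ^+ 2 * gradn x * (4 * M ^+ 2 * K2).
Proof.
move=> c0; have c1 := cut1_le1 r x.
have M0 : 0 <= M by apply: le_trans (uM 0 x).
have n0 : 0 <= gradn x by exact: sqrtr_ge0.
have K10 : 0 <= K1 by rewrite mulr_ge0.
have a0 : 0 <= r^-1 by rewrite invr_ge0 ltW.
have K1c : K1 * r^-1 * cut 1 x <= K1 * r^-1 by rewrite ler_piMr// mulr_ge0.
have dw i : `|dweight i x| <= K1 * r^-1 := le_trans (dweight_bound i c0) K1c.
have pw i : `|perp i x| <= K1 * r^-1 := le_trans (perp_bound i c0) K1c.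
have du' i j : `|du i j x| <= gradn x := du_le_gradn i j x.
rewrite /convect /cubic scale0r addr0 !sum2 !quotU0.
set X := (X in `|X|).
have -> : X = - stream l 0 x * (perp 0 x * du 0 l x * du 0 0 x + perp 0 x * du 1 l x * du 0 1 x +
   (perp 1 x * du 0 l x * du 1 0 x + perp 1 x * du 1 l x * du 1 1 x)) +
   2^-1 * (du 0 l x * du 0 l x + du 1 l x * du 1 l x) * (dweight 0 x * u 0 x + dweight 1 x * u 1 x) +
   ((dstream l 0 0 x * perp 0 x + stream l 0 x * dperp 0 0 x) * u 0 x * du 0 l x +
    (dstream l 0 0 x * perp 1 x + stream l 0 x * dperp 1 0 x) * u 0 x * du 1 l x +
    ((dstream l 1 0 x * perp 0 x + stream l 0 x * dperp 0 1 x) * u 1 x * du 0 l x +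
     (dstream l 1 0 x * perp 1 x + stream l 0 x * dperp 1 1 x) * u 1 x * du 1 l x)).
  by rewrite /X; ring.
set n := gradn x in n0 *; set a := r^-1 in a0 dw pw *.
have -> : a * n ^+ 2 * (10 * M * K1) + a ^+ 2 * n * (4 * M ^+ 2 * K2) =
  M * (K1 * a * n * n + K1 * a * n * n + (K1 * a * n * n + K1 * a * n * n)) +
  2^-1 * (n * n + n * n) * (K1 * a * M + K1 * a * M) +
  ((n * (K1 * a) + M * (K2 * a ^+ 2)) * M * n + (n * (K1 * a) + M * (K2 * a ^+ 2)) * M * n +
   ((n * (K1 * a) + M * (K2 * a ^+ 2)) * M * n + (n * (K1 * a) + M * (K2 * a ^+ 2)) * M * n)).
  by field.
have st : `|- stream l 0 x| <= M by rewrite normrN; exact: stream0_bound.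
have hf : `|2^-1 : R| <= 2^-1 by rewrite ger0_norm.
apply: normD_le; [apply: normD_le|].
- apply: normM_le => //; apply: normD_le; apply: normD_le;
    apply: normM_le (du' _ _); apply: normM_le (du' _ _); exact: pw.
- apply: normM_le; last by apply: normD_le; apply: normM_le.
  apply: normM_le => //; apply: normD_le; apply: normM_le; exact: du'.
- have D j k i : `|(dstream l j 0 x * perp i x + stream l 0 x * dperp i j x) * u j x * du k l x|
     <= (n * (K1 * a) + M * (K2 * a ^+ 2)) * M * n.
    apply: normM_le (du' _ _); apply: normM_le (uM _ _); apply: normD_le; apply: normM_le => //.
    + exact: dstream0_bound.
    + exact: stream0_bound.
    + exact: dperp_bound.
  by apply: normD_le; apply: normD_le.
Qed.

Definition energy_const : R := 32 * c2 * K1 ^+ 2 + 20 * M * K1 + 4 * M ^+ 2 * K2 +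
  8 * c2 * M ^+ 2 * K2 ^+ 2 + 4 * M ^+ 2 * K2.

Lemma energy_const_ge0 : 0 <= energy_const.
Proof.
have M0 : 0 <= M by apply: le_trans (uM 0 0).
have K10 : 0 <= K1 by rewrite mulr_ge0.
have K20 : 0 <= K2 by rewrite mulr_ge0// addr_ge0// mulr_ge0.
have c20 := ltW c2_gt0.
move: K10 K20; rewrite /energy_const; move: K1 K2 => k1 k2 K10 K20; nonneg.
Qed.

(** At s = 0 the quotients are partial derivatives, and the cubic terms cancel
in the sum over the directions. Nothing else is left on the inner disc; in the
transition annulus, where chi is at least 1, every other term carries a factor
1/r. *)
Lemma remainder0_bound (chi : V -> R) x : 1 <= r -> 0 <= chi x ->
  (1 <= sqdist r x <= 2 -> 1 <= chi x) ->
  remainder 0 0 x + remainder 1 0 x <=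
    energy_const * (r^-1 * (cut m.+3 x * chi x * gradsq x) + r^-1 ^+ 3 * cut m.+1 x).
Proof.
move=> r1 chi0 chi1.
have M0 : 0 <= M by apply: le_trans (uM 0 x).
have n0 : 0 <= gradn x by exact: sqrtr_ge0.
have K10 : 0 <= K1 by rewrite mulr_ge0.
have K20 : 0 <= K2 by rewrite mulr_ge0// addr_ge0// mulr_ge0.
have a0 : 0 <= r^-1 by rewrite invr_ge0 ltW.
have a1 : r^-1 <= 1 by rewrite invf_le1.
have C0 := energy_const_ge0.
have k0 := cut_ge0 r m.+1 x; have P0 := cut_ge0 r m.+3 x.
have RHS0 : 0 <= energy_const * (r^-1 * (cut m.+3 x * chi x * gradsq x) + r^-1 ^+ 3 * cut m.+1 x).
  have g0 := gradsq_ge0 x.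
  apply: mulr_ge0 => //; apply: addr_ge0; apply: mulr_ge0 => //; last exact: exprn_ge0.
  by apply: mulr_ge0 => //; exact: mulr_ge0.
have [c0|c0] := eqVneq (cut 1 x) 0.
  have kz : cut m.+1 x = 0 by rewrite cutS c0 mul0r.
  have Pz : cut m.+3 x = 0 by rewrite cutS c0 mul0r.
  by rewrite /remainder !(kz, Pz, mulr0, mul0r, addr0).
have {}c0 : 0 < cut 1 x by rewrite lt_neqAle eq_sym c0 cut_ge0.
have [q1|q1] := leP (sqdist r x) 1.
  have dw i : dweight i x = 0 by rewrite /dweight dprofile_in// mulr0.
  have ddw i j : ddweight i j x = 0.
    by rewrite /ddweight !dprofile_in// ddprofile_in// !mulr0 addr0 mulr0.
  have pw i : perp i x = 0 by rewrite /perp !dw oppr0 if_same.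
  have dpw i j : dperp i j x = 0 by rewrite /dperp !ddw oppr0 if_same.
  have c l i j : corr l i j 0 x = 0 by rewrite /corr dw pw dpw mul0r !mulr0 !addr0.
  have cv l : convect l 0 x = - (cut 2 x * cubic l x).
    rewrite /convect !sum2 !pw !dpw !dw !quotU0 scale0r addr0 /cubic !sum2; ring.
  rewrite /remainder !sum2 !c !cv !expr0n !addr0 !mulr0 !add0r.
  by rewrite -mulrDr -opprD -mulrDr cubic_sum mulr0 oppr0 mulr0.
have q2 := cut1_gt0 c0.
have {}chi1 : 1 <= chi x by apply: chi1; rewrite !ltW.
have PE : cut m.+3 x = cut m.+1 x * cut 1 x ^+ 2 by rewrite expr2 -!cutD !addnS !addn0.
have B0 := convect0_bound 0 c0; have B1 := convect0_bound 1 c0.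
have V0 i j := corr0_bound 0 i j c0; have V1 i j := corr0_bound 1 i j c0.
have H0 := le_trans (ler_norm _) B0; have H1 := le_trans (ler_norm _) B1.
have cs := cubic_sum x.
rewrite /remainder !sum2.
have {V0} := (V0 0 0, V0 0 1, V0 1 0, V0 1 1); have {V1} := (V1 0 0, V1 0 1, V1 1 0, V1 1 1).
move: H0 H1 cs PE; rewrite -gradn_sq.
move: (convect 0 0 x) (convect 1 0 x) (cubic 0 x) (cubic 1 x) => v0 v1 w0 w1.
set n := gradn x in n0 *; set a := r^-1 in a0 a1 *; set c := cut 1 x in c0 *.
set k := cut m.+1 x in k0 *; set P := cut m.+3 x in P0 *; set p := cut 2 x.
set z := chi x in chi0 chi1 *.
set A := 8 * _ + _; set B := _ + a ^+ 2 * _ * _.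
move=> H0 H1 cs PE [[[A1 A2] A3] A4] [[[A5 A6] A7] A8].
move: A1 A2 A3 A4 A5 A6 A7 A8.
move: (corr 1 0 0 0 x ^+ 2) (corr 1 0 1 0 x ^+ 2) (corr 1 1 0 0 x ^+ 2) (corr 1 1 1 0 x ^+ 2)
  (corr 0 0 0 0 x ^+ 2) (corr 0 0 1 0 x ^+ 2) (corr 0 1 0 0 x ^+ 2) (corr 0 1 1 0 x ^+ 2)
  => z1 z2 z3 z4 z5 z6 z7 z8 A1 A2 A3 A4 A5 A6 A7 A8.
have S1 : c2 / 2 * k * (z5 + z6 + (z7 + z8)) + c2 / 2 * k * (z1 + z2 + (z3 + z4)) <=
    c2 / 2 * k * (8 * A).
  rewrite -mulrDr; apply: ler_wpM2l; last by lra.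
  by rewrite mulr_ge0// divr_ge0// ltW.
have S2 : P * v0 + P * v1 <= P * (2 * B).
  rewrite -mulrDr; apply: ler_wpM2l => //.
  have : p * w0 + p * w1 = 0 by rewrite -mulrDr cs mulr0.
  lra.
have a2 : a ^+ 2 <= a by rewrite expr2 ler_piMr.
have a4 : a ^+ 4 <= a ^+ 3 by rewrite exprS ler_piMl// exprn_ge0.
have Pk : P <= k.
  by rewrite PE ler_piMr//; apply: exprn_ile1; [exact: ltW|exact: cut1_le1].
have an : 2 * (a ^+ 2 * n) <= a * n ^+ 2 + a ^+ 3.
  rewrite -subr_ge0 (_ : _ - _ = a * (n - a) ^+ 2); last ring.
  by rewrite mulr_ge0// sqr_ge0.
have n20 : 0 <= n ^+ 2 by exact: sqr_ge0.
have c20 := ltW c2_gt0.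
have M20 : 0 <= M ^+ 2 by exact: sqr_ge0.
have T1 : 32 * c2 * K1 ^+ 2 * (P * n ^+ 2) * a ^+ 2 <= 32 * c2 * K1 ^+ 2 * (P * n ^+ 2) * a.
  by apply: ler_wpM2l => //; nonneg.
have T2 : 8 * c2 * M ^+ 2 * K2 ^+ 2 * k * a ^+ 4 <= 8 * c2 * M ^+ 2 * K2 ^+ 2 * k * a ^+ 3.
  by apply: ler_wpM2l => //; nonneg.
have T3 : 4 * M ^+ 2 * K2 * P * (2 * (a ^+ 2 * n)) <= 4 * M ^+ 2 * K2 * P * (a * n ^+ 2 + a ^+ 3).
  by apply: ler_wpM2l => //; nonneg.
have T4 : 4 * M ^+ 2 * K2 * a ^+ 3 * P <= 4 * M ^+ 2 * K2 * a ^+ 3 * k.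
  by apply: ler_wpM2l => //; nonneg.
set k1 : R := 32 * c2 * K1 ^+ 2 + 20 * M * K1 + 4 * M ^+ 2 * K2.
set k2 : R := 8 * c2 * M ^+ 2 * K2 ^+ 2 + 4 * M ^+ 2 * K2.
have k10 : 0 <= k1 by rewrite /k1; nonneg.
have k20 : 0 <= k2 by rewrite /k2; nonneg.
have kE : energy_const = k1 + k2 by rewrite /energy_const /k1 /k2; ring.
have T5 : k1 * (a * (P * n ^+ 2)) <= k1 * (a * (P * z * n ^+ 2)).
  apply: ler_wpM2l => //; apply: ler_wpM2l => //; apply: ler_wpM2r => //.
  by rewrite ler_peMr.
have T6 : 0 <= k2 * (a * (P * z * n ^+ 2)) by nonneg.
have T7 : 0 <= k1 * (a ^+ 3 * k) by nonneg.
have S1' : c2 / 2 * k * (8 * A) = 32 * c2 * K1 ^+ 2 * (P * n ^+ 2) * a ^+ 2 +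
   8 * c2 * M ^+ 2 * K2 ^+ 2 * k * a ^+ 4.
  by rewrite /A PE; field.
have S2' : P * (2 * B) = 20 * M * K1 * (a * (P * n ^+ 2)) + 4 * M ^+ 2 * K2 * P * (2 * (a ^+ 2 * n)).
  by rewrite /B; ring.
have -> : energy_const * (a * (P * z * n ^+ 2) + a ^+ 3 * k) =
  k1 * (a * (P * z * n ^+ 2)) + k2 * (a * (P * z * n ^+ 2)) + k1 * (a ^+ 3 * k) + k2 * (a ^+ 3 * k).
  by rewrite kE; ring.
have T5' : k1 * (a * (P * n ^+ 2)) = 32 * c2 * K1 ^+ 2 * (P * n ^+ 2) * a +
  20 * M * K1 * (a * (P * n ^+ 2)) + 4 * M ^+ 2 * K2 * P * (a * n ^+ 2).
  by rewrite /k1; ring.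
have k2' : k2 * (a ^+ 3 * k) = 8 * c2 * M ^+ 2 * K2 ^+ 2 * k * a ^+ 3 + 4 * M ^+ 2 * K2 * a ^+ 3 * k.
  by rewrite /k2; ring.
have T3' : 4 * M ^+ 2 * K2 * P * (a * n ^+ 2 + a ^+ 3) = 4 * M ^+ 2 * K2 * P * (a * n ^+ 2) +
   4 * M ^+ 2 * K2 * a ^+ 3 * P by ring.
rewrite k2'; rewrite T5' in T5; rewrite T3' in T3; rewrite S1' in S1; rewrite S2' in S2.
move: S1 S2 T1 T2 T3 T4 T5 T6 T7; rewrite -!addrA; lra.
Qed.

Definition energy (s : R) : R := \sum_l I (fun x => cut m.+4.+1 x * density l s x).

Lemma energy_arith (x0 x1 y0 y1 e0 e1 G w d C a : R) : 0 <= C -> 0 <= a -> 0 <= G ->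
  x0 + x1 <= C * (a * G + w) -> 2^-1 * e0 <= y0 -> 2^-1 * e1 <= y1 ->
  `|x0 - y0| < d / 4 -> `|x1 - y1| < d / 4 -> w <= 16 * a ->
  e0 + e1 <= 32 * C * a * (G + 1) + d.
Proof.
move=> C0 a0 G0 B E0 E1; rewrite !ltr_norml => /andP[N0 _] /andP[N1 _] B2.
have : C * (a * G + w) <= C * (16 * a * (G + 1)).
  apply: ler_wpM2l => //; have := mulr_ge0 a0 G0; lra.
have -> : 32 * C * a * (G + 1) = 2 * (C * (16 * a * (G + 1))) by ring.
lra.
Qed.

(** The remainders are continuous in s, so their bound at s = 0 survives up to
delta for small s, although the density, whose limit would involve second
derivatives of u, may have none. *)
Lemma energy_limit (chi : V -> R) (delta : R) : 1 <= r -> continuous chi ->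
  (forall x, 0 <= chi x) -> (forall x, 1 <= sqdist r x <= 2 -> 1 <= chi x) -> 0 < delta ->
  \forall s \near (0 : R)^'+, energy s <=
    32 * energy_const * r^-1 * (I (fun x => cut m.+3 x * chi x * gradsq x) + 1) + delta.
Proof.
move=> r1 cchi chi0 chi1 d0.
have CR l s : Cc (remainder l s).
  split; last by exists (2 * r); exact: remainder_csupp.
  exact: (@cont_slice R R V (remainder l) s (@remainder_continuous l)).
have cI l : {for 0, continuous (fun s => I (remainder l s))}.
  apply: (@I_continuous R R (remainder l) (2 * r)); first exact: remainder_continuous.
  by near=> s; exact: remainder_csupp.
have d4 : 0 < delta / 4 by rewrite divr_gt0.
have N l : \forall s \near (0 : R)^'+, `|I (remainder l 0) - I (remainder l s)| < delta / 4.
  have /cvgrPdist_lt/(_ _ d4) H := cI l.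
  by apply: cvg_within; exact: H.
near=> s.
have s0 : s != 0 by rewrite gt_eqF//; near: s; exact: nbhs_right_gt.
have [N0 N1] : `|I (remainder 0 0) - I (remainder 0 s)| < delta / 4 /\
    `|I (remainder 1 0) - I (remainder 1 s)| < delta / 4.
  by near: s; exact: filterI (N 0) (N 1).
have E0 := @energy_half 0 s s0; have E1 := @energy_half 1 s s0.
have CC : Cc (fun x => cut m.+3 x * chi x * gradsq x).
  apply: CcMr; first exact: gradsq_continuous.
  by apply: CcMr => //; exact: cut_Cc.
have B : I (remainder 0 0) + I (remainder 1 0) <= energy_const * (r^-1 *
   I (fun x => cut m.+3 x * chi x * gradsq x) + r^-1 ^+ 3 * I (cut m.+1)).
  have CCut : Cc (cut m.+1) by exact: cut_Cc.
  rewrite -ID// -!IZ// -ID; [|exact: CcZ..].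
  rewrite -IZ; last by apply: CcD; exact: CcZ.
  apply: I_le; [exact: CcD|by apply: CcZ; apply: CcD; exact: CcZ|].
  by move=> x; apply: remainder0_bound => //; exact: chi1.
have a0 : 0 <= r^-1 by rewrite invr_ge0 ltW.
have G0 : 0 <= I (fun x => cut m.+3 x * chi x * gradsq x).
  apply: I_ge0 => x; apply: mulr_ge0; last exact: gradsq_ge0.
  by apply: mulr_ge0 => //; exact: cut_ge0.
have B2 : r^-1 ^+ 3 * I (cut m.+1) <= 16 * r^-1.
  have -> : 16 * r^-1 = r^-1 ^+ 3 * (16 * r ^+ 2) by field; rewrite gt_eqF.
  by apply: ler_wpM2l; [exact: exprn_ge0|exact: I_cut_le].
have C0 := energy_const_ge0.
rewrite /energy sum2; exact: (energy_arith C0 a0 G0 B E0 E1 N0 N1 B2).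
Unshelve. all: by end_near. Qed.

End Scale.
End Energy.

(** * The gradient controlled by the energy *)

Section Interpolation.
Context {R : realType}.
Notation V := 'rV[R]_2.
Notation I := (@plane_integral R).
Notation e := (fun l : 'I_2 => delta_mx 0 l : 'rV[R]_2).

Variables (u : 'I_2 -> V -> R) (du : 'I_2 -> 'I_2 -> V -> R) (T : V -> 'M[R]_2)
  (M c1 mu : R).
Hypotheses (Hu : forall i, isC1 (u i) (du i))
  (div0 : forall x, du 0 0 x + du 1 1 x = 0)
  (uM : forall i x, `|u i x| <= M)
  (c1_gt0 : 0 < c1)
  (cT : forall i j, continuous (fun x => T x i j))
  (Tcoer : forall x y, c1 * (1 + frob_norm (strain du x) + frob_norm (strain du y)) `^ (- mu) *
     frob_dot (strain du y - strain du x) (strain du y - strain du x) <=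
     frob_dot (T y - T x) (strain du y - strain du x)).
Notation density := (density du T).
Notation quotU := (quotU du).
Notation quotE := (quotE du).
Notation gradsq := (gradsq du).
Notation gradn := (gradn du).
Notation strain := (strain du).

Definition strain_size (l : 'I_2) (s : R) (x : V) : R :=
  1 + frob_norm (strain x) + frob_norm (strain (x + s *: e l)).

Lemma amgm (t A B lam : R) : 0 < lam -> 0 <= A -> 0 <= B -> t ^+ 2 <= A * B ->
  t <= lam * A + B / (4 * lam).
Proof.
move=> l0 A0 B0 tAB; set y := _ + _.
have l4 : 0 < 4 * lam by rewrite mulr_gt0.
have y0 : 0 <= y by apply: addr_ge0; [apply: mulr_ge0 => //|apply: divr_ge0 => //]; exact: ltW.
have [t0|t0] := leP t 0; first exact: le_trans t0 y0.
rewrite -(@ler_pXn2r _ 2) ?nnegrE// ?(ltW t0)//; apply: le_trans tAB _; rewrite -subr_ge0.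
have -> : y ^+ 2 - A * B = (lam * A - B / (4 * lam)) ^+ 2.
  by rewrite /y; field; rewrite gt_eqF.
exact: sqr_ge0.
Qed.

Lemma entry_sq (A : 'M[R]_2) i j : A i j ^+ 2 <= frob_dot A A.
Proof.
rewrite frob_dotE -!expr2.
have [] := (sqr_ge0 (A 0 0), sqr_ge0 (A 0 1)); have [] := (sqr_ge0 (A 1 0), sqr_ge0 (A 1 1)).
by move: i j; apply: ord2P; apply: ord2P; lra.
Qed.

Lemma strain_size_ge1 l s x : 1 <= strain_size l s x.
Proof.
by rewrite /strain_size -addrA lerDl addr_ge0// frob_norm_ge0.
Qed.

Lemma quotE_coercive l s x :
  frob_dot (quotE l s x) (quotE l s x) <= strain_size l s x `^ mu / c1 * density l s x.
Proof.
have y1 := strain_size_ge1 l s x; have y0 : 0 < strain_size l s x by lra.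
have p0 : 0 < strain_size l s x `^ mu by exact: powR_gt0.
have H := Tcoer x (x + s *: e l); rewrite -/(strain_size l s x) powRN in H.
have s2 : 0 <= s^-1 ^+ 2 by rewrite sqr_ge0.
rewrite mulrAC ler_pdivlMr// mulrC -ler_pdivrMl// mulrA.
have := ler_wpM2l s2 H; congr (is_true (_ <= _)); rewrite /density !frob_dotE.
  rewrite !quotEE; move: (strain _) (strain x) => A B; rewrite !mxE; ring.
rewrite !quotEE !quotTE; move: (T _) (T x) (strain _) (strain x) => A B C D.
by rewrite !mxE; ring.
Qed.

Lemma density_ge0 l s x : 0 <= density l s x.
Proof.
have y0 : 0 < strain_size l s x by have := strain_size_ge1 l s x; lra.
have p0 : 0 < strain_size l s x `^ mu / c1 by rewrite divr_gt0// powR_gt0.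
by rewrite -(pmulr_rge0 _ p0); apply: le_trans (quotE_coercive l s x); exact: frob_dot_ge0.
Qed.

Lemma quotE_young (z w th B lam : R) l s x i j : 0 <= w -> 0 <= th -> z ^+ 2 = w * th ->
  0 < lam -> th * strain_size l s x `^ mu <= B ->
  z * `|quotE l s x i j| <= lam * (w * density l s x) + B / c1 / (4 * lam).
Proof.
move=> w0 th0 zz l0 HB; have D0 := density_ge0 l s x.
have B0 : 0 <= B by apply: le_trans HB; rewrite mulr_ge0// powR_ge0.
apply: amgm => //; [exact: mulr_ge0|by rewrite divr_ge0// ltW|].
rewrite exprMn zz real_normK ?num_real//.
have H := le_trans (entry_sq (quotE l s x) i j) (quotE_coercive l s x).
have := ler_wpM2l (mulr_ge0 w0 th0) H.
move/le_trans; apply.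
have -> : w * th * (strain_size l s x `^ mu / c1 * density l s x) =
  w * density l s x * (th * strain_size l s x `^ mu / c1) by ring.
apply: ler_wpM2l; first exact: mulr_ge0.
by rewrite ler_pM2r// invr_gt0.
Qed.

Lemma strain_norm_continuous : continuous (fun x => frob_norm (strain x)).
Proof.
apply: (cont_comp (f := Num.sqrt)); last exact: sqrt_continuous.
apply: cont_sum => i; apply: cont_sum => j.
by apply: contM; exact: strain_continuous.
Qed.

Lemma strain_le_gradn i j x : `|strain x i j| <= gradn x.
Proof.
rewrite strainE; have h1 := du_le_gradn du i j x; have h2 := du_le_gradn du j i x.
rewrite (_ : gradn x = 2^-1 * (gradn x + gradn x)); last by field.
by apply: normM_le; [rewrite ger0_norm|exact: normD_le].
Qed.

Lemma strain_norm_sq x : frob_norm (strain x) ^+ 2 <= gradsq x.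
Proof.
rewrite frob_norm_sq frob_dotE !strainE /gradsq !sum2 -subr_ge0.
rewrite (_ : _ - _ = 2^-1 * (du 0 1 x - du 1 0 x) ^+ 2); last by field.
by rewrite mulr_ge0// sqr_ge0.
Qed.

Variables (zeta : V -> R) (dzeta : 'I_2 -> V -> R) (r : R).
Hypotheses (Hz : isC1 zeta dzeta) (sz : csupp zeta r) (z0 : forall x, 0 <= zeta x).

Let Cz : Cc zeta.
Proof. by split; [exact: Hz.1|exists r]. Qed.

(** Translation invariance applied to zeta * strain * u: a discrete
integration by parts in which the strain is never differentiated. *)
Lemma strain_by_parts s i j : s != 0 ->
  I (fun x => zeta x * strain x i j * quotU j i s x +
    (zeta x * quotE j s x i j * u i (x + s *: e j) +
     avg j (dzeta j) s x * (strain (x + s *: e j) i j * u i (x + s *: e j)))) = 0.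
Proof.
move=> s0.
pose F x := zeta x * (strain x i j * u i x).
have CF : Cc F.
  by apply: CcMr => //; apply: contM; [exact: strain_continuous|exact: (Hu i).1].
have E := I_shift (s *: e j) CF.
have := IZ s^-1 (CcB (Cc_shift (s *: e j) CF) CF).
rewrite IB ?E ?subrr ?mulr0//; last exact: Cc_shift.
move=> E2; apply: etrans E2; congr I; apply: funext => x; rewrite /F.
have A : avg j (dzeta j) s x = s^-1 * (zeta (x + s *: e j) - zeta x).
  by rewrite (avg_quot _ _ _ Hz) mulKf.
by rewrite A (quotUE Hu)// quotEE; field.
Qed.

(** Since div u = 0, the term D_i u_j D_j u_i is a divergence; its integral
lives on the gradient of zeta. *)
Lemma null_lagrangian s i : s != 0 ->
  I (fun x => \sum_j (dzeta j x * (u i x * quotU i j s x) +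
     zeta x * (du i j x * quotU i j s x))) = 0.
Proof.
move=> s0; have HB j := isC1M Hz (isC1M (Hu i) (quotU_C1 Hu i j s0)).
have CB j : Cc (fun x => zeta x * (u i x * quotU i j s x)).
  by apply: CcMr => //; apply: contM; [exact: (Hu i).1|exact: (quotU_C1 Hu i j s0).1].
apply: etrans (I_div HB CB); congr I; apply: funext => x; rewrite sum2.
have := dquotU_div div0 i s x => /eqP; rewrite addrC addr_eq0 => /eqP ->; ring.
Qed.

(** At s = 0 this is zeta |Du|^2 (principal0), by the identity |Du|^2 = 2 Du :
eps - D_i u_j D_j u_i. *)
Definition principal (s : R) (x : V) : R :=
  \sum_i \sum_j (2 * zeta x * strain x i j * quotU j i s x - zeta x * du i j x * quotU i j s x).

Definition lateral (s : R) (x : V) : R :=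
  \sum_i \sum_j (2 * avg j (dzeta j) s x * strain (x + s *: e j) i j * u i (x + s *: e j) -
     dzeta j x * u i x * quotU i j s x).

Lemma principal0 x : principal 0 x = zeta x * gradsq x.
Proof.
rewrite /principal /gradsq !sum2 /quotU !avg0 !strainE.
by field.
Qed.

Lemma lateral0 x : - (6 * M * ((`|dzeta 0 x| + `|dzeta 1 x|) * gradn x)) <= lateral 0 x.
Proof.
have D i j : `|2 * avg j (dzeta j) 0 x * strain (x + 0 *: e j) i j * u i (x + 0 *: e j) -
     dzeta j x * u i x * quotU i j 0 x| <= 3 * M * (`|dzeta j x| * gradn x).
  rewrite scale0r addr0 /quotU !avg0.
  rewrite (_ : 3 * M * _ = 2 * `|dzeta j x| * gradn x * M + `|dzeta j x| * M * gradn x); last ring.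
  apply: normD_le; last first.
    by rewrite normrN; apply: normM_le; [apply: normM_le|exact: du_le_gradn].
  apply: normM_le => //; apply: normM_le; last exact: strain_le_gradn.
  by apply: normM_le => //; rewrite ger0_norm.
have H : `|lateral 0 x| <= 3 * M * (`|dzeta 0 x| * gradn x) + 3 * M * (`|dzeta 1 x| * gradn x) +
   (3 * M * (`|dzeta 0 x| * gradn x) + 3 * M * (`|dzeta 1 x| * gradn x)).
  by rewrite /lateral !sum2; apply: normD_le; apply: normD_le; exact: D.
move: H; rewrite ler_norml => /andP[H _]; apply: le_trans H.
by rewrite lerN2 le_eqVlt; apply/orP; left; apply/eqP; ring.
Qed.

Variables (omega theta sigma kappa : V -> R).
Hypotheses (Cw : Cc omega) (w0 : forall x, 0 <= omega x) (th0 : forall x, 0 <= theta x)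
  (zz : forall x, zeta x ^+ 2 = omega x * theta x)
  (cs : continuous sigma) (ss : csupp sigma r)
  (ck : continuous kappa) (sk : csupp kappa r) (k0 : forall x, 0 <= kappa x)
  (thY : forall x y, 1 <= y -> theta x * y `^ mu <= sigma x + kappa x * y ^+ 2).

Definition majorant (l : 'I_2) (s : R) (x : V) : R := sigma x + kappa x * strain_size l s x ^+ 2.

Definition defect (lam s : R) (x : V) : R :=
  principal s x + lateral s x - M / (lam * c1) * (majorant 0 s x + majorant 1 s x).

Lemma defect_continuous lam : continuous (fun q : R * V => defect lam q.1 q.2).
Proof.
have cx (f : V -> R) : continuous f -> continuous (fun q : R * V => f q.2).
  by move=> cf; apply: cont_comp cf; exact: cont_snd.
have cW l i : continuous (fun q : R * V => quotU l i q.1 q.2).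
  by apply: avg_continuous; exact: ((Hu i).2 l).2.
have csh (f : V -> R) l : continuous f -> continuous (fun q : R * V => f (q.2 + q.1 *: e l)).
  move=> cf; apply: cont_comp cf; apply: contD; first exact: cont_snd.
  by apply: contZ; [exact: cont_fst|exact: cont_cst].
have cz := Hz.1; have cst i j : continuous (fun x => strain x i j) by exact: strain_continuous.
have csn := strain_norm_continuous.
have cy l : continuous (fun q : R * V => strain_size l q.1 q.2).
  apply: contD; first by apply: contD; [exact: cont_cst|exact: (cx (fun x => frob_norm (strain x)))].
  exact: (csh (fun x => frob_norm (strain x))).
have cm l : continuous (fun q : R * V => majorant l q.1 q.2).
  by apply: contD; [exact: cx|apply: contM; [exact: cx|exact: contX]].
apply: contB; last by apply: contM; [exact: cont_cst|exact: contD].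
apply: contD; apply: cont_sum => i; apply: cont_sum => j; apply: contB.
- apply: contM => //; apply: contM; last exact: (cx (fun x => strain x i j)).
  by apply: contM; [exact: cont_cst|exact: cx].
- apply: contM => //; apply: contM; first exact: cx.
  by apply: (cx (du i j)); exact: ((Hu i).2 j).2.
- apply: contM; last by apply: csh; exact: (Hu i).1.
  apply: contM; last exact: (csh (fun x => strain x i j)).
  by apply: contM; [exact: cont_cst|apply: avg_continuous; exact: (Hz.2 j).2].
- apply: contM => //; apply: contM; first by apply: cx; exact: (Hz.2 j).2.
  by apply: cx; exact: (Hu i).1.
Qed.

Lemma defect_csupp lam s : csupp (defect lam s) (r + 1 + `|s|).
Proof.
move=> x hx; have s0 := normr_ge0 s.
have dz j : dzeta j x = 0.
  by have Q := @partial_csupp R zeta dzeta j r Hz sz; apply: Q; lra.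
have az j : avg j (dzeta j) s x = 0.
  by have Q := @avg_csupp R j (dzeta j) (r + 1) s (@partial_csupp R zeta dzeta j r Hz sz); apply: Q.
have zx : zeta x = 0 by apply: sz; lra.
rewrite /defect /principal /lateral /majorant !sum2 zx !dz !az ss; last lra.
rewrite sk; last lra.
by rewrite !(mulr0, mul0r, subr0, addr0).
Qed.

Lemma defect_Cc lam s : Cc (defect lam s).
Proof.
split; last by exists (r + 1 + `|s|); exact: defect_csupp.
exact: (@cont_slice R R V (defect lam) s (@defect_continuous lam)).
Qed.

Lemma interpolation_half lam s : 0 < lam -> s != 0 ->
  I (defect lam s) <= 4 * M * lam * \sum_l I (fun x => omega x * density l s x).
Proof.
move=> l0 s0.
have M0 : 0 <= M by apply: le_trans (uM 0 0).
pose S i j x := zeta x * strain x i j * quotU j i s x +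
    (zeta x * quotE j s x i j * u i (x + s *: e j) +
     avg j (dzeta j) s x * (strain (x + s *: e j) i j * u i (x + s *: e j))).
pose N i x := \sum_j (dzeta j x * (u i x * quotU i j s x) +
     zeta x * (du i j x * quotU i j s x)).
have cW l i : continuous (quotU l i s) := (quotU_C1 Hu l i s0).1.
have cq l i j : continuous (fun x => quotE l s x i j) by exact: quotE_continuous.
have cush i l : continuous (fun x : V => u i (x + s *: e l)).
  by apply: (@cont_at_shift R (u i)); exact: (Hu i).1.
have Cdz j : Cc (dzeta j) by exact: partial_Cc Hz Cz.
have Caz j : Cc (avg j (dzeta j) s).
  split; last by exists (r + 1 + `|s|); apply: avg_csupp; exact: partial_csupp Hz sz.
  exact: (@cont_slice R R V (avg j (dzeta j)) s (avg_continuous (Hz.2 j).2)).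
have CS i j : Cc (S i j).
  apply: CcD; first by apply: CcMr => //; apply: CcMr => //; exact: strain_continuous.
  apply: CcD; first by apply: CcMr => //; exact: CcMr.
  apply: CcMr => //; apply: contM => //.
  by apply: (@cont_at_shift R (fun y => strain y i j)); exact: strain_continuous.
have CN i : Cc (N i).
  apply: Cc_sum => j; apply: CcD; apply: CcMr => //; apply: contM => //.
    exact: (Hu i).1.
  exact: ((Hu i).2 j).2.
have CD l : Cc (fun x => omega x * density l s x).
  by apply: CcMr => //; exact: density_continuous.
pose G x := \sum_i \sum_j 2 * S i j x - \sum_i N i x.
have CSS : Cc (fun x => \sum_i \sum_j 2 * S i j x).
  by apply: Cc_sum => i; apply: Cc_sum => j; exact: CcZ.
have CG : Cc G by apply: CcB => //; exact: Cc_sum.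
have G0 : I G = 0.
  rewrite IB//; last exact: Cc_sum.
  rewrite !I_sum// => [|i]; last by apply: Cc_sum => j; exact: CcZ.
  rewrite [X in _ - X]big1 => [|i _]; last exact: null_lagrangian.
  rewrite subr0 big1// => i _; rewrite I_sum => [|j]; last exact: CcZ.
  by rewrite big1// => j _; rewrite IZ// strain_by_parts ?mulr0.
rewrite -I_sum// -IZ; last exact: Cc_sum.
rewrite -[leRHS]add0r -[X in _ <= X + _]G0 -ID//; last by apply: CcZ; exact: Cc_sum.
apply: I_le; [exact: defect_Cc|by apply: CcD => //; apply: CcZ; exact: Cc_sum|].
move=> x; rewrite -subr_ge0.
have Y i j : - (2 * zeta x * quotE j s x i j * u i (x + s *: e j)) <=
    2 * M * (lam * (omega x * density j s x) + majorant j s x / c1 / (4 * lam)).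
  have := quotE_young i j (w0 x) (th0 x) (zz x) l0 (thY x (strain_size_ge1 j s x)).
  set q := quotE _ _ _ _ _ => Hq.
  apply: le_trans (ler_norm _) _; rewrite normrN.
  have -> : 2 * zeta x * q * u i (x + s *: e j) = (2 * u i (x + s *: e j)) * (zeta x * q) by ring.
  apply: normM_le; first by apply: normM_le => //; rewrite ger0_norm.
  by rewrite normrM (ger0_norm (z0 x)).
have := (Y 0 0, Y 0 1, Y 1 0, Y 1 1).
rewrite /G /S /N /defect /principal /lateral !sum2.
set q00 := quotE _ _ _ 0 0; set q01 := quotE _ _ _ 0 1; set q10 := quotE _ _ _ 1 0.
set q11 := quotE _ _ _ 1 1.
set m0 := majorant 0 s x; set m1 := majorant 1 s x.
set d0 := omega x * density 0 s x; set d1 := omega x * density 1 s x.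
move=> [[[Y00 Y01] Y10] Y11].
have E : M / (lam * c1) * (m0 + m1) = 2 * (2 * M * (m0 / c1 / (4 * lam))) + 2 * (2 * M * (m1 / c1 / (4 * lam))).
  by field; rewrite !gt_eqF.
rewrite E {E}.
move: Y00 Y01 Y10 Y11; rewrite !mulrDr -!addrA; move: (m0 / c1 / (4 * lam)) (m1 / c1 / (4 * lam)) => b0 b1.
lra.
Qed.

(** The factorization zeta^2 = omega * theta shares the weight between the
energy, which gets omega, and the degenerate factor y^mu of the coercivity,
which gets theta. The hypothesis thY trades y^mu for y^2, so that kappa is the
weight with which |Du|^2 comes back on the right. *)
Lemma interpolation lam delta : 0 < lam -> 0 < delta ->
  \forall s \near (0 : R)^'+,
  I (fun x => zeta x * gradsq x) <=
    4 * M * lam * \sum_l I (fun x => omega x * density l s x) +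
    2 * M / (lam * c1) * I (fun x => sigma x + kappa x * (2 + 8 * gradsq x)) +
    6 * M * I (fun x => (`|dzeta 0 x| + `|dzeta 1 x|) * gradn x) + delta.
Proof.
move=> l0 d0.
have M0 : 0 <= M by apply: le_trans (uM 0 0).
have cI : {for 0, continuous (fun s => I (defect lam s))}.
  apply: (@I_continuous R R (defect lam) (r + 2)); first exact: defect_continuous.
  apply: filterS (@small_near0 R) => s s1 x hx.
  by have Q := @defect_csupp lam s; apply: Q; lra.
have Cs : Cc sigma by split => //; exists r.
have Ck : Cc kappa by split => //; exists r.
have cg := gradsq_continuous Hu.
have cgn : continuous gradn by apply: cont_comp cg _; exact: sqrt_continuous.
have C1 : Cc (fun x => zeta x * gradsq x) by exact: CcMr.
have C2 : Cc (fun x => sigma x + kappa x * (2 + 8 * gradsq x)).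
  apply: CcD => //; apply: CcMr => //; apply: contD; first exact: cont_cst.
  by apply: contM => //; exact: cont_cst.
have C3 : Cc (fun x => (`|dzeta 0 x| + `|dzeta 1 x|) * gradn x).
  apply: CcMr => //; split; first by apply: contD; apply: cont_norm; exact: (Hz.2 _).2.
  exists (r + 1) => x hx; have Q j := @partial_csupp R zeta dzeta j r Hz sz.
  by rewrite (Q 0 x hx) (Q 1 x hx) normr0 addr0.
have B : I (fun x => zeta x * gradsq x) <= I (defect lam 0) +
    2 * M / (lam * c1) * I (fun x => sigma x + kappa x * (2 + 8 * gradsq x)) +
    6 * M * I (fun x => (`|dzeta 0 x| + `|dzeta 1 x|) * gradn x).
  have CD := defect_Cc lam 0.
  rewrite -!IZ// -ID//; last exact: CcZ.
  rewrite -ID//; [|by apply: CcD => //; exact: CcZ|exact: CcZ].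
  apply: I_le => //; first by apply: CcD; [apply: CcD => //|]; exact: CcZ.
  move=> x; rewrite /defect principal0.
  have L := lateral0 x.
  have m l : majorant l 0 x <= sigma x + kappa x * (2 + 8 * gradsq x).
    rewrite lerD2l; apply: ler_wpM2l => //; rewrite /strain_size scale0r addr0.
    have := strain_norm_sq x; set t := frob_norm _ => Ht.
    have : 0 <= (1 - 2 * t) ^+ 2 by exact: sqr_ge0.
    have -> : (1 - 2 * t) ^+ 2 = 2 + 8 * t ^+ 2 - (1 + t + t) ^+ 2 by ring.
    lra.
  have c0 : 0 <= M / (lam * c1) by rewrite divr_ge0// ltW// mulr_gt0.
  have := ler_wpM2l c0 (lerD (m 0) (m 1)).
  have -> : 2 * M / (lam * c1) = 2 * (M / (lam * c1)) by ring.
  set c := M / _; set b := sigma x + _; rewrite [c * (b + b)]mulrDr => H.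
  rewrite -[2 * c * b]mulrA; lra.
near=> s.
have s0 : s != 0 by rewrite gt_eqF//; near: s; exact: nbhs_right_gt.
have H : `|I (defect lam 0) - I (defect lam s)| < delta.
  by near: s; apply: cvg_within; move/cvgrPdist_lt/(_ _ d0) : cI; exact.
have ar (x y y' a b c : R) : x <= y + a + b -> y - y' < delta -> y' <= c ->
    x <= c + a + b + delta by lra.
by move: H; rewrite ltr_norml => /andP[_ H]; exact: ar B H (interpolation_half l0 s0).
Unshelve. all: by end_near. Qed.

End Interpolation.

(** * Nested cutoffs and hole filling *)

Section CutoffEstimates.
Context {R : realType}.
Notation V := 'rV[R]_2.

Lemma sqdist_scale (r c : R) (x : V) : c != 0 -> r != 0 -> sqdist (c * r) x = sqdist r x / c ^+ 2.
Proof. by move=> c0 r0; rewrite /sqdist; field; rewrite c0 r0. Qed.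

Lemma dcut_bound (r : R) n j x : 0 < r ->
  `|dcut r n.+2 j x| <= n.+2%:R * (12 / r) * cut r n.+1 x.
Proof.
move=> r0; have [c0|c0] := eqVneq (cut r 1 x) 0.
  by rewrite /dcut /= cutS c0 !mul0r mulr0 mul0r normr0 mulr0.
have {}c0 : 0 < cut r 1 x by rewrite lt_neqAle eq_sym c0 cut_ge0.
rewrite /dcut /= mulrAC; apply: normM_le; last by rewrite ger0_norm ?cut_ge0.
by apply: normM_le; [rewrite ger0_norm|exact: dprofile_bound].
Qed.

Lemma dcut_in (r : R) n j x : sqdist r x <= 1 -> dcut r n j x = 0.
Proof. by move=> q1; rewrite /dcut dprofile_in// mulr0. Qed.

Lemma dcut_out (r : R) n j x : 2 <= sqdist r x -> dcut r n.+2 j x = 0.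
Proof. by move=> q2; rewrite /dcut /= cut_eq0// mulr0 mul0r. Qed.

Lemma pospow_mono n (a b : R) : a <= b -> pospow n a <= pospow n b.
Proof.
move=> ab; have m0 c : 0 <= Num.max (0 : R) c by rewrite le_max lexx.
by apply: lerXn2r; rewrite ?nnegrE// ge_max m0 le_max ab orbT.
Qed.

Lemma cut_mono (r r' : R) n x : 0 < r -> r <= r' -> cut r n x <= cut r' n x.
Proof.
move=> r0 rr; have r'0 : 0 < r' by lra.
have q : sqdist r' x <= sqdist r x.
  rewrite /sqdist; apply: ler_wpM2l; first by rewrite addr_ge0 ?sqr_ge0.
  rewrite lef_pV2 ?posrE ?exprn_gt0// lerXn2r ?nnegrE//; lra.
by do 2![apply: pospow_mono; rewrite ?lerD2l ?lerN2]; rewrite lerD2r.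
Qed.

(** This difference of nested cutoffs is at least 1 on the annulus that
carries the gradient of the intermediate cutoff, and its integrals are
differences at two radii, which telescope along dyadic radii. *)
Definition ring_cut (n : nat) (r : R) (x : V) : R := cut (2 * r) n x - cut (r / 2) n x.

Lemma ring_cut_ge0 n r x : 0 < r -> 0 <= ring_cut n r x.
Proof. by move=> r0; rewrite subr_ge0; apply: cut_mono; lra. Qed.

Lemma ring_cut_ge1 n r x : 0 < r -> 1 <= sqdist r x <= 2 -> 1 <= ring_cut n.+1 r x.
Proof.
move=> r0 /andP[q1 q2]; rewrite /ring_cut cut_eq1; last first.
  by rewrite sqdist_scale ?gt_eqF// ler_pdivrMr ?mul1r; lra.
rewrite cut_eq0 ?subr0// [r / 2]mulrC sqdist_scale ?gt_eqF// exprVn invrK.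
lra.
Qed.

(** The differences on the right telescope, while b 1 bounds each left side
from below by monotonicity. *)
Lemma hole_filling (b : nat -> R) (A c B : R) N : 0 <= A ->
  (forall j, (j <= N)%N -> b j <= b j.+1) -> (forall j, (j <= N.+1)%N -> 0 <= b j <= B) ->
  (forall j, (j < N)%N -> b j.+1 <= A * (b j.+2 - b j) + c) ->
  N%:R * b 1%N <= 2 * A * B + N%:R * c.
Proof.
move=> A0 mono bnd step.
have b1 j : (0 < j <= N.+1)%N -> b 1%N <= b j.
  elim: j => // j IH /andP[_ jN]; case: j IH jN => // j IH jN.
  by apply: le_trans (IH _) (mono _ _) => //; exact: ltnW.
have H n : (n <= N)%N -> n%:R * b 1%N <= A * (b n.+1 + b n - b 1%N - b 0%N) + n%:R * c.
  elim: n => [|n IH] nN; first by rewrite !mul0r addr0 [b 1%N + _]addrC addrK subrr mulr0.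
  have := IH (ltnW nN); have := step n nN; have := b1 n.+1.
  rewrite /= ltnS (ltnW nN) => /(_ isT) => h1 h2 h3; rewrite -!natr1 !mulrDl !mul1r.
  rewrite (_ : A * (b n.+2 + b n.+1 - b 1%N - b 0%N) =
    A * (b n.+1 + b n - b 1%N - b 0%N) + A * (b n.+2 - b n)); last ring.
  lra.
apply: le_trans (H N (leqnn N)) _; rewrite lerD2r.
rewrite (_ : 2 * A * B = A * (2 * B)); last ring.
apply: ler_wpM2l => //.
have /andP[p1 p2] := bnd N.+1 (leqnn _); have /andP[p3 p4] := bnd N (leqnSn _).
have /andP[p5 p6] := bnd 0%N (leq0n _); have /andP[p7 p8] := bnd 1%N isT.
lra.
Qed.

(** If p^2 y^(2 - mu) >= 1 then y^mu <= p^2 y^2; otherwise the left side is at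
most (p^2 y^(2 - mu))^(j + 1) < 1 by the choice of j. A suitable j exists
because mu < 2. *)
Lemma half_power (mu : R) (j : nat) p y : mu <= 2 -> mu <= j.+1%:R * (2 - mu) ->
  0 <= p -> 1 <= y -> p ^+ (2 * j.+1) * y `^ mu <= 1 + p ^+ (2 * j.+1).+2 * y ^+ 2.
Proof.
move=> mu2 jmu p0 y1; have y0 : 0 < y by lra.
have P0 n : 0 <= p ^+ n by exact: exprn_ge0.
have [h|h] := leP 1 (p ^+ 2 * y `^ (2 - mu)).
  apply: ler_wpDl => //.
  have e2 : y ^+ 2 = y `^ (2 - mu) * y `^ mu.
    rewrite -powRD; last by rewrite (gt_eqF y0) implybT.
    by rewrite subrK powR_mulrn// ltW.
  have -> : p ^+ (2 * j.+1).+2 * y ^+ 2 =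
     (p ^+ 2 * y `^ (2 - mu)) * (p ^+ (2 * j.+1) * y `^ mu).
    by rewrite e2 -addn2 exprD; ring.
  by rewrite ler_peMl// mulr_ge0// powR_ge0.
apply: ler_wpDr; first by rewrite mulr_ge0// exprn_ge0// ltW.
apply: (@le_trans _ _ ((p ^+ 2 * y `^ (2 - mu)) ^+ j.+1)); last first.
  by apply: exprn_ile1; [rewrite mulr_ge0// powR_ge0|exact: ltW].
rewrite exprMn -exprM; apply: ler_wpM2l => //.
rewrite -powR_mulrn ?powR_ge0// -powRrM; apply: ler_powR => //.
by rewrite mulrC.
Qed.

End CutoffEstimates.

(** * The dyadic recursion *)

Section Vanishing.
Context {R : realType}.

Lemma exp2_ge (x : R) : exists n : nat, x <= 2 ^+ n.
Proof.
have [n hn] : exists n : nat, x <= n%:R.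
  exists (Num.bound `|x|); apply: (le_trans (ler_norm x)); apply/ltW.
  by apply: archi_boundP; exact: normr_ge0.
exists n; apply: (le_trans hn); rewrite -natrX ler_nat; exact/ltnW/ltn_expl.
Qed.

(** Hole filling along the radii 2^n, ..., 2^(n + N + 1): L makes the constant
term small, then n makes L/r at most 1/L, then N makes the boundary term
small. Only finitely many conditions on s are used, so they hold together near
0. It is used for the energy, and for the Dirichlet integral, which does not
depend on s. *)
Lemma recursion_vanish (Phi : R -> R -> R) (C B R1 : R) : 0 <= C -> 0 <= B -> 1 <= R1 ->
  (forall r s, 0 <= Phi r s) ->
  (forall r r' s, 0 < r -> r <= r' -> Phi r s <= Phi r' s) ->
  (forall r, R1 <= r -> \forall s \near (0 : R)^'+, Phi r s <= B) ->
  (forall L r, 1 <= L -> R1 <= r -> \forall s \near (0 : R)^'+,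
     Phi r s <= C * (L * (Phi (2 * r) s - Phi (r / 2) s) + L^-1 + L / r)) ->
  forall r eps, 0 < r -> 0 < eps -> \forall s \near (0 : R)^'+, Phi r s <= eps.
Proof.
move=> C0 B0 R11 P0 Pm Pb Pr r eps r0 e0.
(* The constant term 2 C / L is then at most eps / 2. *)
pose L : R := 4 * C / eps + 1.
have L1 : 1 <= L by rewrite /L lerDr divr_ge0 ?mulr_ge0// ltW.
have L0 : 0 < L by lra.
have [N hN] := exp2_ge (4 * C * L * B / eps).
have {N hN} [N N0 hN] : exists2 N, (0 < N)%N & 4 * C * L * B <= eps * N%:R.
  exists (2 ^ N)%N; first by rewrite expn_gt0.
  by rewrite natrX [leRHS]mulrC -ler_pdivrMr.
have [n hn] := exp2_ge (r + R1 + L ^+ 2).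
have L20 : 0 <= L ^+ 2 by rewrite sqr_ge0.
have big j : R1 <= 2 ^+ (n + j).
  have : (2 : R) ^+ n <= 2 ^+ (n + j) by rewrite ler_eXn2l ?leq_addr// ltr1n.
  lra.
have H1 : \forall s \near (0 : R)^'+, forall j : 'I_N.+2, Phi (2 ^+ (n + j)) s <= B.
  by apply: filter_forall => j; apply: Pb.
have H2 : \forall s \near (0 : R)^'+, forall j : 'I_N, Phi (2 ^+ (n + j.+1)) s <=
   C * (L * (Phi (2 * 2 ^+ (n + j.+1)) s - Phi (2 ^+ (n + j.+1) / 2) s) + L^-1 + L / 2 ^+ (n + j.+1)).
  by apply: filter_forall => j; apply: Pr.
move: H1 H2; apply: filterS2 => s H1 H2.
have pm a b : (a <= b)%N -> Phi (2 ^+ (n + a)) s <= Phi (2 ^+ (n + b)) s.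
  by move=> ab; apply: Pm; [rewrite exprn_gt0|rewrite ler_eXn2l ?leq_add2l// ltr1n].
have H := @hole_filling _ (fun j => Phi (2 ^+ (n + j)) s) (C * L) (2 * C / L) B N.
apply: le_trans (_ : Phi (2 ^+ (n + 1)) s <= eps).
  apply: Pm => //; have : (2 : R) ^+ n <= 2 ^+ (n + 1) by rewrite ler_eXn2l ?leq_addr// ltr1n.
  lra.
have Nr : 0 < N%:R :> R by rewrite ltr0n.
rewrite -(ler_pM2l Nr).
apply: (le_trans (H _ _ _ _)).
- exact/mulr_ge0/ltW.
- by move=> j _; exact: pm.
- by move=> j jN; rewrite P0; have := H1 (Ordinal (jN : (j < N.+2)%N)).
- move=> j jN; have := H2 (Ordinal jN) => /=; rewrite -exprS -addnS.
  have -> : (2 : R) ^+ (n + j.+1) / 2 = 2 ^+ (n + j) by rewrite addnS exprS; field.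
  set DE := _ - _ => h; apply: (le_trans h); rewrite -addrA mulrDr mulrA lerD2l.
  rewrite -[2 * C]/(2 * C) [2 * C]mulrC -mulrA; apply: ler_wpM2l => //.
  rewrite (_ : 2 / L = L^-1 + L^-1); last by rewrite mulrC mulr_natr mulr2n.
  rewrite lerD2l ler_pdivrMr ?exprn_gt0// ler_pdivlMl// -expr2.
  have : (2 : R) ^+ n <= 2 ^+ (n + j.+1) by rewrite ler_eXn2l ?leq_addr// ltr1n.
  lra.
have h1 : 2 * C / L <= eps / 2.
  rewrite ler_pdivrMr// /L; rewrite mulrDr (_ : eps / 2 * (4 * C / eps) = 2 * C); last first.
    by field; rewrite gt_eqF.
  lra.
have h2 : N%:R * (2 * C / L) <= N%:R * (eps / 2) by apply: ler_wpM2l => //; exact: ltW.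
move: h2 hN; rewrite (_ : 2 * (C * L) * B = 4 * C * L * B / 2); last by field.
move: (N%:R * (2 * C / L)) (4 * C * L * B) => a b; lra.
Qed.

End Vanishing.

(** * Vanishing of the gradient *)

Section Liouville.
Context {R : realType}.
Notation V := 'rV[R]_2.
Notation I := (@plane_integral R).
Notation e := (fun l : 'I_2 => delta_mx 0 l : 'rV[R]_2).

Variables (u : 'I_2 -> V -> R) (du : 'I_2 -> 'I_2 -> V -> R) (T : V -> 'M[R]_2)
  (M c1 c2 mu : R).
Hypotheses (Hu : forall i, isC1 (u i) (du i))
  (div0 : forall x, du 0 0 x + du 1 1 x = 0)
  (uM : forall i x, `|u i x| <= M)
  (c1_gt0 : 0 < c1) (c2_gt0 : 0 < c2) (mu_lt2 : mu < 2)
  (cT : forall i j, continuous (fun x => T x i j)) (sT : forall x, (T x)^T = T x)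
  (Tcoco : forall x y, frob_dot (T y - T x) (T y - T x) <=
     c2 * frob_dot (T y - T x) (strain du y - strain du x))
  (Tcoer : forall x y, c1 * (1 + frob_norm (strain du x) + frob_norm (strain du y)) `^ (- mu) *
     frob_dot (strain du y - strain du x) (strain du y - strain du x) <=
     frob_dot (T y - T x) (strain du y - strain du x))
  (weak : forall phi (dphi : 'I_2 -> 'I_2 -> V -> R),
     (forall i, isC1 (phi i) (dphi i)) -> (forall i, Cc (phi i)) ->
     (forall x, dphi 0 0 x + dphi 1 1 x = 0) ->
     I (fun x => \sum_i \sum_j T x i j * dphi j i x +
                 \sum_i (\sum_k u k x * du i k x) * phi i x) = 0).
Notation gradsq := (gradsq du).
Notation gradn := (gradn du).
Notation density := (density du T).

Let M0 : 0 <= M. Proof. by apply: le_trans (uM 0 0). Qed.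

Lemma cutX (r : R) n x : cut r n x = cut r 1 x ^+ n.
Proof. by elim: n => [|n IH]; rewrite ?cut0// cutS IH exprS. Qed.

Lemma CcN2 (w : V -> R) : Cc w -> Cc (fun x => w x * gradsq x).
Proof. by move=> Cw; apply: CcMr => //; exact: gradsq_continuous. Qed.

Lemma gradn_continuous : continuous gradn.
Proof. by apply: cont_comp (gradsq_continuous Hu) _; exact: sqrt_continuous. Qed.

Lemma gradn_ge0 x : 0 <= gradn x. Proof. exact: sqrtr_ge0. Qed.

(** Young's inequality for |D eta| |Du|: the weight z of the first factor is a
geometric mean of the weights under which |Du|^2 and 1 are integrated. *)
Lemma lateral_bound (d : 'I_2 -> V -> R) (k t : R) (z w v : V -> R) :
  (forall j, Cc (d j)) -> 0 <= k -> 0 < t -> Cc w -> Cc v ->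
  (forall x, 0 <= w x) -> (forall x, 0 <= v x) ->
  (forall x j, `|d j x| <= k * z x) -> (forall x, z x ^+ 2 <= w x * v x) ->
  I (fun x => (`|d 0 x| + `|d 1 x|) * gradn x) <=
  2 * k * (t * I (fun x => w x * gradsq x) + (4 * t)^-1 * I v).
Proof.
move=> Cd k0 t0 Cw Cv w0 v0 dz zz.
have CN := CcN2 Cw.
have CL : Cc (fun x => (`|d 0 x| + `|d 1 x|) * gradn x).
  apply: CcMr; first exact: gradn_continuous.
  have Cab j : Cc (fun x => `|d j x|).
    have [cc [b sb]] := Cd j; split; first exact: cont_norm.
    by exists b => x hx; rewrite sb ?normr0.
  exact: CcD.
have CR : Cc (fun x => t * (w x * gradsq x) + (4 * t)^-1 * v x) by apply: CcD; exact: CcZ.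
rewrite -!IZ// -ID; [|exact: CcZ..]; rewrite -IZ//; apply: I_le => //; first exact: CcZ.
move=> x; have g0 := gradn_ge0 x.
have zn : z x * gradn x <= t * (w x * gradsq x) + v x / (4 * t).
  apply: amgm => //; first by apply: mulr_ge0 => //; exact: gradsq_ge0.
  rewrite exprMn (gradn_sq du) [leRHS]mulrAC; apply: ler_wpM2r; last exact: zz.
  exact: gradsq_ge0.
have D j : `|d j x| * gradn x <= k * (t * (w x * gradsq x) + v x / (4 * t)).
  apply: le_trans (ler_wpM2r g0 (dz x j)) _.
  by rewrite -[k * z x * _]mulrA; exact: (ler_wpM2l k0 zn).
rewrite mulrDl [(4 * t)^-1 * _]mulrC; have := D 0; have := D 1.
move: (`|d 0 x| * _) (`|d 1 x| * _) (t * _ + _) => a b c; lra.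
Qed.

(** The choice of w decides where |Du|^2 is charged: on the whole disc in
lateral_self, where it is absorbed for small t, or only on the annulus in
lateral_ring. *)
Lemma lateral_int (r t : R) n (w z : V -> R) : 0 < r -> 0 < t -> Cc w -> (forall x, 0 <= w x) ->
  (forall x j, `|dcut r n.+3 j x| <= n.+3%:R * (12 / r) * z x) ->
  (forall x, z x ^+ 2 <= w x * cut r n.+1 x) ->
  I (fun x => (`|dcut r n.+3 0 x| + `|dcut r n.+3 1 x|) * gradn x) <=
  24 * n.+3%:R * (t * I (fun x => w x * gradsq x) + 4 / t).
Proof.
move=> r0 t0 Cw w0 dz zz.
have tr : 0 < t * r by rewrite mulr_gt0.
have k0 : 0 <= n.+3%:R * (12 / r) by rewrite mulr_ge0// divr_ge0// ltW.
have cd j : Cc (dcut r n.+3 j) by apply: partial_Cc (cut_C1 r n.+1) (cut_Cc r0 n.+2).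
apply: le_trans (lateral_bound cd k0 tr Cw (cut_Cc r0 n) w0 (cut_ge0 r n.+1) dz zz) _.
have H : (4 * (t * r))^-1 * I (cut r n.+1) <= (4 * (t * r))^-1 * (16 * r ^+ 2).
  by apply: ler_wpM2l (I_cut_le r0 n); rewrite invr_ge0 mulr_ge0// ltW.
set X := I (fun x => w x * _).
have -> : 24 * n.+3%:R * (t * X + 4 / t) =
    2 * (n.+3%:R * (12 / r)) * (t * r * X + (4 * (t * r))^-1 * (16 * r ^+ 2)).
  by field; rewrite !gt_eqF.
by apply: ler_wpM2l; [rewrite mulr_ge0|rewrite lerD2l].
Qed.

Lemma lateral_self r t n : 0 < r -> 0 < t ->
  I (fun x => (`|dcut r n.+3 0 x| + `|dcut r n.+3 1 x|) * gradn x) <=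
  24 * n.+3%:R * (t * I (fun x => cut r n.+3 x * gradsq x) + 4 / t).
Proof.
move=> r0 t0; apply: (@lateral_int r t n _ (cut r n.+2)) => //.
- exact: cut_Cc.
- by move=> x; exact: cut_ge0.
- by move=> x j; exact: dcut_bound.
- by move=> x; rewrite expr2 -!cutD !addSn !addnS.
Qed.

Lemma ring_cut_le1 n (r : R) x : 0 < r -> ring_cut n r x <= 1.
Proof. by move=> r0; rewrite /ring_cut; have := cut_le1 (2 * r) n x; have := cut_ge0 (r / 2) n x; lra. Qed.

Lemma ring_cut_Cc n (r : R) : 0 < r -> Cc (ring_cut n.+1 r).
Proof. by move=> r0; apply: CcB; apply: cut_Cc; lra. Qed.

Lemma lateral_ring r t n k : 0 < r -> 0 < t ->
  I (fun x => (`|dcut r n.+3 0 x| + `|dcut r n.+3 1 x|) * gradn x) <=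
  24 * n.+3%:R * (t * I (fun x => ring_cut k.+1 r x * gradsq x) + 4 / t).
Proof.
move=> r0 t0; apply: (@lateral_int r t n _ (fun x => cut r n.+2 x * ring_cut k.+1 r x)) => //.
- exact: ring_cut_Cc.
- by move=> x; exact: ring_cut_ge0.
- move=> x j; have K0 : 0 <= n.+3%:R * (12 / r) by rewrite mulr_ge0// divr_ge0// ltW.
  have nn : 0 <= n.+3%:R * (12 / r) * (cut r n.+2 x * ring_cut k.+1 r x).
    by rewrite mulr_ge0// mulr_ge0 ?cut_ge0 ?ring_cut_ge0.
  have [q1|q1] := leP (sqdist r x) 1; first by rewrite dcut_in// normr0.
  have [q2|q2] := leP 2 (sqdist r x); first by rewrite dcut_out// normr0.
  apply: le_trans (dcut_bound _ _ _ r0) _; rewrite [leRHS]mulrA ler_peMr//.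
    by rewrite mulr_ge0// cut_ge0.
  by apply: ring_cut_ge1 => //; rewrite !ltW.
- move=> x; have c0 := cut_ge0 r n.+1 x; have w0 := ring_cut_ge0 k.+1 x r0.
  have w1 := ring_cut_le1 k.+1 x r0.
  rewrite exprMn mulrC [ring_cut _ _ _ ^+ 2]expr2 -mulrA; apply: ler_wpM2l => //.
  apply: (@le_trans _ _ (1 * cut r n.+1 x)); last by rewrite mul1r.
  apply: ler_pM => //; first by rewrite exprn_ge0// cut_ge0.
  by rewrite expr2 -cutD; apply: cut_anti; exact: (leq_trans (leqnSn n.+1) (leq_addr _ _)).
Qed.

Lemma csupp_mono (f : V -> R) a b : csupp f a -> a <= b -> csupp f b.
Proof. by move=> sf ab x hx; apply: sf; lra. Qed.

Lemma I_quad (sigma kappa : V -> R) : Cc sigma -> Cc kappa ->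
  I (fun x => sigma x + kappa x * (2 + 8 * gradsq x)) =
  I sigma + 2 * I kappa + 8 * I (fun x => kappa x * gradsq x).
Proof.
move=> Cs Ck; have Ckg := CcN2 Ck.
rewrite -!IZ// -!ID//; [|by apply: CcD => //; exact: CcZ|exact: CcZ|exact: CcZ].
by congr I; apply: funext => x; ring.
Qed.

Variables (m k : nat).
Hypotheses (mk : m.+1 = (2 * k.+1)%N) (kmu : mu <= k.+1%:R * (2 - mu)).
Notation E := (energy du T m).
(** Two exponents occur: m+3 is the one that energy_limit puts on |Du|^2, m+5
that of the energy. *)
Definition dirichlet_lo (r : R) := I (fun x => cut r m.+3 x * gradsq x).
Definition dirichlet_hi (r : R) := I (fun x => cut r m.+4.+1 x * gradsq x).
Let K := 32 * energy_const M c2 m.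

Let K_ge0 : 0 <= K.
Proof. by rewrite mulr_ge0//; exact: (energy_const_ge0 uM c2_gt0). Qed.

(** The weight chi of energy_limit is left free: the constant 1 is enough to
bound the energy, and a ring cutoff localizes it. *)
Lemma energy_bound r (chi : V -> R) (delta : R) : 1 <= r -> continuous chi ->
  (forall x, 0 <= chi x) -> (forall x, 1 <= sqdist r x <= 2 -> 1 <= chi x) -> 0 < delta ->
  \forall s \near (0 : R)^'+,
    E r s <= K / r * (I (fun x => cut r m.+3 x * chi x * gradsq x) + 1) + delta.
Proof.
move=> r1; have r0 : 0 < r by lra.
exact: (@energy_limit _ _ _ _ _ _ Hu div0 uM c2_gt0 cT sT Tcoco weak m r r0 chi delta r1).
Qed.

Lemma theta_bound r x y : 0 < r -> 1 <= y ->
  cut r m.+1 x * y `^ mu <= cut (2 * r) 1 x + cut r m.+3 x * y ^+ 2.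
Proof.
move=> r0 y1; have y0 : 0 <= y by lra.
have [c0|c0] := eqVneq (cut r 1 x) 0.
  by rewrite (cutS r m) (cutS r m.+2) c0 !mul0r addr0 cut_ge0.
have {}c0 : 0 < cut r 1 x by rewrite lt_neqAle eq_sym c0 cut_ge0.
rewrite (@cut_eq1 _ (2 * r)); last first.
  by rewrite sqdist_scale ?gt_eqF// ler_pdivrMr// mul1r; have := cut1_gt0 c0; lra.
rewrite (cutX r m.+1) (cutX r m.+3) mk.
by apply: half_power => //; [exact: ltW|exact: ltW].
Qed.

(** Interpolation with the exponents m+3, m+5, m+1 for zeta, omega, theta: the
relation m + 1 = 2 (k + 1) makes half_power bound theta y^mu by 1 + zeta y^2
on the support. *)
Lemma growth_step r lam t delta : 0 < r -> 0 < lam -> 0 < t -> 0 < delta ->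
  \forall s \near (0 : R)^'+,
  dirichlet_lo r <= 4 * M * lam * E r s + 2 * M / (lam * c1) * (96 * r ^+ 2 + 8 * dirichlet_lo r) +
    6 * M * (24 * m.+3%:R * (t * dirichlet_lo r + 4 / t)) + delta.
Proof.
move=> r0 l0 t0 d0.
have r20 : 0 < 2 * r by lra.
have rr : 2 * r <= 2 * (2 * r) by lra.
have c1m := cut_csupp r0; have c2m := cut_csupp r20.
have Cs : Cc (cut (2 * r) 1) by exact: cut_Cc.
have Ck : Cc (cut r m.+3) by exact: cut_Cc.
have zz x : cut r m.+3 x ^+ 2 = cut r m.+4.+1 x * cut r m.+1 x.
  by rewrite expr2 -!cutD !addSn !addnS.
have H := interpolation Hu div0 uM c1_gt0 cT Tcoer (cut_C1 r m.+1)
  (csupp_mono (c1m m.+2) rr) (fun x => cut_ge0 r m.+3 x) (cut_Cc r0 m.+4)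
  (fun x => cut_ge0 r m.+4.+1 x) (fun x => cut_ge0 r m.+1 x) zz
  (@cut_continuous _ (2 * r) 1) (c2m 0%N) (@cut_continuous _ r m.+3) (csupp_mono (c1m m.+2) rr)
  (fun x => cut_ge0 r m.+3 x) (fun x y => @theta_bound r x y r0) l0 d0.
apply: filterS H => s H; apply: le_trans H _.
rewrite I_quad// lerD2r; apply: lerD; last first.
  by apply: ler_wpM2l; [rewrite mulr_ge0|exact: lateral_self].
rewrite lerD2l; apply: ler_wpM2l.
  by rewrite divr_ge0// ?mulr_ge0// ltW// mulr_gt0.
have := I_cut_le r20 0; have := I_cut_le r0 m.+2; rewrite -/(dirichlet_lo r) exprMn; lra.
Qed.

Lemma growth_arith (g en a b d1 d2 X : R) : g <= a * en + b + d1 * g -> 0 <= a ->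
  en <= X * (g + 1) + d2 -> a * X <= 4^-1 -> d1 <= 2^-1 -> 0 <= g -> 0 <= X ->
  g <= 4 * (b + 4^-1 + a * d2).
Proof.
move=> H a0 He aX d12 g0 X0.
have h1 : a * en <= a * (X * (g + 1) + d2) by exact: ler_wpM2l.
have h2 : a * X * (g + 1) <= 4^-1 * (g + 1) by apply: ler_wpM2r => //; lra.
have h3 : d1 * g <= 2^-1 * g by exact: ler_wpM2r.
rewrite mulrDr mulrA in h1; lra.
Qed.

Lemma dirichlet_lo_ge0 r : 0 <= dirichlet_lo r.
Proof.
by apply: I_ge0 => x; apply: mulr_ge0; [exact: cut_ge0|exact: gradsq_ge0].
Qed.

(** With lam proportional to r, the energy term costs lam * E, at most a
fraction of the Dirichlet integral plus a constant by energy_bound, and the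
term with 1/lam costs O(r). Everything containing the Dirichlet integral is
absorbed on the left. *)
Lemma linear_growth : exists B R0, [/\ 0 <= B, 1 <= R0 & forall r, R0 <= r -> dirichlet_lo r <= B * r].
Proof.
(* Each of l0, t and R0 makes the coefficient of one absorbed term at most
1/4. *)
pose l0 : R := (16 * M * K + 1)^-1.
have l0p : 0 < l0 by rewrite invr_gt0 ltr_wpDl//; nonneg.
pose K3 : R := 24 * m.+3%:R.
have K30 : 0 <= K3 by rewrite mulr_ge0.
pose t : R := (24 * M * K3 + 1)^-1.
have t0 : 0 < t by rewrite invr_gt0 ltr_wpDl//; nonneg.
pose R0 : R := 1 + 64 * M / (l0 * c1).
pose B : R := 4 * (2 * M / (l0 * c1) * 96 + 6 * M * (K3 * (4 / t)) + 1 + 4^-1 + 4 * M * l0).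
have lc : 0 < l0 * c1 by rewrite mulr_gt0.
have nn1 : 0 <= 2 * M / (l0 * c1) * 96 by rewrite mulr_ge0// divr_ge0 ?mulr_ge0// ltW.
have nn2 : 0 <= 6 * M * (K3 * (4 / t)).
  by rewrite !mulr_ge0// invr_ge0 ltW.
have nn3 : 0 <= 4 * M * l0 by rewrite !mulr_ge0// ltW.
exists B, R0; split.
- by rewrite /B; lra.
- by rewrite /R0 lerDl divr_ge0 ?mulr_ge0// ltW.
move=> r rR.
have r1 : 1 <= r.
  apply: le_trans rR; rewrite /R0 lerDl divr_ge0 ?mulr_ge0//; exact: ltW.
have r0 : 0 < r by lra.
have lr : 0 < l0 * r by rewrite mulr_gt0.
have EB := @energy_bound r (fun=> 1) 1 r1 (@cont_cst V R 1) (fun=> ler01) (fun _ _ => lexx 1) ltr01.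
have GS := growth_step r0 lr t0 ltr01.
suff : \forall s \near (0 : R)^'+, dirichlet_lo r <= B * r by move=> /filter_ex[].
move: EB GS; apply: filterS2 => s H1 H2.
move: H1; rewrite (_ : I _ = dirichlet_lo r); last by congr I; apply: funext => x; rewrite mulr1.
move=> H1; have g0 := dirichlet_lo_ge0 r.
have := @growth_arith (dirichlet_lo r) (E r s) (4 * M * (l0 * r))
  (2 * M / (l0 * r * c1) * (96 * r ^+ 2) + 6 * M * (K3 * (4 / t)) + 1)
  (2 * M / (l0 * r * c1) * 8 + 6 * M * (K3 * t)) 1 (K / r).
have -> : 4 * M * (l0 * r) * (K / r) = 4 * M * K * l0 by field; rewrite gt_eqF.
have E1 : 2 * M / (l0 * r * c1) * (96 * r ^+ 2) = 2 * M / (l0 * c1) * 96 * r.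
  by field; rewrite !gt_eqF.
rewrite E1 => A.
apply: le_trans (A _ _ H1 _ _ g0 _) _.
- apply: le_trans H2 _; rewrite -/K3 -{}E1.
  by rewrite le_eqVlt; apply/orP; left; apply/eqP; ring.
- by rewrite !mulr_ge0// ltW.
- rewrite /l0 ler_pdivrMr; last by rewrite ltr_wpDl//; nonneg.
  have : 0 <= M * K by exact: mulr_ge0.
  lra.
- have h1 : 2 * M / (l0 * r * c1) * 8 <= 4^-1.
    have -> : 2 * M / (l0 * r * c1) * 8 = (16 * M / (l0 * c1)) / r by field; rewrite !gt_eqF.
    rewrite ler_pdivrMr//; move: rR; rewrite /R0 -![_ * M / _]mulrA.
    by move: (M / (l0 * c1)) => q; lra.
  have h2 : 6 * M * (K3 * t) <= 4^-1.
    rewrite /t !mulrA ler_pdivrMr; last by rewrite ltr_wpDl//; nonneg.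
    have : 0 <= M * K3 by exact: mulr_ge0.
    lra.
  lra.
- by rewrite divr_ge0// ltW.
rewrite /B.
have h1 : 6 * M * (K3 * (4 / t)) <= 6 * M * (K3 * (4 / t)) * r by rewrite ler_peMr.
have h2 : 4 * M * (l0 * r) = 4 * M * l0 * r by ring.
rewrite h2; lra.
Qed.

Lemma E_mono r r' s : 0 < r -> r <= r' -> E r s <= E r' s.
Proof.
move=> r0 rr; have r'0 : 0 < r' by lra.
apply: ler_sum => l _; apply: I_le.
- by apply: CcMr; [exact: density_continuous|exact: cut_Cc].
- by apply: CcMr; [exact: density_continuous|exact: cut_Cc].
by move=> x; apply: ler_wpM2r; [exact: (density_ge0 c1_gt0 Tcoer)|exact: cut_mono].
Qed.

Lemma E_ge0 r s : 0 <= E r s.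
Proof.
apply: sumr_ge0 => l _; apply: I_ge0 => x.
by apply: mulr_ge0; [exact: cut_ge0|exact: (density_ge0 c1_gt0 Tcoer)].
Qed.

Lemma energy_bounded : exists B R0, [/\ 0 <= B, 1 <= R0 & forall r, R0 <= r ->
  \forall s \near (0 : R)^'+, E r s <= B].
Proof.
have [B [R0 [B0 R01 HB]]] := linear_growth.
exists (K * (B + 1) + 1), R0; split => // [|r rR].
  by rewrite addr_ge0// mulr_ge0// addr_ge0.
have r1 : 1 <= r by lra.
have r0 : 0 < r by lra.
have := @energy_bound r (fun=> 1) 1 r1 (@cont_cst V R 1) (fun=> ler01) (fun _ _ => lexx 1) ltr01.
apply: filterS => s; rewrite (_ : I _ = dirichlet_lo r); last by congr I; apply: funext => x; rewrite mulr1.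
move=> H; apply: le_trans H _; rewrite lerD2r -mulrA; apply: ler_wpM2l => //.
rewrite mulrC ler_pdivrMr//; have := HB r rR.
have : 1 <= r by []. lra.
Qed.

Let dring (r : R) (j : 'I_2) (x : V) := dcut (2 * r) m.+4.+1 j x - dcut (r / 2) m.+4.+1 j x.

Lemma dring_bound r j x : 0 < r ->
  `|dring r j x| <= 30 * m.+4.+1%:R / r * cut (2 * r) m.+4 x.
Proof.
move=> r0; have r2 : 0 < 2 * r by lra.
have rh : 0 < r / 2 by lra.
have rr : r / 2 <= 2 * r by lra.
have h1 := dcut_bound m.+3 j x r2; have h2 := dcut_bound m.+3 j x rh.
have h3 := cut_mono m.+4 x rh rr.
apply: (le_trans (ler_normB _ _)).
have h4 : m.+4.+1%:R * (12 / (r / 2)) * cut (r / 2) m.+4 x <=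
          m.+4.+1%:R * (12 / (r / 2)) * cut (2 * r) m.+4 x.
  by apply: ler_wpM2l => //; rewrite mulr_ge0// divr_ge0// ltW.
have -> : 30 * m.+4.+1%:R / r * cut (2 * r) m.+4 x =
   m.+4.+1%:R * (12 / (2 * r)) * cut (2 * r) m.+4 x +
   m.+4.+1%:R * (12 / (r / 2)) * cut (2 * r) m.+4 x.
  by field; rewrite gt_eqF.
by apply: lerD => //; exact: le_trans h2 h4.
Qed.

Lemma dring_int r L : 0 < r -> 0 < L ->
  I (fun x => (`|dring r 0 x| + `|dring r 1 x|) * gradn x) <=
  60 * m.+4.+1%:R / r * (L * dirichlet_lo (2 * r) + 16 * r ^+ 2 / L).
Proof.
move=> r0 L0; have r2 : 0 < 2 * r by lra.
have rh : 0 < r / 2 by lra.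
have k0 : 0 <= 30 * m.+4.+1%:R / r by rewrite divr_ge0 ?mulr_ge0// ltW.
have cd j : Cc (dring r j).
  by apply: CcB; [exact: partial_Cc (cut_C1 _ m.+3) (cut_Cc r2 m.+4)
                 |exact: partial_Cc (cut_C1 _ m.+3) (cut_Cc rh m.+4)].
have zz x : cut (2 * r) m.+4 x ^+ 2 <= cut (2 * r) m.+3 x * cut (2 * r) m.+4.+1 x.
  by rewrite expr2 -!cutD !addSn !addnS.
apply: le_trans (lateral_bound cd k0 L0 (cut_Cc r2 m.+2) (cut_Cc r2 m.+4) (cut_ge0 _ m.+3)
  (cut_ge0 _ m.+4.+1) (fun x j => dring_bound j x r0) zz) _; rewrite -/(dirichlet_lo (2 * r)).
have H : (4 * L)^-1 * I (cut (2 * r) m.+4.+1) <= (4 * L)^-1 * (16 * (2 * r) ^+ 2).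
  by apply: ler_wpM2l (I_cut_le r2 m.+4); rewrite invr_ge0 mulr_ge0// ltW.
have -> : 60 * m.+4.+1%:R / r * (L * dirichlet_lo (2 * r) + 16 * r ^+ 2 / L) =
   2 * (30 * m.+4.+1%:R / r) * (L * dirichlet_lo (2 * r) + (4 * L)^-1 * (16 * (2 * r) ^+ 2)).
  by field; rewrite !gt_eqF.
by apply: ler_wpM2l; [rewrite mulr_ge0|rewrite lerD2l].
Qed.

Lemma ring_energy r s : 0 < r ->
  \sum_l I (fun x => ring_cut m.+4.+1 r x * density l s x) = E (2 * r) s - E (r / 2) s.
Proof.
move=> r0; rewrite /energy -sumrB; apply: eq_bigr => l _.
have cd : continuous (density l s) by exact: density_continuous.
rewrite -IB; [|by apply: CcMr => //; apply: cut_Cc; lra..].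
by congr I; apply: funext => x; rewrite /ring_cut mulrBl.
Qed.

Lemma square_bound x y (w : V -> R) : 0 <= w x -> 1 <= y ->
  w x * y `^ mu <= 0 + w x * y ^+ 2.
Proof.
move=> w0 y1; rewrite add0r; apply: ler_wpM2l => //.
rewrite -powR_mulrn; last lra.
by apply: ler_powR => //; exact: ltW.
Qed.

Lemma ring_dirichlet_lo r : 0 < r -> I (fun x => ring_cut m.+4.+1 r x * gradsq x) <= dirichlet_lo (2 * r).
Proof.
move=> r0; apply: I_le.
- by apply: CcN2; exact: ring_cut_Cc.
- by apply: CcN2; apply: cut_Cc; lra.
move=> x; apply: ler_wpM2r; first exact: gradsq_ge0.
have h1 : cut (2 * r) m.+4.+1 x <= cut (2 * r) m.+3 x.
  by apply: cut_anti; exact: leq_trans (leqnSn _) (leqnSn _).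
by rewrite /ring_cut; have := cut_ge0 (r / 2) m.+4.+1 x; lra.
Qed.

(** Interpolation on the annulus. As the Dirichlet integral is already known
to grow linearly, zeta = omega = theta suffices and y^mu <= y^2 is good
enough. *)
Lemma ring_step r L delta : 0 < r -> 0 < L -> 0 < delta ->
  \forall s \near (0 : R)^'+,
  I (fun x => ring_cut m.+4.+1 r x * gradsq x) <=
    4 * M * (L * r) * (E (2 * r) s - E (r / 2) s) +
    2 * M / (L * r * c1) * (128 * r ^+ 2 + 8 * dirichlet_lo (2 * r)) +
    6 * M * (60 * m.+4.+1%:R / r * (L * dirichlet_lo (2 * r) + 16 * r ^+ 2 / L)) + delta.
Proof.
move=> r0 L0 d0; have r2 : 0 < 2 * r by lra.
have rh : 0 < r / 2 by lra.
have Lr : 0 < L * r by rewrite mulr_gt0.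
have Cz := ring_cut_Cc m.+4 r0.
have z0 x := ring_cut_ge0 m.+4.+1 x r0.
have sz : csupp (ring_cut m.+4.+1 r) (4 * r).
  move=> x hx; rewrite /ring_cut (cut_csupp r2) ?(cut_csupp rh) ?subrr//; lra.
have Hz : isC1 (ring_cut m.+4.+1 r) (dring r) := isC1B (cut_C1 _ _) (cut_C1 _ _).
have s0 : csupp (fun=> 0 : R) (4 * r) by move=> x.
have H := interpolation Hu div0 uM c1_gt0 cT Tcoer Hz sz z0 Cz z0 z0
  (fun x => expr2 (ring_cut m.+4.+1 r x)) (@cont_cst V R 0) s0 Cz.1 sz z0
  (fun x y => @square_bound x y (ring_cut m.+4.+1 r) (z0 x)) Lr d0.
apply: filterS H => s H; apply: le_trans H _.
have C0 : Cc (fun=> 0 : R) by split; [exact: cont_cst|exists (4 * r)].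
rewrite ring_energy// I_quad// I0 add0r lerD2r; apply: lerD; last first.
  by apply: ler_wpM2l; [rewrite mulr_ge0|exact: dring_int].
rewrite lerD2l; apply: ler_wpM2l.
  by rewrite divr_ge0// ?mulr_ge0// ltW// mulr_gt0.
have h1 := ring_dirichlet_lo r0.
have h2 : I (ring_cut m.+4.+1 r) <= I (cut (2 * r) m.+4.+1).
  apply: I_le => //; first exact: cut_Cc.
  by move=> x; rewrite /ring_cut gerBl cut_ge0.
have := I_cut_le r2 m.+4; rewrite exprMn; lra.
Qed.

Lemma recursion_arith (a1 a2 a3 k0 x y z y2 y3 y4 : R) : 0 <= a1 -> 0 <= a2 -> 0 <= a3 ->
  0 <= k0 -> 0 <= x -> 0 <= y -> 0 <= z -> y2 <= a2 * y -> y3 <= a3 * (z + y) ->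
  y4 <= 2 * k0 * z ->
  a1 * x + y2 + y3 + y4 + y <= (a1 + a2 + a3 + 2 * k0 + 1) * (x + y + z).
Proof.
move=> A1 A2 A3 K0 x0 y0 z0 h2 h3 h4.
have := mulr_ge0 A2 x0; have := mulr_ge0 A3 x0; have := mulr_ge0 K0 x0.
have := mulr_ge0 A1 y0; have := mulr_ge0 K0 y0.
have := mulr_ge0 A1 z0; have := mulr_ge0 A2 z0; have := mulr_ge0 K0 z0; nra.
Qed.

(** The energy bound charges |Du|^2 only on the annulus, where ring_step with
lam = L * r converts it back into a difference of energies. *)
Lemma energy_recursion : exists C R1, [/\ 0 <= C, 1 <= R1 & forall L r, 1 <= L -> R1 <= r ->
  \forall s \near (0 : R)^'+,
    E r s <= C * (L * (E (2 * r) s - E (r / 2) s) + L^-1 + L / r)].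
Proof.
have [B [R0 [B0 R01 HB]]] := linear_growth.
set k5 : R := m.+4.+1%:R; have k50 : 0 <= k5 by [].
set a1 : R := 4 * M * K; set a2 : R := 2 * M * K / c1 * (128 + 16 * B).
set a3 : R := 360 * M * K * k5 * (2 * B + 16).
have a10 : 0 <= a1 by rewrite /a1; nonneg.
have a20 : 0 <= a2.
  have ? : 0 <= c1^-1 by rewrite invr_ge0 ltW.
  by apply: mulr_ge0; [apply: mulr_ge0 => //; do 2!apply: mulr_ge0 => //|lra].
have a4 : 0 <= 360 * M * K * k5.
  apply: mulr_ge0; last exact: k50.
  apply: mulr_ge0; last exact: K_ge0.
  by apply: mulr_ge0; [exact: ler0n|exact: M0].
have a30 : 0 <= a3 by apply: mulr_ge0 a4 _; lra.
exists (a1 + a2 + a3 + 2 * K + 1), R0; split => // [|L r L1 rR].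
  by have := K_ge0; lra.
have r1 : 1 <= r by lra.
have r0 : 0 < r by lra.
have L0 : 0 < L by lra.
have Li0 : 0 < L^-1 by rewrite invr_gt0.
have := @energy_bound r (ring_cut m.+4.+1 r) L^-1 r1 (ring_cut_Cc m.+4 r0).1
  (fun x => ring_cut_ge0 _ x r0) (fun x => @ring_cut_ge1 _ m.+4 r x r0) Li0.
have := ring_step r0 L0 ltr01.
apply: filterS2 => s.
set DE := E (2 * r) s - _; set X := I (fun x => ring_cut _ _ _ * _).
set Y := I (fun x => cut _ _ _ * _ * _) => H1 H2.
have DE0 : 0 <= DE by rewrite subr_ge0; apply: E_mono; lra.
have YX : Y <= X.
  have Cr : Cc (fun x => ring_cut m.+4.+1 r x * gradsq x) by apply: CcN2; exact: ring_cut_Cc.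
  apply: I_le => //.
    apply: CcN2; apply: CcMl; [exact: cut_continuous|exact: ring_cut_Cc].
  move=> x; apply: ler_wpM2r; first exact: gradsq_ge0.
  by rewrite ler_piMl ?cut_le1// ring_cut_ge0.
have G2 : dirichlet_lo (2 * r) <= B * (2 * r) by apply: HB; lra.
have b1 : 0 <= 2 * M / (L * r * c1) by rewrite divr_ge0 ?mulr_ge0// ltW// !mulr_gt0.
have b2 : 0 <= 60 * k5 / r by rewrite divr_ge0 ?mulr_ge0// ltW.
have H3 : X <= 4 * M * (L * r) * DE + 2 * M / (L * r * c1) * (128 * r ^+ 2 + 8 * (B * (2 * r))) +
    6 * M * (60 * k5 / r * (L * (B * (2 * r)) + 16 * r ^+ 2 / L)) + 1.
  apply: le_trans H1 _; rewrite lerD2r; apply: lerD.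
    by rewrite lerD2l; apply: ler_wpM2l => //; lra.
  apply: ler_wpM2l; first by rewrite mulr_ge0.
  apply: ler_wpM2l => //; rewrite lerD2r; apply: ler_wpM2l => //; exact: ltW.
have Kr : 0 <= K / r by rewrite divr_ge0// ltW.
have H4 := ler_wpM2l Kr (lerD (le_trans YX H3) (lexx 1)).
apply: le_trans H2 _; apply: (le_trans (lerD H4 (lexx _))).
have ri1 : r^-1 <= 1 by rewrite invf_le1.
have ri0 : 0 <= r^-1 by rewrite invr_ge0 ltW.
have rL : r^-1 <= L / r by rewrite ler_peMl.
rewrite (_ : K / r * _ = a1 * (L * DE) + 2 * M * K / c1 * (128 + 16 * B * r^-1) * L^-1 +
   360 * M * K * k5 * (2 * B * (L / r) + 16 * L^-1) + 2 * K * r^-1); last first.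
  by rewrite /a1; field; rewrite !gt_eqF.
have e2 : 2 * M * K / c1 * (128 + 16 * B * r^-1) * L^-1 <= a2 * L^-1.
  apply: ler_wpM2r; first exact: ltW.
  apply: ler_wpM2l.
    by apply: divr_ge0; [apply: mulr_ge0 K_ge0; apply: mulr_ge0|exact: ltW].
  have hB : B * r^-1 <= B by rewrite ler_piMr.
  lra.
have e3 : 360 * M * K * k5 * (2 * B * (L / r) + 16 * L^-1) <= a3 * (L / r + L^-1).
  rewrite /a3 -[360 * M * K * k5 * _ * _]mulrA; apply: ler_wpM2l; first exact: a4.
  have h1 : 0 <= B * L^-1 by rewrite mulr_ge0// ltW.
  have h2 : 0 <= L / r by rewrite mulr_ge0// ltW.
  by rewrite mulrDl !mulrDr; lra.
have e4 : 2 * K * r^-1 <= 2 * K * (L / r) by apply: ler_wpM2l => //; rewrite mulr_ge0.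
have p1 : 0 <= L * DE by rewrite mulr_ge0// ltW.
have p2 : 0 <= L / r by rewrite mulr_ge0// ltW.
exact: (recursion_arith a10 a20 a30 K_ge0 p1 (ltW Li0) p2 e2 e3 e4).
Qed.

Lemma energy_vanish r eps : 0 < r -> 0 < eps -> \forall s \near (0 : R)^'+, E r s <= eps.
Proof.
move=> r0 e0.
have [B [R0 [B0 R01 HB]]] := energy_bounded.
have [C [R1 [C0 R11 HC]]] := energy_recursion.
apply: (@recursion_vanish _ (fun r s => E r s) C B (R0 + R1) C0 B0) => //.
- lra.
- by move=> *; exact: E_ge0.
- by move=> *; exact: E_mono.
- by move=> r' hr; apply: HB; lra.
- by move=> L r' L1 hr; apply: HC => //; lra.
Qed.

Lemma dirichlet_hi_ge0 r : 0 <= dirichlet_hi r.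
Proof. by apply: I_ge0 => x; apply: mulr_ge0; [exact: cut_ge0|exact: gradsq_ge0]. Qed.

Lemma dirichlet_hi_mono r r' : 0 < r -> r <= r' -> dirichlet_hi r <= dirichlet_hi r'.
Proof.
move=> r0 rr; have r'0 : 0 < r' by lra.
apply: I_le; [by apply: CcN2; exact: cut_Cc..|move=> x].
by apply: ler_wpM2r; [exact: gradsq_ge0|exact: cut_mono].
Qed.

Lemma small_arith (f en Q lat eta : R) (lam := 6 * M * Q / (c1 * eta) + 1) :
  0 < eta -> 0 <= Q -> en <= eta / (12 * M * lam + 1) ->
  f <= 4 * M * lam * en + 2 * M / (lam * c1) * Q + lat + eta / 3 -> f <= lat + eta.
Proof.
move=> e0 Q0 hen; have lam1 : 1 <= lam.
  by rewrite /lam lerDr divr_ge0 ?mulr_ge0// ltW// mulr_gt0.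
have Ml : 0 <= M * lam by apply: mulr_ge0 => //; lra.
have h1 : 4 * M * lam * en <= eta / 3.
  apply: (@le_trans _ _ (4 * M * lam * (eta / (12 * M * lam + 1)))).
    by apply: ler_wpM2l => //; lra.
  rewrite mulrA ler_pdivrMr; last by lra.
  have := mulr_ge0 Ml (ltW e0); lra.
have h2 : 2 * M / (lam * c1) * Q <= eta / 3.
  rewrite mulrAC ler_pdivrMr; last by rewrite mulr_gt0//; lra.
  have -> : eta / 3 * (lam * c1) = 2 * M * Q + eta * c1 / 3.
    by rewrite /lam; field; rewrite !gt_eqF.
  by rewrite lerDl divr_ge0// mulr_ge0// ltW.
lra.
Qed.

(** The energy vanishes with s, so lam may be taken arbitrarily large: every
term of the interpolation inequality but the lateral one disappears. *)
Lemma dirichlet_hi_lateral r : 0 < r -> dirichlet_hi r <=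
  6 * M * I (fun x => (`|dcut r m.+4.+1 0 x| + `|dcut r m.+4.+1 1 x|) * gradn x).
Proof.
move=> r0; apply/ler_addgt0Pr => eta e0.
pose z := cut r m.+4.+1.
have z0 x : 0 <= z x := cut_ge0 r m.+4.+1 x.
have Cz : Cc z := cut_Cc r0 m.+4.
have sz : csupp z (2 * r) := cut_csupp r0 m.+4.
have s0 : csupp (fun=> 0 : R) (2 * r) by move=> x.
have C0 : Cc (fun=> 0 : R) by split; [exact: cont_cst|exists (2 * r)].
pose Q := I (fun x => 0 + z x * (2 + 8 * gradsq x)).
have Q0 : 0 <= Q.
  by apply: I_ge0 => x; rewrite add0r; apply: mulr_ge0 => //; have := gradsq_ge0 du x; lra.
pose lam : R := 6 * M * Q / (c1 * eta) + 1.
have lam0 : 0 < lam by rewrite ltr_wpDl// divr_ge0 ?mulr_ge0// ltW// mulr_gt0.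
have e3 : 0 < eta / 3 by lra.
have H := interpolation Hu div0 uM c1_gt0 cT Tcoer (cut_C1 r m.+3) sz z0 Cz z0 z0
  (fun x => expr2 (z x)) (@cont_cst V R 0) s0 Cz.1 sz z0
  (fun x y => @square_bound x y z (z0 x)) lam0 e3.
have en0 : 0 < eta / (12 * M * lam + 1).
  by rewrite divr_gt0// ltr_wpDl// mulr_ge0 ?mulr_ge0// ltW.
have H2 := energy_vanish r0 en0.
suff : \forall s \near (0 : R)^'+, dirichlet_hi r <= 6 * M * I (fun x =>
   (`|dcut r m.+4.+1 0 x| + `|dcut r m.+4.+1 1 x|) * gradn x) + eta by move=> /filter_ex[].
move: H H2; apply: filterS2 => s h1 h2.
exact: (small_arith e0 Q0 h2 h1).
Qed.

Let k5 : R := 6 * M * (24 * m.+4.+1%:R).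

Let k5_ge0 : 0 <= k5. Proof. by apply: mulr_ge0; apply: mulr_ge0. Qed.

(** The lateral term is absorbed by choosing t in lateral_self. *)
Lemma dirichlet_hi_bounded r : 0 < r -> dirichlet_hi r <= 16 * k5 * (k5 + 1).
Proof.
move=> r0.
have t0 : 0 < (2 * (k5 + 1))^-1 by rewrite invr_gt0; have := k5_ge0; lra.
have M6 : 0 <= 6 * M by apply: mulr_ge0.
have := le_trans (dirichlet_hi_lateral r0) (ler_wpM2l M6 (lateral_self m.+2 r0 t0)).
rewrite -/(dirichlet_hi r) mulrA -/k5 invrK => h.
have h2 : k5 * ((2 * (k5 + 1))^-1 * dirichlet_hi r) <= dirichlet_hi r / 2.
  rewrite mulrA [leRHS]mulrC; apply: ler_wpM2r; first exact: dirichlet_hi_ge0.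
  rewrite ler_pdivrMr; last by have := k5_ge0; lra.
  by have := k5_ge0; lra.
rewrite mulrDr in h.
rewrite (_ : k5 * (4 * (2 * (k5 + 1))) = 8 * k5 * (k5 + 1)) in h; last ring.
rewrite (_ : 16 * k5 * (k5 + 1) = 8 * k5 * (k5 + 1) * 2); last ring.
move: (8 * k5 * (k5 + 1)) h => X h; lra.
Qed.

Lemma ring_dirichlet_hi r : 0 < r ->
  I (fun x => ring_cut m.+4.+1 r x * gradsq x) = dirichlet_hi (2 * r) - dirichlet_hi (r / 2).
Proof.
move=> r0; rewrite /dirichlet_hi -IB; [|by apply: CcN2; apply: cut_Cc; lra..].
by congr I; apply: funext => x; rewrite /ring_cut mulrBl.
Qed.

(** The same lateral term, now charged on the annulus. *)
Lemma dirichlet_hi_recursion L r : 0 < r -> 0 < L ->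
  dirichlet_hi r <= k5 * (L * (dirichlet_hi (2 * r) - dirichlet_hi (r / 2)) + 4 / L).
Proof.
move=> r0 L0; have M6 : 0 <= 6 * M by apply: mulr_ge0.
have := le_trans (dirichlet_hi_lateral r0) (ler_wpM2l M6 (lateral_ring m.+2 m.+4 r0 L0)).
by rewrite ring_dirichlet_hi// mulrA.
Qed.

Lemma dirichlet_hi_eq0 r : 0 < r -> dirichlet_hi r = 0.
Proof.
move=> r0; apply/eqP; rewrite eq_le dirichlet_hi_ge0 andbT.
apply/ler_addgt0Pr => eta e0; rewrite add0r.
suff : \forall s \near (0 : R)^'+, dirichlet_hi r <= eta by move=> /filter_ex[].
have K4 : 0 <= 4 * k5 by apply: mulr_ge0.
have B0 : 0 <= 16 * k5 * (k5 + 1).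
  by apply: mulr_ge0; [apply: mulr_ge0|apply: addr_ge0].
apply: (@recursion_vanish _ (fun r _ => dirichlet_hi r) (4 * k5) (16 * k5 * (k5 + 1)) 1) => //.
- by move=> *; exact: dirichlet_hi_ge0.
- by move=> *; exact: dirichlet_hi_mono.
- by move=> r' hr; apply: nearW => _; apply: dirichlet_hi_bounded; lra.
- move=> L r' L1 hr; apply: nearW => _.
  have r'0 : 0 < r' by lra.
  have L0 : 0 < L by lra.
  apply: (le_trans (dirichlet_hi_recursion r'0 L0)); rewrite [4 * k5]mulrC -[leRHS]mulrA.
  apply: ler_wpM2l; first exact: k5_ge0.
  have h1 : 0 <= L * (dirichlet_hi (2 * r') - dirichlet_hi (r' / 2)).
    by apply: mulr_ge0; [exact: ltW|rewrite subr_ge0; apply: dirichlet_hi_mono; lra].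
  have h2 : 0 <= L / r' by rewrite divr_ge0// ltW.
  move: (dirichlet_hi _ - dirichlet_hi _) h1 => D h1; lra.
Qed.

Lemma gradsq_eq0 x : gradsq x = 0.
Proof.
apply/eqP; rewrite eq_le gradsq_ge0 andbT leNgt; apply/negP => g0.
pose N2 := x 0 0 ^+ 2 + x 0 1 ^+ 2.
have N0 : 0 <= N2 by rewrite addr_ge0// sqr_ge0.
have r0 : 0 < 1 + N2 by lra.
have := @I_gt0 R (fun x => cut (1 + N2) m.+4.+1 x * gradsq x) x.
rewrite -/(dirichlet_hi (1 + N2)) dirichlet_hi_eq0// ltxx => H.
have : false => //; apply: H; first by apply: CcN2; exact: cut_Cc.
  by move=> y; apply: mulr_ge0; [exact: cut_ge0|exact: gradsq_ge0].
rewrite cut_eq1 ?mul1r// /sqdist ler_pdivrMr ?exprn_gt0// mul1r -/N2 expr2.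
by have := mulr_ge0 N0 N0; lra.
Qed.

Lemma du_eq0 i j x : du i j x = 0.
Proof.
have := gradsq_eq0 x; rewrite /gradsq !sum2 => H.
have h a b := sqr_ge0 (du a b x).
have : du i j x ^+ 2 = 0.
  apply: (@ord2P (fun i => du i j x ^+ 2 = 0)); apply: (@ord2P (fun j => du _ j x ^+ 2 = 0));
    have := h 0 0; have := h 0 1; have := h 1 0; have := h 1 1; lra.
by move=> /eqP; rewrite sqrf_eq0 => /eqP.
Qed.

Lemma liouville i x : u i x = u i 0.
Proof.
have A j y s : u i (y + s *: e j) = u i y.
  apply/eqP; rewrite -subr_eq0 (avg_quot j s y (Hu i)) /avg.
  by rewrite (_ : (fun t => _) = (fun=> 0)) ?J_cst ?mulr0//; apply: funext => t; exact: du_eq0.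
by rewrite {1}(row2_split x) A -[x 0 0 *: _]add0r A.
Qed.

End Liouville.

(** * From the vector field to its components *)

Section Components.
Context {R : realType}.
Notation V := 'rV[R]_2.
Notation e := (fun l : 'I_2 => delta_mx 0 l : 'rV[R]_2).

(** Translates continuous differentiability of the field into the form in
which partial derivatives are data. *)
Lemma isC1_component (u : V -> V) i : Ck 1 u ->
  isC1 (fun x => u x 0 i) (fun j x => 'J u x j i).
Proof.
move=> [du cdu].
have E j x : 'J u x j i = 'D_(e j) u x 0 i.
  rewrite jacobianE// derive_mx; last exact: diff_derivable.
  by rewrite mxE.
have di x : differentiable (fun x => u x 0 i) x.
  by apply: (@differentiable_comp _ _ _ _ u (fun y : V => y 0 i)) => //; exact: differentiable_coord.
split.
  by move=> x; apply: differentiable_continuous.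
move=> j; split.
  move=> x; rewrite jacobianE//; apply: derivableP; exact: diff_derivable.
under eq_fun do rewrite E.
by apply: (@cont_comp V V R ('D_(e j) u) (fun y : V => y 0 i)); [exact: cdu|exact: coord_continuous].
Qed.

Lemma frob_norm_ge_coord (y : V) i : `|y 0 i| <= frob_norm y.
Proof.
rewrite /frob_norm -sqrtr_sqr; apply: ler_wsqrtr.
rewrite /frob_dot big_ord1 sum2 -!expr2; move: i; apply: ord2P.
  by rewrite lerDl sqr_ge0.
by rewrite lerDr sqr_ge0.
Qed.

Lemma dominated_continuous (S : topologicalType) (f : S -> R) (g : S -> S -> R) :
  (forall x, continuous (g x)) -> (forall x, g x x = 0) ->
  (forall x y, `|f x - f y| <= g x y) -> continuous f.
Proof.
move=> cg gx fg x; apply/cvgrPdist_lt => eps e0.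
have /cvgrPdist_lt/(_ _ e0) := cg x x; rewrite gx => H.
near=> y; have : `|0 - g x y| < eps by near: y; exact: H.
rewrite sub0r normrN; apply: le_lt_trans.
exact: le_trans (fg x y) (ler_norm _).
Unshelve. all: by end_near. Qed.

End Components.

Theorem theorem3 (R : realType) (h : R -> R) (c1 c2 mu : R)
    (u : 'rV[R]_2 -> 'rV[R]_2)
    (h_ge0 : forall t : R, 0 <= t -> 0 <= h t)
    (h_C2 : Ck_ge0 2 h)
    (h0 : h 0 = 0)
    (dh0 : derive_ge0 h 0 = 0)
    (c1_gt0 : 0 < c1)
    (c2_gt0 : 0 < c2)
    (mu_gt1 : 1 < mu)
    (h_lower : forall t : R, 0 <= t ->
      c1 * (1 + t) `^ (- mu)
        <= Num.min (derive_ge0 (derive_ge0 h) t) (derive_quot h t))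
    (h_upper : forall t : R, 0 <= t ->
      Num.max (derive_ge0 (derive_ge0 h) t) (derive_quot h t)
        <= c2 / (1 + t))
    (mu_lt2 : mu < 2)
    (u_C1 : Ck 1 u)
    (u_sol : weak_solution h u)
    (u_bounded : has_ubound (range (fun x => frob_norm (u x)))) :
  exists c : 'rV[R]_2, forall x : 'rV[R]_2, u x = c.
Proof.
pose us (i : 'I_2) (x : 'rV[R]_2) : R := u x 0 i.
pose du (i j : 'I_2) (x : 'rV[R]_2) : R := 'J u x j i.
have Hu i : isC1 (us i) (du i) := isC1_component i u_C1.
have [divu weak] := u_sol.
have div0 x : du 0 0 x + du 1 1 x = 0.
  by rewrite -(divu x) /divergence sum2.
have [M HM] := u_bounded.
have uM i x : `|us i x| <= M.
  by apply: le_trans (frob_norm_ge_coord _ _) _; apply: HM; exists x.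
have sE x : sym_grad u x = strain du x.
  by apply/matrixP => i j; rewrite sym_gradE [RHS]mxE /du; congr (_ * _); exact: addrC.
pose T x := stress h (strain du x).
have cS i j : continuous (fun x => strain du x i j) by exact: strain_continuous.
have SM A B := @stress_mono R h c1 c2 mu h_C2 dh0 c1_gt0 c2_gt0 mu_gt1 h_lower h_upper A B.
have SM1 A B : frob_dot (stress h B - stress h A) (stress h B - stress h A) <=
    c2 * frob_dot (stress h B - stress h A) (B - A) by case: (SM B A).
have SM2 A B : c1 * (1 + frob_norm A + frob_norm B) `^ (- mu) * frob_dot (B - A) (B - A) <=
    frob_dot (stress h B - stress h A) (B - A) by rewrite addrAC; case: (SM B A).
have cT i j : continuous (fun x => T x i j).
  apply: (@dominated_continuous R _ _ (fun x y => c2 * frob_norm (strain du x - strain du y))) => x.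
  - apply: contM; first exact: cont_cst.
    apply: (@cont_comp _ _ _ _ Num.sqrt); last exact: sqrt_continuous.
    apply: cont_sum => a; apply: cont_sum => b.
    under eq_fun do rewrite !mxE.
    by apply: contM; (apply: contB; first exact: cont_cst); have := cS a b;
      under eq_fun do rewrite mxE.
  - rewrite subrr /frob_norm /frob_dot big1 ?sqrtr0 ?mulr0// => a _.
    by rewrite big1// => b _; rewrite mxE mul0r.
  - move=> y; exact: (@stress_lipschitz R h c1 c2 mu).
have sT x : (T x)^T = T x.
  by apply/matrixP => i j; rewrite /T /stress !mxE addrC.
have [k hk] : exists k : nat, mu <= k.+1%:R * (2 - mu).
  have m2 : 0 < 2 - mu by lra.
  exists (Num.bound (mu / (2 - mu))).
  rewrite -ler_pdivrMr//; apply/ltW; apply: (@lt_trans _ _ (Num.bound (mu / (2 - mu)))%:R).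
    by apply: archi_boundP; rewrite divr_ge0//; lra.
  by rewrite ltr_nat.
exists (u 0) => x; apply/rowP => i.
have L := @liouville R us du T M c1 c2 mu Hu div0 uM c1_gt0 c2_gt0 mu_lt2 cT sT.
apply: (L (fun a b => SM1 _ _) (fun a b => SM2 _ _) _ (2 * k).+1 k _ hk); last by rewrite mulnS.
have bE x' i' : convection u x' 0 i' = \sum_k us k x' * du i' k x' by rewrite mxE.
  have cb i' : continuous (fun x => convection u x 0 i').
    under eq_fun do rewrite bE.
    by apply: cont_sum => l; apply: contM; [exact: (Hu l).1|exact: ((Hu i').2 l).2].
  move=> phi dphi Hphi Cphi d0.
  have W := @weak_form_C1 R T (convection u) cT sT cb _ phi dphi Hphi Cphi d0.
  rewrite -[RHS]W; last first.
    move=> psi tpsi dpsi; rewrite -[RHS](weak psi tpsi dpsi); congr (_ + _).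
    congr plane_integral; apply: funext => y.
    by rewrite (mx_gradient_Hpot h_C2 dh0) sE.
  congr plane_integral; apply: funext => y; congr (_ + _).
by apply: eq_bigr => l _; rewrite bE.
Qed.
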